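(* Let $\varphi$ and $\psi$ be automorphisms of $B_N$. Then $[C_\psi^{\ast}, C_\varphi]=C_\psi^{\ast} C_\varphi- C_\varphi C_\psi^{\ast}$ is compact on the Dirichlet space $\mathcal{D}(B_N)$ if and only if $\varphi\circ\psi=\psi\circ\varphi$.
   Context: The Dirichlet space $\mathcal{D}(B_N)$ consists of holomorphic $f=\sum_\alpha c_\alpha z^\alpha$ on $B_N$ with $\|f\|_{\mathcal D}^2=|f(0)|^2+\sum_\alpha|c_\alpha|^2|\alpha|\frac{\alpha!}{|\alpha|!}<\infty$ (multi-index notation $|\alpha|=\sum\alpha_i$, $\alpha!=\prod\alpha_i!$). $C_\varphi f=f\circ\varphi$ and $C_\psi^\ast$ denotes the adjoint of $C_\psi$ in $\mathcal{D}(B_N)$. Automorphisms are biholomorphic self-maps of $B_N$. *)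

(* Defs.v *)
From Stdlib Require Import Reals Lra Lia List Arith Factorial ClassicalEpsilon.
Import ListNotations.
Open Scope R_scope.

Record C := mkC { re : R; im : R }.
Definition C0 : C := mkC 0 0.
Definition C1 : C := mkC 1 0.
Definition CR (r : R) : C := mkC r 0.
Definition Cadd (a b : C) : C := mkC (re a + re b) (im a + im b).
Definition Copp (a : C) : C := mkC (- re a) (- im a).
Definition Csub (a b : C) : C := Cadd a (Copp b).
Definition Cmul (a b : C) : C :=
  mkC (re a * re b - im a * im b) (re a * im b + im a * re b).
Definition Cconj (a : C) : C := mkC (re a) (- im a).
Definition Cmod2 (a : C) : R := re a * re a + im a * im a.
Definition Cmod (a : C) : R := sqrt (Cmod2 a).
Fixpoint Cpow (a : C) (n : nat) : C :=
  match n with O => C1 | S n' => Cmul a (Cpow a n') end.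
Definition Csum (l : list C) : C := fold_right Cadd C0 l.
Definition Rsum (l : list R) : R := fold_right Rplus 0 l.

Definition Ccv (u : nat -> C) (l : C) : Prop :=
  forall eps, 0 < eps -> exists M, forall n, (M <= n)%nat -> Cmod (Csub (u n) l) < eps.
(** the limit of a complex sequence (meaningful when it converges) *)
Definition Clim (u : nat -> C) : C := epsilon (inhabits C0) (Ccv u).

(** * Points of C^N: sequences vanishing from index N on *)
Definition vec := nat -> C.
Definition vadd (z h : vec) : vec := fun i => Cadd (z i) (h i).
Definition supp_in (N : nat) (z : vec) : Prop := forall i, (N <= i)%nat -> z i = C0.
Definition vnorm2 (N : nat) (z : vec) : R := Rsum (map (fun i => Cmod2 (z i)) (seq 0 N)).
Definition vnorm (N : nat) (z : vec) : R := sqrt (vnorm2 N z).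
Definition in_ball (N : nat) (z : vec) : Prop := supp_in N z /\ vnorm2 N z < 1.

Definition holo (N : nat) (f : vec -> C) : Prop :=
  forall z, in_ball N z -> exists d : nat -> C,
    forall eps, 0 < eps -> exists delta, 0 < delta /\
      forall h, supp_in N h -> 0 < vnorm N h < delta ->
        Cmod (Csub (Csub (f (vadd z h)) (f z))
                   (Csum (map (fun i => Cmul (d i) (h i)) (seq 0 N))))
        <= eps * vnorm N h.

Definition holo_map (N : nat) (phi : vec -> vec) : Prop :=
  forall i, (i < N)%nat -> holo N (fun z => phi z i).
Definition self_map (N : nat) (phi : vec -> vec) : Prop :=
  forall z, in_ball N z -> in_ball N (phi z).
Definition automorphism (N : nat) (phi : vec -> vec) : Prop :=
  holo_map N phi /\ self_map N phi /\
  exists chi, holo_map N chi /\ self_map N chi /\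
    forall z, in_ball N z -> chi (phi z) = z /\ phi (chi z) = z.

(** * Multi-indices (lists of length N) and monomials *)
Fixpoint mi (N k : nat) : list (list nat) :=
  match N with
  | O => if Nat.eqb k 0 then [ [] ] else []
  | S N' => flat_map (fun j => map (cons j) (mi N' (k - j))) (seq 0 (S k))
  end.
Fixpoint monoAux (z : vec) (i : nat) (a : list nat) : C :=
  match a with [] => C1 | n :: t => Cmul (Cpow (z i) n) (monoAux z (S i) t) end.
Definition mono (z : vec) (a : list nat) : C := monoAux z 0 a.
Definition afact (a : list nat) : nat := fold_right mult 1%nat (map fact a).
Definition zero_mi (N : nat) : list nat := repeat 0%nat N.

Definition homog (N : nat) (c : list nat -> C) (k : nat) (z : vec) : C :=
  Csum (map (fun a => Cmul (c a) (mono z a)) (mi N k)).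
Definition expansion (N : nat) (f : vec -> C) (c : list nat -> C) : Prop :=
  forall z, in_ball N z ->
    Ccv (fun n => Csum (map (fun k => homog N c k z) (seq 0 (S n)))) (f z).
Definition coef (N : nat) (f : vec -> C) : list nat -> C :=
  epsilon (inhabits (fun _ => C0)) (expansion N f).

Definition weight (k : nat) (a : list nat) : R := INR k * INR (afact a) / INR (fact k).

Definition inD (N : nat) (f : vec -> C) : Prop :=
  holo N f /\ exists c, expansion N f c /\ exists r,
    Un_cv (fun n => Rsum (map (fun k =>
       Rsum (map (fun a => weight k a * Cmod2 (c a)) (mi N k))) (seq 0 (S n)))) r.

Definition Dterm (N : nat) (c d : list nat -> C) (k : nat) : C :=
  Csum (map (fun a => Cmul (CR (weight k a)) (Cmul (c a) (Cconj (d a)))) (mi N k)).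
Definition Dinner (N : nat) (f g : vec -> C) : C :=
  let c := coef N f in let d := coef N g in
  Cadd (Cmul (c (zero_mi N)) (Cconj (d (zero_mi N))))
       (Clim (fun n => Csum (map (fun k => Dterm N c d k) (seq 0 (S n))))).
Definition Dnorm (N : nat) (f : vec -> C) : R := sqrt (re (Dinner N f f)).

Definition Ccomp (f : vec -> C) (phi : vec -> vec) : vec -> C := fun z => f (phi z).
Definition fsub (f g : vec -> C) : vec -> C := fun z => Csub (f z) (g z).

Definition is_adjoint_comp (N : nat) (psi : vec -> vec) (A : (vec -> C) -> (vec -> C)) : Prop :=
  forall g, inD N g -> inD N (A g) /\
    forall f, inD N f -> Dinner N (Ccomp f psi) g = Dinner N f (A g).

Definition compact_op (N : nat) (T : (vec -> C) -> (vec -> C)) : Prop :=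
  forall u : nat -> (vec -> C), (forall n, inD N (u n)) ->
    (exists M, forall n, Dnorm N (u n) <= M) ->
    exists s : nat -> nat, (forall k, (s k < s (S k))%nat) /\
      exists g, inD N g /\ Un_cv (fun k => Dnorm N (fsub (T (u (s k))) g)) 0.

(* Main.v *)
(** Modulo constants the Dirichlet norm is reproduced by k_w(z) = - log (1 - <z, w>).
    For an automorphism chi with inverse kappa and a = kappa(0), the identity
      (1 - <chi z, chi w>) (1 - <z, a>) (1 - <a, w>) = (1 - |a|^2) (1 - <z, w>)
    gives k_w o chi = k_(kappa w) - k_a modulo constants, so that C_chi preserves the
    seminorm on combinations of kernels and, these being dense, everywhere.  Hence C_psi^*
    is C_chi, chi the inverse of psi, up to a finite rank operator, and the commutator is
    C_(phi o chi) - C_(chi o phi) up to finite rank.  If phi and psi commute it has finite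
    rank.  If it is compact, testing it on k_w / |k_w| as |w| -> 1 shows that
    chi o phi o psi o phi^-1 tends to the identity at the boundary, hence is the identity.

    The identity is explicit for the involutions exchanging 0 and a, and an automorphism
    fixing 0 is a linear isometry by Schwarz's lemma.  The maximum principle for functions
    that are only assumed complex differentiable comes from Goursat's bisection argument in
    logarithmic polar coordinates, which needs only rectangles. *)
From Stdlib Require Import Reals Lra Lia List Arith Factorial ClassicalEpsilon FunctionalExtensionality.
From Coquelicot Require Import Rcomplements Rbar Hierarchy Derive RInt RInt_analysis Continuity AutoDerive PSeries Series Lim_seq.
Require Import Defs.
Import ListNotations.
Open Scope R_scope.

(** * Complex numbers and finite sums *)

(** Membership in the space demands an expansion in monomials, and for f o chi it does not come from
    Cauchy theory. It is built on the coefficient side: kernel combinations go to kernel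
    combinations, the seminorm is preserved, and completeness of the coefficient space yields the
    coefficients of f o chi as a limit.

    With b = psi(0) and chi the inverse of psi, the adjoint sends g to g(0) (1 + k_b) + g o chi -
    g(chi 0). The finite rank part of the commutator thus involves only 1, k_b, k_b o phi and values
    of the function at fixed points.

    In the converse direction |k_w|^2 = - log (1 - |w|^2) is unbounded, while an automorphism
    changes it by a bounded amount only. Since |h(z) - h(0)| is at most a constant times |h| |k_z|,
    an image of k_w / |k_w| of small norm has values small against |k_w| at psi(kap w), kap the
    inverse of phi. There f o phi o chi contributes exactly |k_w|, and only f o chi o phi, that is
    k_w(gam w) / |k_w| with gam = chi o phi o psi o kap, can compensate it. This forces gam w to be
    close to w. *)

Lemma C_ext (a b : C) : re a = re b -> im a = im b -> a = b.
Proof. destruct a, b; simpl; intros -> ->; reflexivity. Qed.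

Definition Ci : C := mkC 0 1.
Definition Cinv (a : C) : C := mkC (re a / Cmod2 a) (- im a / Cmod2 a).
Definition Cdiv (a b : C) : C := Cmul a (Cinv b).

Lemma C_ring : ring_theory C0 C1 Cadd Cmul Csub Copp (@eq C).
Proof.
  constructor; intros; apply C_ext; unfold Csub; simpl; ring.
Qed.

Lemma Cmod2_pos (a : C) : a <> C0 -> 0 < Cmod2 a.
Proof.
  intros H. unfold Cmod2.
  destruct (Req_dec (re a) 0) as [h|h]; [destruct (Req_dec (im a) 0) as [h'|h']|].
  - exfalso; apply H; apply C_ext; assumption.
  - nra.
  - nra.
Qed.

Lemma C1_neq_C0 : C1 <> C0.
Proof. intros H; apply (f_equal re) in H; simpl in H; lra. Qed.

Lemma C_field : field_theory C0 C1 Cadd Cmul Csub Copp Cdiv Cinv (@eq C).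
Proof.
  constructor.
  - exact C_ring.
  - exact C1_neq_C0.
  - reflexivity.
  - intros p Hp. apply Cmod2_pos in Hp. unfold Cmod2 in Hp.
    apply C_ext; simpl; unfold Cmod2; field; lra.
Qed.

Add Field C_field_inst : C_field.

Ltac Csolve := apply C_ext; simpl; try ring.

Lemma Cmod2_ge0 (a : C) : 0 <= Cmod2 a.
Proof. unfold Cmod2; nra. Qed.

Lemma Cmod_ge0 (a : C) : 0 <= Cmod a.
Proof. apply sqrt_pos. Qed.

Lemma Cmod_sqr (a : C) : Cmod a * Cmod a = Cmod2 a.
Proof. apply sqrt_sqrt, Cmod2_ge0. Qed.

Lemma Cmod_0 : Cmod C0 = 0.
Proof. unfold Cmod, Cmod2; simpl. replace (0*0+0*0) with 0 by ring. apply sqrt_0. Qed.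

Lemma Cmod_1 : Cmod C1 = 1.
Proof. unfold Cmod, Cmod2; simpl. replace (1*1+0*0) with 1 by ring. apply sqrt_1. Qed.

Lemma Cmod2_mul (a b : C) : Cmod2 (Cmul a b) = Cmod2 a * Cmod2 b.
Proof. unfold Cmod2; simpl; ring. Qed.

Lemma Cmod_mul (a b : C) : Cmod (Cmul a b) = Cmod a * Cmod b.
Proof. unfold Cmod. rewrite Cmod2_mul. apply sqrt_mult; apply Cmod2_ge0. Qed.

Lemma Cmod_le_of_sqr (a : C) (r : R) : 0 <= r -> Cmod2 a <= r * r -> Cmod a <= r.
Proof.
  intros Hr H. unfold Cmod. rewrite <- (sqrt_square r Hr). now apply sqrt_le_1_alt.
Qed.

Lemma Cmod_lt_of_sqr (a : C) (r : R) : 0 <= r -> Cmod2 a < r * r -> Cmod a < r.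
Proof.
  intros Hr H. pose proof (Cmod_ge0 a). pose proof (Cmod_sqr a). nra.
Qed.

Lemma re_le_Cmod (a : C) : re a <= Cmod a.
Proof. pose proof (Cmod_ge0 a). pose proof (Cmod_sqr a). unfold Cmod2 in *. nra. Qed.

Lemma Rabs_re_le (a : C) : Rabs (re a) <= Cmod a.
Proof.
  pose proof (Cmod_ge0 a). pose proof (Cmod_sqr a). unfold Cmod2 in *.
  apply Rabs_le; split; nra.
Qed.

Lemma Rabs_im_le (a : C) : Rabs (im a) <= Cmod a.
Proof.
  pose proof (Cmod_ge0 a). pose proof (Cmod_sqr a). unfold Cmod2 in *.
  apply Rabs_le; split; nra.
Qed.

Lemma Cmod_le_abs (a : C) : Cmod a <= Rabs (re a) + Rabs (im a).
Proof.
  pose proof (Rabs_pos (re a)). pose proof (Rabs_pos (im a)).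
  apply Cmod_le_of_sqr; [lra|]. unfold Cmod2.
  pose proof (Rsqr_abs (re a)). pose proof (Rsqr_abs (im a)). unfold Rsqr in *. nra.
Qed.

Lemma Cmod_triangle (a b : C) : Cmod (Cadd a b) <= Cmod a + Cmod b.
Proof.
  pose proof (Cmod_ge0 a). pose proof (Cmod_ge0 b).
  apply Cmod_le_of_sqr; [lra|].
  pose proof (Cmod_sqr a) as Ha. pose proof (Cmod_sqr b) as Hb.
  pose proof (re_le_Cmod (Cmul a (Cconj b))) as Hc.
  rewrite Cmod_mul in Hc.
  replace (Cmod (Cconj b)) with (Cmod b) in Hc
    by (unfold Cmod, Cmod2; simpl; f_equal; ring).
  unfold Cmod2 in *; simpl in *. nra.
Qed.

Lemma Cmod_opp (a : C) : Cmod (Copp a) = Cmod a.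
Proof. unfold Cmod, Cmod2; simpl; f_equal; ring. Qed.

Lemma Cmod_conj (a : C) : Cmod (Cconj a) = Cmod a.
Proof. unfold Cmod, Cmod2; simpl; f_equal; ring. Qed.

Lemma Cmod_sub_le (a b : C) : Cmod (Csub a b) <= Cmod a + Cmod b.
Proof. unfold Csub. rewrite <- (Cmod_opp b). apply Cmod_triangle. Qed.

Lemma Cmod_sub_sym (a b : C) : Cmod (Csub a b) = Cmod (Csub b a).
Proof. rewrite <- Cmod_opp. f_equal. ring. Qed.

Lemma Cmod_dist_triangle (a b c : C) :
  Cmod (Csub a c) <= Cmod (Csub a b) + Cmod (Csub b c).
Proof. replace (Csub a c) with (Cadd (Csub a b) (Csub b c)) by ring. apply Cmod_triangle. Qed.

Lemma Cmod_sub_ge (a b : C) : Cmod a - Cmod b <= Cmod (Csub a b).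
Proof.
  pose proof (Cmod_triangle (Csub a b) b) as H.
  replace (Cadd (Csub a b) b) with a in H by ring. lra.
Qed.

Lemma Cmod_eq0 (a : C) : Cmod a = 0 -> a = C0.
Proof.
  intros H. destruct (excluded_middle_informative (a = C0)) as [e|n]; [exact e|].
  apply Cmod2_pos in n. rewrite <- Cmod_sqr, H in n. lra.
Qed.

Lemma Cmod_pos (a : C) : a <> C0 -> 0 < Cmod a.
Proof. intros H. apply sqrt_lt_R0. now apply Cmod2_pos. Qed.

Lemma Cmod_gt0_neq (a : C) : 0 < Cmod a -> a <> C0.
Proof. intros H ->. rewrite Cmod_0 in H. lra. Qed.

Lemma Csub_eq0 (a b : C) : Csub a b = C0 -> a = b.
Proof. intros H. replace a with (Cadd (Csub a b) b) by ring. rewrite H. ring. Qed.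

Lemma Cmod_inv (a : C) : a <> C0 -> Cmod (Cinv a) = / Cmod a.
Proof.
  intros H. pose proof (Cmod_pos a H).
  assert (Cmod (Cmul (Cinv a) a) = 1).
  { replace (Cmul (Cinv a) a) with C1 by (field; exact H). apply Cmod_1. }
  rewrite Cmod_mul in H1. apply Rmult_eq_reg_r with (Cmod a); [|lra].
  rewrite H1. field. lra.
Qed.

Lemma Cmod_div (a b : C) : b <> C0 -> Cmod (Cdiv a b) = Cmod a / Cmod b.
Proof. intros H. unfold Cdiv. rewrite Cmod_mul, Cmod_inv by exact H. reflexivity. Qed.

Lemma Cmod_CR (r : R) : Cmod (CR r) = Rabs r.
Proof.
  unfold Cmod, Cmod2; simpl. replace (r * r + 0 * 0) with (Rsqr r) by (unfold Rsqr; ring).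
  apply sqrt_Rsqr_abs.
Qed.

Lemma CR_neq0 (r : R) : r <> 0 -> CR r <> C0.
Proof. intros H e. apply H. exact (f_equal re e). Qed.

Lemma Cmul_neq0 (a b : C) : a <> C0 -> b <> C0 -> Cmul a b <> C0.
Proof.
  intros Ha Hb. apply Cmod_gt0_neq. rewrite Cmod_mul.
  apply Rmult_lt_0_compat; now apply Cmod_pos.
Qed.

Lemma one_minus_neq0 (x : C) : Cmod x < 1 -> Csub C1 x <> C0.
Proof.
  intros H e. apply Csub_eq0 in e. rewrite <- e, Cmod_1 in H. lra.
Qed.

Lemma Cmod_pow (a : C) (n : nat) : Cmod (Cpow a n) = Cmod a ^ n.
Proof. induction n; simpl; [apply Cmod_1|]. now rewrite Cmod_mul, IHn. Qed.

Lemma Cconj_mul (a b : C) : Cconj (Cmul a b) = Cmul (Cconj a) (Cconj b).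
Proof. Csolve. Qed.
Lemma Cconj_add (a b : C) : Cconj (Cadd a b) = Cadd (Cconj a) (Cconj b).
Proof. Csolve. Qed.
Lemma Cconj_sub (a b : C) : Cconj (Csub a b) = Csub (Cconj a) (Cconj b).
Proof. Csolve. Qed.
Lemma Cconj_conj (a : C) : Cconj (Cconj a) = a.
Proof. Csolve. Qed.
Lemma Cconj_CR (r : R) : Cconj (CR r) = CR r.
Proof. Csolve. Qed.
Lemma Cconj_pow (a : C) (n : nat) : Cconj (Cpow a n) = Cpow (Cconj a) n.
Proof. induction n; simpl; [Csolve|]. now rewrite Cconj_mul, IHn. Qed.
Lemma Cmul_conj (a : C) : Cmul a (Cconj a) = CR (Cmod2 a).
Proof. unfold Cmod2. Csolve. Qed.
Lemma CR_mul (a b : R) : CR (a * b) = Cmul (CR a) (CR b).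
Proof. Csolve. Qed.
Lemma CR_add (a b : R) : CR (a + b) = Cadd (CR a) (CR b).
Proof. Csolve. Qed.
Lemma CR_sub (a b : R) : CR (a - b) = Csub (CR a) (CR b).
Proof. Csolve. Qed.

Lemma re_Csum (l : list C) : re (Csum l) = Rsum (map re l).
Proof. induction l; simpl; congruence. Qed.
Lemma im_Csum (l : list C) : im (Csum l) = Rsum (map im l).
Proof. induction l; simpl; congruence. Qed.

Section Sums.
Context {T : Type}.

Lemma Csum_ext (f g : T -> C) (l : list T) :
  (forall i, In i l -> f i = g i) -> Csum (map f l) = Csum (map g l).
Proof. intros H. f_equal. now apply map_ext_in. Qed.

Lemma Rsum_ext (f g : T -> R) (l : list T) :
  (forall i, In i l -> f i = g i) -> Rsum (map f l) = Rsum (map g l).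
Proof. intros H. f_equal. now apply map_ext_in. Qed.

Lemma Csum_add (f g : T -> C) (l : list T) :
  Csum (map (fun i => Cadd (f i) (g i)) l) = Cadd (Csum (map f l)) (Csum (map g l)).
Proof. induction l as [|a l IH]; simpl; [ring|]. rewrite IH. ring. Qed.

Lemma Csum_sub (f g : T -> C) (l : list T) :
  Csum (map (fun i => Csub (f i) (g i)) l) = Csub (Csum (map f l)) (Csum (map g l)).
Proof. induction l as [|a l IH]; simpl; [ring|]. rewrite IH. ring. Qed.

Lemma Csum_mul_l (c : C) (f : T -> C) (l : list T) :
  Csum (map (fun i => Cmul c (f i)) l) = Cmul c (Csum (map f l)).
Proof. induction l as [|a l IH]; simpl; [ring|]. rewrite IH. ring. Qed.

Lemma Csum_conj (f : T -> C) (l : list T) :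
  Csum (map (fun i => Cconj (f i)) l) = Cconj (Csum (map f l)).
Proof. induction l as [|a l IH]; simpl; [Csolve|]. rewrite IH. Csolve. Qed.

Lemma Csum_zero (f : T -> C) (l : list T) :
  (forall i, In i l -> f i = C0) -> Csum (map f l) = C0.
Proof.
  induction l as [|a l IH]; simpl; intros H; [reflexivity|].
  rewrite H, IH by auto. ring.
Qed.

Lemma Rsum_plus (f g : T -> R) (l : list T) :
  Rsum (map (fun i => f i + g i) l) = Rsum (map f l) + Rsum (map g l).
Proof. induction l as [|a l IH]; simpl; [ring|]. rewrite IH. ring. Qed.

Lemma Rsum_scal (c : R) (f : T -> R) (l : list T) :
  Rsum (map (fun i => c * f i) l) = c * Rsum (map f l).
Proof. induction l as [|a l IH]; simpl; [ring|]. rewrite IH. ring. Qed.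

Lemma Rsum_le (f g : T -> R) (l : list T) :
  (forall i, In i l -> f i <= g i) -> Rsum (map f l) <= Rsum (map g l).
Proof.
  induction l as [|a l IH]; simpl; intros H; [lra|].
  apply Rplus_le_compat; auto.
Qed.

Lemma Rsum_ge0 (f : T -> R) (l : list T) :
  (forall i, In i l -> 0 <= f i) -> 0 <= Rsum (map f l).
Proof.
  induction l as [|a l IH]; simpl; intros H; [lra|].
  apply Rplus_le_le_0_compat; auto.
Qed.

Lemma Rsum_ge_term (f : T -> R) (l : list T) (i : T) :
  (forall i, In i l -> 0 <= f i) -> In i l -> f i <= Rsum (map f l).
Proof.
  induction l as [|a l IH]; simpl; intros H Hi; [contradiction|].
  pose proof (Rsum_ge0 f l (fun i h => H i (or_intror h))).
  destruct Hi as [->|Hi]; [lra|].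
  pose proof (IH (fun i h => H i (or_intror h)) Hi). pose proof (H a (or_introl eq_refl)). lra.
Qed.

Lemma Cmod_Csum_le (f : T -> C) (l : list T) :
  Cmod (Csum (map f l)) <= Rsum (map (fun i => Cmod (f i)) l).
Proof.
  induction l as [|a l IH]; simpl; [rewrite Cmod_0; lra|].
  eapply Rle_trans; [apply Cmod_triangle|lra].
Qed.

Lemma Rsum_const (c : R) (l : list T) : Rsum (map (fun _ => c) l) = INR (length l) * c.
Proof.
  induction l as [|a l IH]; [simpl; ring|]. cbn [map length Rsum fold_right].
  rewrite S_INR. unfold Rsum in IH. rewrite IH. ring.
Qed.
End Sums.

Lemma Csum_app (l m : list C) : Csum (l ++ m) = Cadd (Csum l) (Csum m).
Proof. induction l; simpl; [ring|]. rewrite IHl. ring. Qed.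

Lemma Rsum_app (l m : list R) : Rsum (l ++ m) = Rsum l + Rsum m.
Proof. induction l; simpl; [ring|]. rewrite IHl. ring. Qed.

Lemma Csum_seq_S (f : nat -> C) (n : nat) :
  Csum (map f (seq 0 (S n))) = Cadd (Csum (map f (seq 0 n))) (f n).
Proof. rewrite seq_S, map_app, Csum_app. simpl. ring. Qed.

Lemma Rsum_seq_S (f : nat -> R) (n : nat) :
  Rsum (map f (seq 0 (S n))) = Rsum (map f (seq 0 n)) + f n.
Proof. rewrite seq_S, map_app, Rsum_app. simpl. ring. Qed.

Lemma Ccv_unique (u : nat -> C) (l m : C) : Ccv u l -> Ccv u m -> l = m.
Proof.
  intros Hl Hm. apply Csub_eq0, Cmod_eq0.
  destruct (Rle_lt_or_eq_dec _ _ (Cmod_ge0 (Csub l m))) as [h|h]; [|now symmetry].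
  exfalso. destruct (Hl (Cmod (Csub l m) / 2)) as [n1 H1]; [lra|].
  destruct (Hm (Cmod (Csub l m) / 2)) as [n2 H2]; [lra|].
  specialize (H1 (Nat.max n1 n2) (Nat.le_max_l _ _)).
  specialize (H2 (Nat.max n1 n2) (Nat.le_max_r _ _)).
  pose proof (Cmod_dist_triangle l (u (Nat.max n1 n2)) m).
  rewrite (Cmod_sub_sym l (u _)) in H. lra.
Qed.

Lemma Clim_eq (u : nat -> C) (l : C) : Ccv u l -> Clim u = l.
Proof.
  intros H. apply (Ccv_unique u); [|exact H].
  unfold Clim. apply epsilon_spec. now exists l.
Qed.

Lemma lt_Rmin (x a b : R) : x < Rmin a b -> x < a /\ x < b.
Proof. unfold Rmin. destruct Rle_dec; lra. Qed.

Ltac split_Rmin :=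
  repeat match goal with H : _ < Rmin _ _ |- _ => apply lt_Rmin in H; destruct H end.

Lemma Cmod2_conj (a : C) : Cmod2 (Cconj a) = Cmod2 a.
Proof. unfold Cmod2; simpl; ring. Qed.

Lemma Cconj_inv (a : C) : Cconj (Cinv a) = Cinv (Cconj a).
Proof. unfold Cinv. rewrite Cmod2_conj. apply C_ext; simpl; unfold Rdiv; ring. Qed.

(** * Complex differentiability *)

(* Differentiability at [z] along the increments in [dom], with differential [ell];
   instantiated both with [C] and with vectors supported in [0, N). *)
Section Frechet.
Context {V : Type} (plus : V -> V -> V) (nrm : V -> R) (dom : V -> Prop).
Hypothesis nrm_ge0 : forall h, 0 <= nrm h.

(** The first conjunct stands in for linearity: a bound of [ell h] by a multiple of the norm of h is
    what the product and chain rules draw on. *)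
Definition frechet (f : V -> C) (z : V) (ell : V -> C) : Prop :=
  (exists K, 0 <= K /\ forall h, dom h -> Cmod (ell h) <= K * nrm h) /\
  forall eps, 0 < eps -> exists delta, 0 < delta /\ forall h, dom h -> nrm h < delta ->
    Cmod (Csub (Csub (f (plus z h)) (f z)) (ell h)) <= eps * nrm h.

Lemma frechet_ext f z ell ell' :
  (forall h, dom h -> ell h = ell' h) -> frechet f z ell -> frechet f z ell'.
Proof.
  intros E [[K [HK Hb]] Hd]. split.
  - exists K; split; [exact HK|]. intros h Hh. rewrite <- E by exact Hh. auto.
  - intros eps He. destruct (Hd eps He) as [dl [Hdl H]]. exists dl; split; [exact Hdl|].
    intros h Hh Hn. rewrite <- E by exact Hh. auto.
Qed.

Lemma frechet_lipschitz f z ell : frechet f z ell ->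
  exists K delta, 0 < K /\ 0 < delta /\ forall h, dom h -> nrm h < delta ->
    Cmod (Csub (f (plus z h)) (f z)) <= K * nrm h.
Proof.
  intros [[K [HK Hb]] Hd]. destruct (Hd 1 Rlt_0_1) as [dl [Hdl H]].
  exists (K + 1), dl. split; [lra|split; [exact Hdl|]]. intros h Hh Hn.
  specialize (H h Hh Hn). specialize (Hb h Hh).
  replace (Csub (f (plus z h)) (f z)) with
    (Cadd (Csub (Csub (f (plus z h)) (f z)) (ell h)) (ell h)) by ring.
  eapply Rle_trans; [apply Cmod_triangle|]. lra.
Qed.

Lemma frechet_const c z : frechet (fun _ => c) z (fun _ => C0).
Proof.
  split.
  - exists 0; split; [lra|]. intros h _. rewrite Cmod_0. lra.
  - intros eps He. exists 1; split; [lra|]. intros h _ _.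
    replace (Csub (Csub c c) C0) with C0 by ring. rewrite Cmod_0.
    apply Rmult_le_pos; [lra|apply nrm_ge0].
Qed.

Lemma frechet_add f g z lf lg : frechet f z lf -> frechet g z lg ->
  frechet (fun x => Cadd (f x) (g x)) z (fun h => Cadd (lf h) (lg h)).
Proof.
  intros [[K1 [HK1 Hb1]] Hd1] [[K2 [HK2 Hb2]] Hd2]. split.
  - exists (K1 + K2); split; [lra|]. intros h Hh.
    eapply Rle_trans; [apply Cmod_triangle|]. specialize (Hb1 h Hh). specialize (Hb2 h Hh). lra.
  - intros eps He. destruct (Hd1 (eps / 2)) as [d1 [Hd1p H1]]; [lra|].
    destruct (Hd2 (eps / 2)) as [d2 [Hd2p H2]]; [lra|].
    exists (Rmin d1 d2); split; [now apply Rmin_glb_lt|]. intros h Hh Hn.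
    specialize (H1 h Hh (Rlt_le_trans _ _ _ Hn (Rmin_l _ _))).
    specialize (H2 h Hh (Rlt_le_trans _ _ _ Hn (Rmin_r _ _))).
    replace (Csub (Csub (Cadd (f (plus z h)) (g (plus z h))) (Cadd (f z) (g z))) (Cadd (lf h) (lg h)))
      with (Cadd (Csub (Csub (f (plus z h)) (f z)) (lf h)) (Csub (Csub (g (plus z h)) (g z)) (lg h)))
      by ring.
    eapply Rle_trans; [apply Cmod_triangle|]. lra.
Qed.

Lemma frechet_mul f g z lf lg : frechet f z lf -> frechet g z lg ->
  frechet (fun x => Cmul (f x) (g x)) z (fun h => Cadd (Cmul (f z) (lg h)) (Cmul (g z) (lf h))).
Proof.
  intros Hf Hg.
  destruct (frechet_lipschitz f z lf Hf) as [Kf [df [HKf [Hdf Lf]]]].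
  destruct (frechet_lipschitz g z lg Hg) as [Kg [dg [HKg [Hdg Lg]]]].
  destruct Hf as [[K1 [HK1 Hb1]] Hd1]. destruct Hg as [[K2 [HK2 Hb2]] Hd2].
  pose proof (Cmod_ge0 (f z)) as F0. pose proof (Cmod_ge0 (g z)) as G0.
  split.
  - exists (Cmod (f z) * K2 + Cmod (g z) * K1). split.
    + apply Rplus_le_le_0_compat; now apply Rmult_le_pos.
    + intros h Hh. eapply Rle_trans; [apply Cmod_triangle|]. rewrite !Cmod_mul.
      pose proof (Rmult_le_compat_l _ _ _ F0 (Hb2 h Hh)).
      pose proof (Rmult_le_compat_l _ _ _ G0 (Hb1 h Hh)). lra.
  - intros eps He. set (m := Cmod (f z) + Cmod (g z) + 1).
    assert (Hm : 0 < m) by (unfold m; lra).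
    destruct (Hd1 (eps / (2 * m))) as [d1 [Hd1p H1]]; [apply Rdiv_lt_0_compat; lra|].
    destruct (Hd2 (eps / (2 * m))) as [d2 [Hd2p H2]]; [apply Rdiv_lt_0_compat; lra|].
    (* Half of eps is spent on the two first order errors, the other half on the product P Q of the
       increments, which is quadratic in h by the Lipschitz bounds. *)
    set (d3 := eps / (2 * (Kf * Kg))).
    assert (HK : 0 < Kf * Kg) by now apply Rmult_lt_0_compat.
    assert (Hd3 : 0 < d3) by (apply Rdiv_lt_0_compat; lra).
    exists (Rmin (Rmin d1 d2) (Rmin d3 (Rmin df dg))).
    split; [repeat apply Rmin_glb_lt; assumption|]. intros h Hh Hn.
    assert (nrm h < d1 /\ nrm h < d2 /\ nrm h < d3 /\ nrm h < df /\ nrm h < dg) as (n1 & n2 & n3 & n4 & n5).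
    { split_Rmin. repeat split; assumption. }
    specialize (H1 h Hh n1). specialize (H2 h Hh n2). specialize (Lf h Hh n4). specialize (Lg h Hh n5).
    pose proof (nrm_ge0 h) as N0.
    set (A := Csub (Csub (f (plus z h)) (f z)) (lf h)) in *.
    set (B := Csub (Csub (g (plus z h)) (g z)) (lg h)) in *.
    set (P := Csub (f (plus z h)) (f z)) in *. set (Q := Csub (g (plus z h)) (g z)) in *.
    replace (Csub (Csub (Cmul (f (plus z h)) (g (plus z h))) (Cmul (f z) (g z)))
       (Cadd (Cmul (f z) (lg h)) (Cmul (g z) (lf h))))
      with (Cadd (Cadd (Cmul (f z) B) (Cmul (g z) A)) (Cmul P Q)) by (unfold A, B, P, Q; ring).
    eapply Rle_trans; [apply Cmod_triangle|].
    eapply Rle_trans; [apply Rplus_le_compat_r, Cmod_triangle|]. rewrite !Cmod_mul.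
    assert (E1 : Cmod P * Cmod Q <= eps / 2 * nrm h).
    { apply Rle_trans with ((Kf * nrm h) * (Kg * nrm h)).
      - apply Rmult_le_compat; auto using Cmod_ge0.
      - replace ((Kf * nrm h) * (Kg * nrm h)) with ((Kf * Kg * nrm h) * nrm h) by ring.
        apply Rmult_le_compat_r; [exact N0|].
        replace (eps / 2) with (Kf * Kg * d3) by (unfold d3; field; lra).
        apply Rmult_le_compat_l; lra. }
    assert (E2 : Cmod (f z) * Cmod B + Cmod (g z) * Cmod A <= eps / 2 * nrm h).
    { apply Rle_trans with ((Cmod (f z) + Cmod (g z)) * (eps / (2 * m) * nrm h)).
      { pose proof (Rmult_le_compat_l _ _ _ F0 H2). pose proof (Rmult_le_compat_l _ _ _ G0 H1). lra. }
      replace (eps / 2 * nrm h) with (m * (eps / (2 * m) * nrm h)) by (field; lra).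
      apply Rmult_le_compat_r; [|unfold m; lra].
      apply Rmult_le_pos; [|exact N0]. left; apply Rdiv_lt_0_compat; lra. }
    lra.
Qed.
End Frechet.

Definition cderiv (f : C -> C) (z d : C) : Prop :=
  frechet Cadd Cmod (fun _ => True) f z (Cmul d).

Definition ccont (f : C -> C) (z : C) : Prop :=
  forall eps, 0 < eps -> exists delta, 0 < delta /\
    forall h, Cmod h < delta -> Cmod (Csub (f (Cadd z h)) (f z)) <= eps.

Lemma frechet_comp {V : Type} (plus : V -> V -> V) (nrm : V -> R) (dom : V -> Prop)
  (nrm_ge0 : forall h, 0 <= nrm h) (g : C -> C) (d : C) f z ell :
  frechet plus nrm dom f z ell -> cderiv g (f z) d ->
  frechet plus nrm dom (fun x => g (f x)) z (fun h => Cmul d (ell h)).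
Proof.
  intros Hf [_ Hg].
  destruct (frechet_lipschitz plus nrm dom f z ell Hf) as [Kf [df [HKf [Hdf Lf]]]].
  destruct Hf as [[K [HK Hb]] Hd]. pose proof (Cmod_ge0 d) as D0. split.
  - exists (Cmod d * K). split; [now apply Rmult_le_pos|]. intros h Hh. rewrite Cmod_mul.
    pose proof (Rmult_le_compat_l _ _ _ D0 (Hb h Hh)). lra.
  - intros eps He.
    destruct (Hg (eps / (2 * Kf))) as [d1 [Hd1 H1]]; [apply Rdiv_lt_0_compat; lra|].
    destruct (Hd (eps / (2 * (Cmod d + 1)))) as [d2 [Hd2 H2]]; [apply Rdiv_lt_0_compat; lra|].
    assert (Hd3 : 0 < d1 / Kf) by now apply Rdiv_lt_0_compat.
    exists (Rmin df (Rmin d2 (d1 / Kf))). split; [repeat apply Rmin_glb_lt; assumption|].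
    intros h Hh Hn.
    assert (nrm h < df /\ nrm h < d2 /\ nrm h < d1 / Kf) as (n1 & n2 & n3).
    { split_Rmin. repeat split; assumption. }
    specialize (Lf h Hh n1). specialize (H2 h Hh n2). pose proof (nrm_ge0 h) as N0.
    set (w := Csub (f (plus z h)) (f z)) in *.
    assert (Hw : Cmod w < d1).
    { eapply Rle_lt_trans; [exact Lf|]. replace d1 with (Kf * (d1 / Kf)) by (field; lra).
      apply Rmult_lt_compat_l; lra. }
    specialize (H1 w I Hw). replace (Cadd (f z) w) with (f (plus z h)) in H1 by (unfold w; ring).
    replace (Csub (Csub (g (f (plus z h))) (g (f z))) (Cmul d (ell h))) with
      (Cadd (Csub (Csub (g (f (plus z h))) (g (f z))) (Cmul d w)) (Cmul d (Csub w (ell h)))) by ring.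
    eapply Rle_trans; [apply Cmod_triangle|]. rewrite Cmod_mul.
    assert (E1 : eps / (2 * Kf) * Cmod w <= eps / 2 * nrm h).
    { replace (eps / 2 * nrm h) with (eps / (2 * Kf) * (Kf * nrm h)) by (field; lra).
      apply Rmult_le_compat_l; [left; apply Rdiv_lt_0_compat; lra|exact Lf]. }
    assert (E2 : Cmod d * Cmod (Csub w (ell h)) <= eps / 2 * nrm h).
    { replace (eps / 2 * nrm h) with ((Cmod d + 1) * (eps / (2 * (Cmod d + 1)) * nrm h)) by (field; lra).
      apply Rmult_le_compat; auto using Cmod_ge0; lra. }
    lra.
Qed.

Lemma cderiv_eq f z d d' : d = d' -> cderiv f z d -> cderiv f z d'.
Proof. intros <-; auto. Qed.

Lemma cderiv_const c z : cderiv (fun _ => c) z C0.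
Proof.
  eapply frechet_ext; [|apply (frechet_const Cadd Cmod (fun _ => True) Cmod_ge0)].
  intros h _; simpl; ring.
Qed.

Lemma cderiv_id z : cderiv (fun x => x) z C1.
Proof.
  split.
  - exists 1. split; [lra|]. intros h _. replace (Cmul C1 h) with h by ring. lra.
  - intros eps He. exists 1. split; [lra|]. intros h _ _.
    replace (Csub (Csub (Cadd z h) z) (Cmul C1 h)) with C0 by ring. rewrite Cmod_0.
    apply Rmult_le_pos; [lra|apply Cmod_ge0].
Qed.

Lemma cderiv_add f g z df dg : cderiv f z df -> cderiv g z dg ->
  cderiv (fun x => Cadd (f x) (g x)) z (Cadd df dg).
Proof.
  intros Hf Hg. eapply frechet_ext; [|exact (frechet_add _ _ _ _ _ _ _ _ Hf Hg)].
  intros h _; simpl; ring.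
Qed.

Lemma cderiv_mul f g z df dg : cderiv f z df -> cderiv g z dg ->
  cderiv (fun x => Cmul (f x) (g x)) z (Cadd (Cmul (f z) dg) (Cmul (g z) df)).
Proof.
  intros Hf Hg. eapply frechet_ext; [|exact (frechet_mul _ _ _ Cmod_ge0 _ _ _ _ _ Hf Hg)].
  intros h _; simpl; ring.
Qed.

Lemma cderiv_comp f g z df dg : cderiv f z df -> cderiv g (f z) dg ->
  cderiv (fun x => g (f x)) z (Cmul dg df).
Proof.
  intros Hf Hg. eapply frechet_ext; [|exact (frechet_comp _ _ _ Cmod_ge0 _ _ _ _ _ Hf Hg)].
  intros h _; simpl; ring.
Qed.

Lemma cderiv_sub f g z df dg : cderiv f z df -> cderiv g z dg ->
  cderiv (fun x => Csub (f x) (g x)) z (Csub df dg).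
Proof.
  intros Hf Hg. unfold Csub. apply cderiv_add; [exact Hf|].
  pose proof (cderiv_mul _ _ _ _ _ (cderiv_const (Copp C1) z) Hg) as H.
  eapply cderiv_eq; [|replace (fun x => Copp (g x)) with (fun x => Cmul (Copp C1) (g x)); [exact H|]].
  - cbv beta; ring.
  - apply functional_extensionality; intros x; ring.
Qed.

Lemma cderiv_inv z : z <> C0 -> cderiv Cinv z (Copp (Cmul (Cinv z) (Cinv z))).
Proof.
  intros Hz. pose proof (Cmod_pos z Hz) as Hp. split.
  - exists (Cmod (Copp (Cmul (Cinv z) (Cinv z)))). split; [apply Cmod_ge0|].
    intros h _. rewrite Cmod_mul. lra.
  - intros eps He. set (r := Cmod z) in *.
    assert (H1 : 0 < eps * (r * r * r) / 2) by (apply Rdiv_lt_0_compat; [|lra]; repeat apply Rmult_lt_0_compat; lra).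
    (* The first bound keeps |z + h| >= r / 2; the second then makes the remainder |h|^2 / (r^2 |z +
       h|) at most eps |h|. *)
    exists (Rmin (r / 2) (eps * (r * r * r) / 2)). split; [apply Rmin_glb_lt; lra|].
    intros h _ Hh.
    assert (Cmod h < r / 2 /\ Cmod h < eps * (r * r * r) / 2) as [h1 h2]
      by now apply lt_Rmin.
    assert (Hzh : r / 2 <= Cmod (Cadd z h)).
    { pose proof (Cmod_sub_ge z (Copp h)) as T. rewrite Cmod_opp in T.
      replace (Csub z (Copp h)) with (Cadd z h) in T by ring. unfold r in *; lra. }
    assert (Hn : Cadd z h <> C0) by (apply Cmod_gt0_neq; lra).
    replace (Csub (Csub (Cinv (Cadd z h)) (Cinv z)) (Cmul (Copp (Cmul (Cinv z) (Cinv z))) h))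
      with (Cdiv (Cmul h h) (Cmul (Cmul z z) (Cadd z h))) by (field; split; assumption).
    rewrite Cmod_div by (repeat apply Cmul_neq0; assumption). rewrite !Cmod_mul. fold r.
    pose proof (Cmod_ge0 h) as h0.
    assert (Hd : 0 < r * r * Cmod (Cadd z h)) by (repeat apply Rmult_lt_0_compat; lra).
    apply Rmult_le_reg_r with (r * r * Cmod (Cadd z h)); [exact Hd|].
    unfold Rdiv. rewrite Rmult_assoc, Rinv_l, Rmult_1_r by lra.
    replace (eps * Cmod h * (r * r * Cmod (Cadd z h))) with (Cmod h * (eps * (r * r * Cmod (Cadd z h)))) by ring.
    apply Rmult_le_compat_l; [exact h0|].
    apply Rle_trans with (eps * (r * r * (r / 2))); [lra|].
    apply Rmult_le_compat_l; [lra|]. apply Rmult_le_compat_l; [nra|exact Hzh].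
Qed.

Lemma cderiv_div f g z df dg : g z <> C0 -> cderiv f z df -> cderiv g z dg ->
  exists d, cderiv (fun x => Cdiv (f x) (g x)) z d.
Proof.
  intros Hz Hf Hg. eexists. unfold Cdiv.
  apply cderiv_mul; [exact Hf|]. apply cderiv_comp with (g := Cinv); [exact Hg|].
  now apply cderiv_inv.
Qed.

Lemma cderiv_pow f n z d : cderiv f z d -> exists d', cderiv (fun x => Cpow (f x) n) z d'.
Proof.
  intros Hf. induction n as [|n [d' IH]]; simpl.
  - exists C0. apply cderiv_const.
  - eexists. apply cderiv_mul; [exact Hf|exact IH].
Qed.

Lemma cderiv_local f g z d r : 0 < r -> (forall h, Cmod h < r -> f (Cadd z h) = g (Cadd z h)) ->
  cderiv f z d -> cderiv g z d.
Proof.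
  intros Hr E [HK Hd]. split; [exact HK|]. intros eps He.
  destruct (Hd eps He) as [dl [Hdl H]]. exists (Rmin r dl). split; [now apply Rmin_glb_lt|].
  intros h _ Hh. rewrite <- E by (eapply Rlt_le_trans; [exact Hh|apply Rmin_l]).
  assert (Ez : g z = f z).
  { specialize (E C0). rewrite Cmod_0 in E. replace (Cadd z C0) with z in E by ring.
    symmetry; auto. }
  rewrite Ez. apply H; [exact I|]. eapply Rlt_le_trans; [exact Hh|apply Rmin_r].
Qed.

Lemma cderiv_ccont f z d : cderiv f z d -> ccont f z.
Proof.
  intros H eps He. destruct (frechet_lipschitz _ _ _ _ _ _ H) as [K [dl [HK [Hdl L]]]].
  exists (Rmin dl (eps / K)). split.
  - apply Rmin_glb_lt; [exact Hdl|now apply Rdiv_lt_0_compat].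
  - intros h Hh. assert (Cmod h < dl /\ Cmod h < eps / K) as [h1 h2]
      by now apply lt_Rmin.
    eapply Rle_trans; [apply L; [exact I|exact h1]|].
    replace eps with (K * (eps / K)) by (field; lra). apply Rmult_le_compat_l; lra.
Qed.

(** * Goursat's lemma on rectangles *)

Lemma continuous_eps (f : R -> R) (x : R) :
  (forall eps, 0 < eps -> exists delta, 0 < delta /\
     forall h, Rabs h < delta -> Rabs (f (x + h) - f x) <= eps) ->
  continuous f x.
Proof.
  intros H. apply filterlim_locally. intros eps.
  destruct (H (eps / 2)) as [d [Hd Hf]]; [destruct eps; simpl; lra|].
  exists (mkposreal d Hd). intros y Hy.
  change (Rabs (f y - f x) < eps).
  change (Rabs (y - x) < d) in Hy.
  specialize (Hf (y - x) Hy). assert (E : @eq R (x + (y - x)) y) by ring. rewrite E in Hf.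
  destruct eps as [e He]; simpl in *; lra.
Qed.

(** Affine comparison functions have explicit integrals, so that in Goursat's argument the linear
    parts cancel by arithmetic alone. *)
Lemma RInt_near_affine (f : R -> R) (c d al be eta : R) :
  c <= d -> ex_RInt f c d ->
  (forall t, c <= t <= d -> Rabs (f t - (al + be * t)) <= eta) ->
  Rabs (RInt f c d - (al * (d - c) + be * (d * d - c * c) / 2)) <= (d - c) * eta.
Proof.
  intros Hcd Hex Hb.
  assert (Hl : is_RInt (fun t => al + be * t) c d (al * (d - c) + be * (d * d - c * c) / 2)).
  { replace (al * (d - c) + be * (d * d - c * c) / 2)
      with (minus (al * d + be * (d * d) / 2) (al * c + be * (c * c) / 2))
      by (unfold minus, plus, opp; simpl; field).
    apply (is_RInt_derive (fun t => al * t + be * (t * t) / 2)).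
    - intros x _. auto_derive; [exact I|]. field.
    - intros x _. apply (ex_derive_continuous (fun t => al + be * t)). auto_derive. exact I. }
  rewrite <- (is_RInt_unique _ _ _ _ Hl).
  change (RInt f c d - RInt (fun t => al + be * t) c d) with
    (minus (RInt f c d) (RInt (fun t => al + be * t) c d)).
  rewrite <- RInt_minus; [|exact Hex|eexists; exact Hl].
  apply abs_RInt_le_const; [exact Hcd| |exact Hb].
  apply ex_RInt_minus; [exact Hex|eexists; exact Hl].
Qed.

Lemma pow2_pos (n : nat) : 0 < 2 ^ n.
Proof. apply pow_lt; lra. Qed.

(* Rectangles are [a, a + l] x [c, c + kap l]: halving keeps the aspect ratio [kap]. *)
Lemma bisection_2d (P : R -> R -> R -> Prop) (kap a0 c0 l0 : R) :
  0 < kap -> 0 < l0 ->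
  (forall a c l, 0 < l -> P a c (l / 2) -> P (a + l / 2) c (l / 2) ->
     P a (c + kap * (l / 2)) (l / 2) -> P (a + l / 2) (c + kap * (l / 2)) (l / 2) -> P a c l) ->
  (forall s t, a0 <= s <= a0 + l0 -> exists delta, 0 < delta /\ forall a c l, 0 < l < delta ->
     a <= s <= a + l -> c <= t <= c + kap * l -> P a c l) ->
  P a0 c0 l0.
Proof.
  intros Hk Hl0 Hsplit Hloc.
  destruct (excluded_middle_informative (P a0 c0 l0)) as [H|Hn]; [exact H|exfalso].
  set (len := fun n => l0 / 2 ^ n).
  assert (Hlen : forall n, 0 < len n).
  { intros n. apply Rdiv_lt_0_compat; [lra|apply pow2_pos]. }
  assert (HlenS : forall n, len n / 2 = len (S n)).
  { intros n. unfold len; simpl. field. pose proof (pow2_pos n); lra. }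
  (* Corners travel together with the proof that P fails there, so that the nested sequence [sq] can
     be defined by recursion. *)
  assert (step : forall n (x : {p | ~ P (fst p) (snd p) (len n)}),
    {y : {p | ~ P (fst p) (snd p) (len (S n))} |
      fst (proj1_sig x) <= fst (proj1_sig y) <= fst (proj1_sig x) + len (S n) /\
      snd (proj1_sig x) <= snd (proj1_sig y) <= snd (proj1_sig x) + kap * len (S n)}).
  { intros n [[a c] Hx]; simpl in *.
    pose proof (Hlen (S n)) as Hp. assert (0 < kap * len (S n)) by now apply Rmult_lt_0_compat.
    destruct (excluded_middle_informative (P a c (len (S n)))) as [H1|H1];
      [|exists (exist _ (a, c) H1); simpl; lra].
    destruct (excluded_middle_informative (P (a + len (S n)) c (len (S n)))) as [H2|H2];
      [|exists (exist _ (a + len (S n), c) H2); simpl; lra].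
    destruct (excluded_middle_informative (P a (c + kap * len (S n)) (len (S n)))) as [H3|H3];
      [|exists (exist _ (a, c + kap * len (S n)) H3); simpl; lra].
    destruct (excluded_middle_informative (P (a + len (S n)) (c + kap * len (S n)) (len (S n))))
      as [H4|H4];
      [|exists (exist _ (a + len (S n), c + kap * len (S n)) H4); simpl; lra].
    exfalso. apply Hx. apply Hsplit; [apply Hlen|..]; rewrite HlenS; assumption. }
  assert (Hn0 : ~ P (fst (a0, c0)) (snd (a0, c0)) (len 0%nat)).
  { unfold len; simpl. now replace (l0 / 1) with l0 by field. }
  set (sq := fix sq n : {p | ~ P (fst p) (snd p) (len n)} :=
    match n with O => exist _ (a0, c0) Hn0 | S m => proj1_sig (step m (sq m)) end).
  set (A := fun n => fst (proj1_sig (sq n))). set (B := fun n => snd (proj1_sig (sq n))).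
  assert (HA : forall n, A n <= A (S n) <= A n + len (S n)).
  { intros n. exact (proj1 (proj2_sig (step n (sq n)))). }
  assert (HB : forall n, B n <= B (S n) <= B n + kap * len (S n)).
  { intros n. exact (proj2 (proj2_sig (step n (sq n)))). }
  (* Serves both coordinates. X increases by at most r len (S n), which is exactly the drop of r len
     n, so the upper ends X n + r len n decrease and the intervals are nested. *)
  assert (limit : forall (X : nat -> R) (r : R), 0 < r ->
    (forall n, X n <= X (S n) <= X n + r * len (S n)) ->
    exists x, forall n, X n <= x <= X n + r * len n).
  { intros X r Hr HX.
    assert (Hup : forall n m, X (n + m)%nat + r * len (n + m)%nat <= X n + r * len n).
    { intros n m. induction m as [|m IH]; [rewrite Nat.add_0_r; lra|].
      rewrite Nat.add_succ_r. specialize (HX (n + m)%nat).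
      pose proof (HlenS (n + m)%nat) as E.
      assert (r * len (n + m)%nat = 2 * (r * len (S (n + m)))) by (rewrite <- E; field). lra. }
    assert (Hmono : forall n m, X n <= X (n + m)%nat).
    { intros n m. induction m as [|m IH]; [rewrite Nat.add_0_r; lra|].
      rewrite Nat.add_succ_r. specialize (HX (n + m)%nat). lra. }
    assert (Hall : forall n m, X m <= X n + r * len n).
    { intros n m. pose proof (Rmult_lt_0_compat r (len m) Hr (Hlen m)).
      pose proof (Rmult_lt_0_compat r (len n) Hr (Hlen n)).
      destruct (Nat.le_ge_cases n m) as [h|h].
      - pose proof (Hup n (m - n)%nat) as U. replace (n + (m - n))%nat with m in U by lia. lra.
      - pose proof (Hmono m (n - m)%nat) as U. replace (m + (n - m))%nat with n in U by lia. lra. }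
    destruct (completeness (fun y => exists n, y = X n)) as [x [Hx1 Hx2]].
    - exists (X 0%nat + r * len 0%nat). intros y [n ->]. apply Hall.
    - exists (X 0%nat). now exists 0%nat.
    - exists x. intros n. split.
      + apply Hx1. now exists n.
      + apply Hx2. intros y [m ->]. apply Hall. }
  destruct (limit A 1) as [s Hs]; [lra|intros n; rewrite Rmult_1_l; apply HA|].
  destruct (limit B kap) as [t Ht]; [exact Hk|exact HB|].
  destruct (Hloc s t) as [delta [Hd HP]].
  { specialize (Hs 0%nat). unfold A, len in Hs; simpl in Hs. lra. }
  assert (Hsmall : exists n, len n < delta).
  { destruct (pow_lt_1_zero (/ 2)) with (y := delta / l0) as [n Hn1].
    - rewrite Rabs_pos_eq; lra.
    - apply Rdiv_lt_0_compat; lra.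
    - exists n. specialize (Hn1 n (Nat.le_refl _)).
      rewrite Rabs_pos_eq in Hn1 by (apply pow_le; lra).
      rewrite pow_inv in Hn1. unfold len, Rdiv.
      apply Rmult_lt_reg_r with (/ l0); [now apply Rinv_0_lt_compat|].
      replace (l0 * / 2 ^ n * / l0) with (/ 2 ^ n); [exact Hn1|].
      field. split; [lra|]. pose proof (pow2_pos n); lra. }
  destruct Hsmall as [n Hn1].
  apply (proj2_sig (sq n)). apply HP.
  - split; [apply Hlen|exact Hn1].
  - specialize (Hs n). unfold A in Hs. lra.
  - exact (Ht n).
Qed.

Section Goursat.
Variables (u v : R -> R -> R) (S0 : R).
(** Complex differentiability of u + i v with derivative p + i q. The half-plane s < S0 is what a
    punctured disc of radius exp S0 becomes in logarithmic polar coordinates. *)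
Hypothesis CR_diff : forall s t, s < S0 -> exists p q, forall eps, 0 < eps ->
  exists delta, 0 < delta /\ forall h k, Rabs h < delta -> Rabs k < delta ->
    Rabs (u (s + h) (t + k) - u s t - (p * h - q * k)) <= eps * (Rabs h + Rabs k) /\
    Rabs (v (s + h) (t + k) - v s t - (q * h + p * k)) <= eps * (Rabs h + Rabs k).

(* The imaginary part of the integral of [(u + i v) d(s + i t)] over the boundary. *)
Definition boundary_int (a b c d : R) : R :=
  RInt (fun t => u b t) c d - RInt (fun t => u a t) c d
  - RInt (fun s => v s d) a b + RInt (fun s => v s c) a b.

Lemma CR_diff_continuous s t : s < S0 -> forall eps, 0 < eps -> exists delta, 0 < delta /\
  forall h k, Rabs h < delta -> Rabs k < delta ->
    Rabs (u (s + h) (t + k) - u s t) <= eps /\ Rabs (v (s + h) (t + k) - v s t) <= eps.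
Proof.
  intros Hs eps He. destruct (CR_diff s t Hs) as [p [q Hpq]].
  destruct (Hpq 1 Rlt_0_1) as [d [Hd Hb]].
  set (m := Rabs p + Rabs q + 1).
  assert (Hm : 0 < m) by (unfold m; pose proof (Rabs_pos p); pose proof (Rabs_pos q); lra).
  assert (He' : 0 < eps / (2 * m)) by (apply Rdiv_lt_0_compat; lra).
  exists (Rmin d (eps / (2 * m))). split; [now apply Rmin_glb_lt|].
  intros h k Hh Hk.
  assert (Rabs h < d /\ Rabs h < eps / (2 * m)) as [h1 h2]
    by (split; eapply Rlt_le_trans; [exact Hh|apply Rmin_l|exact Hh|apply Rmin_r]).
  assert (Rabs k < d /\ Rabs k < eps / (2 * m)) as [k1 k2]
    by (split; eapply Rlt_le_trans; [exact Hk|apply Rmin_l|exact Hk|apply Rmin_r]).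
  destruct (Hb h k h1 k1) as [B1 B2].
  assert (E : m * (Rabs h + Rabs k) <= eps).
  { apply Rle_trans with (m * (eps / (2 * m) + eps / (2 * m))).
    - apply Rmult_le_compat_l; lra.
    - right. field. lra. }
  assert (lin : forall x y, (Rabs x + Rabs y) * (Rabs h + Rabs k) + (Rabs h + Rabs k) = m * (Rabs h + Rabs k) ->
     Rabs (x * h + y * k) + 1 * (Rabs h + Rabs k) <= eps).
  { intros x y Exy. pose proof (Rabs_triang (x * h) (y * k)) as T.
    rewrite !Rabs_mult in T.
    pose proof (Rabs_pos x). pose proof (Rabs_pos y). pose proof (Rabs_pos h). pose proof (Rabs_pos k).
    nra. }
  split.
  - pose proof (lin p (-q)) as L. rewrite Rabs_Ropp in L.
    replace (p * h + - q * k) with (p * h - q * k) in L by ring.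
    pose proof (Rabs_triang (u (s + h) (t + k) - u s t - (p * h - q * k)) (p * h - q * k)) as T.
    replace (u (s + h) (t + k) - u s t - (p * h - q * k) + (p * h - q * k))
      with (u (s + h) (t + k) - u s t) in T by ring.
    assert (Rabs (p * h - q * k) + 1 * (Rabs h + Rabs k) <= eps) by (apply L; unfold m; ring). lra.
  - pose proof (lin q p) as L.
    pose proof (Rabs_triang (v (s + h) (t + k) - v s t - (q * h + p * k)) (q * h + p * k)) as T.
    replace (v (s + h) (t + k) - v s t - (q * h + p * k) + (q * h + p * k))
      with (v (s + h) (t + k) - v s t) in T by ring.
    assert (Rabs (q * h + p * k) + 1 * (Rabs h + Rabs k) <= eps) by (apply L; unfold m; ring). lra.
Qed.

Lemma ex_RInt_vertical s c d : s < S0 -> ex_RInt (fun t => u s t) c d.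
Proof.
  intros Hs. apply (ex_RInt_continuous (V := R_CompleteNormedModule)). intros t _.
  apply continuous_eps. intros eps He.
  destruct (CR_diff_continuous s t Hs eps He) as [dl [Hd H]].
  exists dl; split; [exact Hd|]. intros h Hh.
  destruct (H 0 h) as [H1 _]; [rewrite Rabs_R0; exact Hd|exact Hh|].
  now rewrite Rplus_0_r in H1.
Qed.

Lemma ex_RInt_horizontal t a b : a < S0 -> b < S0 -> ex_RInt (fun s => v s t) a b.
Proof.
  intros Ha Hb. apply (ex_RInt_continuous (V := R_CompleteNormedModule)). intros s [_ Hs].
  apply continuous_eps. intros eps He.
  assert (s < S0) by (eapply Rle_lt_trans; [exact Hs|now apply Rmax_lub_lt]).
  destruct (CR_diff_continuous s t H eps He) as [dl [Hd H']].
  exists dl; split; [exact Hd|]. intros h Hh.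
  destruct (H' h 0) as [_ H1]; [exact Hh|rewrite Rabs_R0; exact Hd|].
  now rewrite Rplus_0_r in H1.
Qed.

(** Inner edges are traversed twice in opposite directions and cancel; only the four outer edges
    have to be cut by Chasles' relation. *)
Lemma boundary_int_split a m b c n d : a < S0 -> m < S0 -> b < S0 ->
  boundary_int a b c d =
  boundary_int a m c n + boundary_int m b c n + boundary_int a m n d + boundary_int m b n d.
Proof.
  intros Ha Hm Hb. unfold boundary_int.
  assert (V : forall s, s < S0 -> RInt (fun t => u s t) c d =
     RInt (fun t => u s t) c n + RInt (fun t => u s t) n d).
  { intros s Hs. symmetry. apply (RInt_Chasles (V := R_CompleteNormedModule));
      now apply ex_RInt_vertical. }
  assert (W : forall t, RInt (fun s => v s t) a b =
     RInt (fun s => v s t) a m + RInt (fun s => v s t) m b).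
  { intros t. symmetry. apply (RInt_Chasles (V := R_CompleteNormedModule));
      now apply ex_RInt_horizontal. }
  rewrite (V a Ha), (V b Hb), (W c), (W d). ring.
Qed.

(** The boundary integral of a complex affine function is 0, so what survives is the error eta times
    the perimeter. *)
Lemma boundary_int_near_affine a b c d u0 v0 p q s0 t0 eta :
  a <= b -> b < S0 -> c <= d ->
  (forall s t, a <= s <= b -> c <= t <= d ->
    Rabs (u s t - u0 - (p * (s - s0) - q * (t - t0))) <= eta /\
    Rabs (v s t - v0 - (q * (s - s0) + p * (t - t0))) <= eta) ->
  Rabs (boundary_int a b c d) <= 2 * ((b - a) + (d - c)) * eta.
Proof.
  intros Hab Hb Hcd H.
  assert (Ha : a < S0) by lra.
  assert (U : forall s, a <= s <= b -> Rabs (RInt (fun t => u s t) c d -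
     ((u0 + p * (s - s0) + q * t0) * (d - c) + (- q) * (d * d - c * c) / 2)) <= (d - c) * eta).
  { intros s Hs. apply RInt_near_affine; [exact Hcd|apply ex_RInt_vertical; lra|].
    intros t Ht. destruct (H s t Hs Ht) as [H1 _].
    match goal with |- Rabs ?x <= _ => match type of H1 with Rabs ?y <= _ =>
      replace x with y by ring end end. exact H1. }
  assert (V : forall t, c <= t <= d -> Rabs (RInt (fun s => v s t) a b -
     ((v0 - q * s0 + p * (t - t0)) * (b - a) + q * (b * b - a * a) / 2)) <= (b - a) * eta).
  { intros t Ht. apply RInt_near_affine; [exact Hab|apply ex_RInt_horizontal; lra|].
    intros s Hs. destruct (H s t Hs Ht) as [_ H1].
    match goal with |- Rabs ?x <= _ => match type of H1 with Rabs ?y <= _ =>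
      replace x with y by ring end end. exact H1. }
  pose proof (U a ltac:(lra)) as U1. pose proof (U b ltac:(lra)) as U2.
  pose proof (V c ltac:(lra)) as V1. pose proof (V d ltac:(lra)) as V2.
  unfold boundary_int.
  apply Rabs_le_between in U1. apply Rabs_le_between in U2.
  apply Rabs_le_between in V1. apply Rabs_le_between in V2.
  apply Rabs_le_between. split; lra.
Qed.

Lemma goursat a l c kap : 0 < l -> 0 < kap -> a + l < S0 ->
  boundary_int a (a + l) c (c + kap * l) = 0.
Proof.
  intros Hl Hk Hal.
  (* The bound eps l'^2 is divided by 4 under halving, matching the four quarters. The premise keeps
     every subrectangle inside the half-plane s < S0. *)
  set (P := fun eps a' c' l' => a' + l' <= a + l ->
    Rabs (boundary_int a' (a' + l') c' (c' + kap * l')) <= eps * (l' * l')).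
  assert (HP : forall eps, 0 < eps -> P eps a c l).
  { intros eps He. apply (bisection_2d (P eps) kap); [exact Hk|exact Hl| |].
    - intros a' c' l' Hl' H1 H2 H3 H4 Hle. unfold P in *.
      rewrite (boundary_int_split a' (a' + l' / 2) (a' + l') c' (c' + kap * (l' / 2)) (c' + kap * l'))
        by lra.
      replace (a' + l' / 2 + l' / 2) with (a' + l') in * by field.
      replace (c' + kap * (l' / 2) + kap * (l' / 2)) with (c' + kap * l') in * by field.
      specialize (H1 ltac:(lra)). specialize (H2 ltac:(lra)).
      specialize (H3 ltac:(lra)). specialize (H4 ltac:(lra)).
      apply Rabs_le_between in H1. apply Rabs_le_between in H2.
      apply Rabs_le_between in H3. apply Rabs_le_between in H4.
      replace (eps * (l' * l')) with (4 * (eps * (l' / 2 * (l' / 2)))) by field.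
      apply Rabs_le_between. split; lra.
    - intros s t [Hs1 Hs2]. destruct (CR_diff s t) as [p [q Hpq]]; [lra|].
      (* On a rectangle with sides l' and kap l' the affine error is e' (1 + kap) l' and the
         perimeter 2 (1 + kap) l'; their product is eps l'^2. *)
      set (e' := eps / (2 * ((1 + kap) * (1 + kap)))).
      assert (Hm : 0 < 2 * ((1 + kap) * (1 + kap))) by nra.
      assert (He' : 0 < e') by now apply Rdiv_lt_0_compat.
      destruct (Hpq e' He') as [dl [Hd Hb]].
      exists (dl / (1 + kap)). split; [apply Rdiv_lt_0_compat; lra|].
      intros a' c' l' [Hl' Hld] Has Hct Hle.
      assert (Hld' : (1 + kap) * l' < dl).
      { apply Rmult_lt_reg_r with (/ (1 + kap)); [apply Rinv_0_lt_compat; lra|].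
        replace ((1 + kap) * l' * / (1 + kap)) with l' by (field; lra). exact Hld. }
      replace (eps * (l' * l')) with
        (2 * ((a' + l' - a') + (c' + kap * l' - c')) * (e' * ((1 + kap) * l')))
        by (unfold e'; field; lra).
      assert (0 < kap * l') by now apply Rmult_lt_0_compat.
      apply (boundary_int_near_affine _ _ _ _ (u s t) (v s t) p q s t); [lra|lra|lra|].
      intros s' t' Hs' Ht'.
      assert (h1 : Rabs (s' - s) <= l') by (apply Rabs_le_between; lra).
      assert (k1 : Rabs (t' - t) <= kap * l') by (apply Rabs_le_between; lra).
      destruct (Hb (s' - s) (t' - t)) as [B1 B2]; [lra|lra|].
      replace (s + (s' - s)) with s' in * by ring. replace (t + (t' - t)) with t' in * by ring.
      assert (e' * (Rabs (s' - s) + Rabs (t' - t)) <= e' * ((1 + kap) * l'))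
        by (apply Rmult_le_compat_l; lra).
      split; lra. }
  unfold P in HP.
  destruct (Req_dec (boundary_int a (a + l) c (c + kap * l)) 0) as [E|E]; [exact E|exfalso].
  set (J := boundary_int a (a + l) c (c + kap * l)) in *.
  pose proof (Rabs_pos_lt J E) as HJ.
  specialize (HP (Rabs J / (2 * (l * l)))).
  assert (Hll : 0 < l * l) by nra.
  specialize (HP ltac:(apply Rdiv_lt_0_compat; lra) ltac:(lra)).
  replace (Rabs J / (2 * (l * l)) * (l * l)) with (Rabs J / 2) in HP by (field; lra). lra.
Qed.
End Goursat.

(** * The maximum principle *)

Definition Cexp (s t : R) : C := mkC (exp s * cos t) (exp s * sin t).

Lemma Cexp_plus s t h k : Cexp (s + h) (t + k) = Cmul (Cexp s t) (Cexp h k).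
Proof. unfold Cexp; apply C_ext; simpl; rewrite exp_plus, ?cos_plus, ?sin_plus; ring. Qed.

Lemma Cmod_Cexp s t : Cmod (Cexp s t) = exp s.
Proof.
  pose proof (exp_pos s). unfold Cmod, Cmod2; simpl.
  replace (exp s * cos t * (exp s * cos t) + exp s * sin t * (exp s * sin t))
    with (exp s * exp s * (Rsqr (sin t) + Rsqr (cos t))) by (unfold Rsqr; ring).
  rewrite sin2_cos2, Rmult_1_r. apply sqrt_square. lra.
Qed.

Lemma derivable_pt_lim_0_bound (f : R -> R) (l : R) : derivable_pt_lim f 0 l ->
  forall eps, 0 < eps -> exists delta, 0 < delta /\
    forall h, Rabs h < delta -> Rabs (f h - f 0 - l * h) <= eps * Rabs h.
Proof.
  intros H eps He. destruct (H eps He) as [d Hd]. exists d. split; [apply cond_pos|].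
  intros h Hh. destruct (Req_dec h 0) as [->|n].
  - replace (f 0 - f 0 - l * 0) with 0 by ring. rewrite Rabs_R0. lra.
  - specialize (Hd h n Hh). rewrite Rplus_0_l in Hd.
    replace (f h - f 0 - l * h) with (((f h - f 0) / h - l) * h) by (field; exact n).
    rewrite Rabs_mult. apply Rmult_le_compat_r; [apply Rabs_pos|lra].
Qed.

Lemma Cexp_first_order eps : 0 < eps -> exists delta, 0 < delta /\
  forall a b, Rabs a < delta -> Rabs b < delta ->
    Cmod (Csub (Csub (Cexp a b) C1) (mkC a b)) <= eps * (Rabs a + Rabs b).
Proof.
  (* The error terms add up to at most e |a| + 5 e |b|; e <= 1 serves to keep exp a below 2. *)
  intros He. set (e := Rmin (eps / 8) 1).
  assert (He1 : 0 < e) by (apply Rmin_glb_lt; lra).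
  assert (He2 : e <= eps / 8) by apply Rmin_l. assert (He3 : e <= 1) by apply Rmin_r.
  destruct (derivable_pt_lim_0_bound exp 1 derivable_pt_lim_exp_0 e He1) as [d1 [Hd1 H1]].
  destruct (derivable_pt_lim_0_bound sin 1 derivable_pt_lim_sin_0 e He1) as [d2 [Hd2 H2]].
  destruct (derivable_pt_lim_0_bound cos 0 derivable_pt_lim_cos_0 e He1) as [d3 [Hd3 H3]].
  rewrite exp_0 in H1. rewrite sin_0 in H2. rewrite cos_0 in H3.
  exists (Rmin (Rmin d1 d2) (Rmin d3 (e / 2))). split; [repeat apply Rmin_glb_lt; lra|].
  intros a b Ha Hb. split_Rmin.
  specialize (H1 a ltac:(assumption)). specialize (H2 b ltac:(assumption)).
  specialize (H3 b ltac:(assumption)).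
  pose proof (Rabs_pos a) as a0. pose proof (Rabs_pos b) as b0.
  assert (Ea : Rabs (exp a - 1) <= e).
  { replace (exp a - 1) with ((exp a - 1 - 1 * a) + a) by ring.
    eapply Rle_trans; [apply Rabs_triang|]. nra. }
  assert (Ea3 : 0 < exp a <= 2).
  { split; [apply exp_pos|]. apply Rabs_le_between in Ea. lra. }
  eapply Rle_trans; [apply Cmod_le_abs|]. unfold Cexp; simpl.
  replace (exp a * cos b + - (1) + - a) with ((exp a - 1 - 1 * a) + exp a * (cos b - 1 - 0 * b)) by ring.
  replace (exp a * sin b + - 0 + - b) with (exp a * (sin b - 0 - 1 * b) + (exp a - 1) * b) by ring.
  assert (T1 : forall x, Rabs (exp a * x) <= 2 * Rabs x).
  { intros x. rewrite Rabs_mult, (Rabs_pos_eq (exp a)) by lra.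
    apply Rmult_le_compat_r; [apply Rabs_pos|lra]. }
  pose proof (Rabs_triang (exp a - 1 - 1 * a) (exp a * (cos b - 1 - 0 * b))) as P1.
  pose proof (Rabs_triang (exp a * (sin b - 0 - 1 * b)) ((exp a - 1) * b)) as P2.
  rewrite (Rabs_mult (exp a - 1) b) in P2.
  pose proof (T1 (cos b - 1 - 0 * b)). pose proof (T1 (sin b - 0 - 1 * b)).
  assert (Rabs (exp a - 1) * Rabs b <= e * Rabs b) by (apply Rmult_le_compat_r; lra).
  assert (0 <= (eps / 8 - e) * (Rabs a + Rabs b)) by (apply Rmult_le_pos; lra).
  nra.
Qed.

(** Chain rule for f o exp at s + i t: the differential is multiplication by d exp(s + i t), the
    Cauchy-Riemann form which [goursat] asks for. *)
Lemma polar_CR (f : C -> C) s t d : cderiv f (Cexp s t) d ->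
  forall eps, 0 < eps -> exists delta, 0 < delta /\
    forall h k, Rabs h < delta -> Rabs k < delta ->
    Cmod (Csub (Csub (f (Cexp (s + h) (t + k))) (f (Cexp s t))) (Cmul (Cmul d (Cexp s t)) (mkC h k)))
      <= eps * (Rabs h + Rabs k).
Proof.
  intros [_ Hd] eps He. set (E := Cexp s t) in *.
  pose proof (Cmod_ge0 E) as E0. pose proof (Cmod_ge0 d) as D0.
  assert (DE : 0 <= Cmod d * Cmod E) by now apply Rmult_le_pos.
  set (m := 2 * (Cmod d * Cmod E + 1)).
  set (e1 := Rmin 1 (eps / m)).
  assert (Hm : 0 < m) by (unfold m; lra).
  assert (He1 : 0 < e1) by (apply Rmin_glb_lt; [lra|now apply Rdiv_lt_0_compat]).
  assert (He1a : e1 <= 1) by apply Rmin_l. assert (He1b : e1 <= eps / m) by apply Rmin_r.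
  destruct (Cexp_first_order e1 He1) as [d1 [Hd1 H1]].
  destruct (Hd (eps / (4 * (Cmod E + 1)))) as [d2 [Hd2 H2]]; [apply Rdiv_lt_0_compat; lra|].
  exists (Rmin d1 (d2 / (4 * (Cmod E + 1)))). split; [apply Rmin_glb_lt; [lra|apply Rdiv_lt_0_compat; lra]|].
  intros h k Hh Hk. split_Rmin. specialize (H1 h k ltac:(assumption) ltac:(assumption)).
  rewrite Cexp_plus. fold E. set (X := Csub (Csub (Cexp h k) C1) (mkC h k)) in *.
  set (S := Rabs h + Rabs k) in *.
  assert (S0 : 0 <= S) by (unfold S; pose proof (Rabs_pos h); pose proof (Rabs_pos k); lra).
  set (w := Cmul E (Csub (Cexp h k) C1)).
  assert (Hhk : Cmod (mkC h k) <= S) by (apply (Cmod_le_abs (mkC h k))).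
  assert (Hw : Cmod w <= Cmod E * (2 * S)).
  { unfold w. rewrite Cmod_mul. apply Rmult_le_compat_l; [exact E0|].
    replace (Csub (Cexp h k) C1) with (Cadd X (mkC h k)) by (unfold X; ring).
    eapply Rle_trans; [apply Cmod_triangle|]. nra. }
  assert (Hw2 : Cmod w < d2).
  { assert (S < 2 * (d2 / (4 * (Cmod E + 1)))) by (unfold S; lra).
    eapply Rle_lt_trans; [exact Hw|].
    apply Rle_lt_trans with ((Cmod E + 1) * (2 * S)); [nra|].
    replace d2 with ((Cmod E + 1) * (2 * (2 * (d2 / (4 * (Cmod E + 1)))))) by (field; lra).
    apply Rmult_lt_compat_l; lra. }
  specialize (H2 w I Hw2).
  replace (Cadd E w) with (Cmul E (Cexp h k)) in H2 by (unfold w; ring).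
  replace (Csub (Csub (f (Cmul E (Cexp h k))) (f E)) (Cmul (Cmul d E) (mkC h k))) with
    (Cadd (Csub (Csub (f (Cmul E (Cexp h k))) (f E)) (Cmul d w)) (Cmul (Cmul d E) X))
    by (unfold X, w; ring).
  eapply Rle_trans; [apply Cmod_triangle|]. rewrite !Cmod_mul.
  assert (A1 : eps / (4 * (Cmod E + 1)) * Cmod w <= eps / 2 * S).
  { replace (eps / 2 * S) with (eps / (4 * (Cmod E + 1)) * ((Cmod E + 1) * (2 * S))) by (field; lra).
    apply Rmult_le_compat_l; [left; apply Rdiv_lt_0_compat; lra|]. nra. }
  assert (A2 : Cmod d * Cmod E * Cmod X <= eps / 2 * S).
  { apply Rle_trans with ((Cmod d * Cmod E + 1) * (eps / m * S)).
    - apply Rmult_le_compat; [exact DE|apply Cmod_ge0|lra|].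
      eapply Rle_trans; [exact H1|]. apply Rmult_le_compat_r; lra.
    - right. unfold m. field. lra. }
  lra.
Qed.

(* The circle means of [re f] do not depend on the radius (Goursat in logarithmic
   coordinates, where the vertical sides cancel by periodicity) and tend to [re (f 0)]. *)
Lemma circle_mean_bound (f : C -> C) (rho r B : R) : ccont f C0 ->
  (forall z, 0 < Cmod z < rho -> exists d, cderiv f z d) -> 0 < r < rho ->
  (forall z, Cmod z = r -> re (f z) <= B) -> re (f C0) <= B.
Proof.
  intros Hc Hd [Hr Hrho] HB.
  set (u := fun s t => re (f (Cexp s t))). set (v := fun s t => im (f (Cexp s t))).
  assert (HCR : forall s t, s < ln rho -> exists p q, forall eps, 0 < eps ->
    exists delta, 0 < delta /\ forall h k, Rabs h < delta -> Rabs k < delta ->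
    Rabs (u (s + h) (t + k) - u s t - (p * h - q * k)) <= eps * (Rabs h + Rabs k) /\
    Rabs (v (s + h) (t + k) - v s t - (q * h + p * k)) <= eps * (Rabs h + Rabs k)).
  { intros s t Hs. destruct (Hd (Cexp s t)) as [d Hdd].
    - rewrite Cmod_Cexp. split; [apply exp_pos|].
      rewrite <- (exp_ln rho) by lra. now apply exp_increasing.
    - exists (re (Cmul d (Cexp s t))), (im (Cmul d (Cexp s t))). intros eps He.
      destruct (polar_CR f s t d Hdd eps He) as [dl [Hdl H]]. exists dl; split; [exact Hdl|].
      intros h k Hh Hk. specialize (H h k Hh Hk).
      pose proof (Rabs_re_le (Csub (Csub (f (Cexp (s + h) (t + k))) (f (Cexp s t)))
        (Cmul (Cmul d (Cexp s t)) (mkC h k)))) as P1.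
      pose proof (Rabs_im_le (Csub (Csub (f (Cexp (s + h) (t + k))) (f (Cexp s t)))
        (Cmul (Cmul d (Cexp s t)) (mkC h k)))) as P2.
      unfold u, v. split.
      + eapply Rle_trans; [|exact (Rle_trans _ _ _ P1 H)]. right. apply f_equal. simpl. ring.
      + eapply Rle_trans; [|exact (Rle_trans _ _ _ P2 H)]. right. apply f_equal. simpl. ring. }
  set (M := fun s => RInt (fun t => u s t) 0 (2 * PI)).
  pose proof PI_RGT_0 as HPI.
  assert (Hlr : ln r < ln rho) by now apply ln_increasing.
  assert (HM : forall s, s < ln r -> M s = M (ln r)).
  { intros s Hs. set (l := ln r - s). assert (Hl : 0 < l) by (unfold l; lra).
    (* The aspect ratio 2 PI / l makes the rectangle exactly one period high, so the edges t = 0 and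
       t = 2 PI carry equal integrals. *)
    pose proof (goursat u v (ln rho) HCR s l 0 (2 * PI / l) Hl) as G.
    assert (Hk : 0 < 2 * PI / l) by (apply Rdiv_lt_0_compat; lra).
    specialize (G Hk). replace (s + l) with (ln r) in G by (unfold l; ring).
    specialize (G Hlr).
    replace (0 + 2 * PI / l * l) with (2 * PI) in G by (field; lra).
    unfold boundary_int in G.
    replace (RInt (fun s0 => v s0 (2 * PI)) s (ln r)) with (RInt (fun s0 => v s0 0) s (ln r)) in G.
    - unfold M. lra.
    - apply (RInt_ext (V := R_CompleteNormedModule)). intros x _. unfold v. do 2 f_equal.
      unfold Cexp. now rewrite cos_2PI, sin_2PI, cos_0, sin_0. }
  assert (Hex : forall s, s < ln rho -> ex_RInt (fun t => u s t) 0 (2 * PI)).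
  { intros s Hs. eapply ex_RInt_vertical; eassumption. }
  assert (Hup : M (ln r) <= 2 * PI * B).
  { replace (2 * PI * B) with (RInt (fun _ : R => B) 0 (2 * PI)).
    - apply RInt_le; [lra|now apply Hex|apply (ex_RInt_const (V := R_NormedModule))|].
      intros t _. apply HB. rewrite Cmod_Cexp. now apply exp_ln.
    - rewrite (RInt_const (V := R_CompleteNormedModule)). unfold scal; simpl; unfold mult; simpl. ring. }
  apply le_epsilon. intros eps He.
  destruct (Hc eps He) as [dl [Hdl H]].
  set (s := Rmin (ln r - 1) (ln dl - 1)).
  assert (s < ln r) by (unfold s; eapply Rle_lt_trans; [apply Rmin_l|lra]).
  assert (Hs : exp s < dl).
  { rewrite <- (exp_ln dl) by lra. apply exp_increasing.
    unfold s; eapply Rle_lt_trans; [apply Rmin_r|lra]. }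
  assert (Hlow : 2 * PI * (re (f C0) - eps) <= M s).
  { replace (2 * PI * (re (f C0) - eps)) with (RInt (fun _ : R => re (f C0) - eps) 0 (2 * PI)).
    - apply RInt_le; [lra|apply (ex_RInt_const (V := R_NormedModule))|apply Hex; lra|].
      intros t _. specialize (H (Cexp s t)). rewrite Cmod_Cexp in H. specialize (H Hs).
      replace (Cadd C0 (Cexp s t)) with (Cexp s t) in H by ring.
      pose proof (Rabs_re_le (Csub (f (Cexp s t)) (f C0))) as P. unfold u.
      assert (P' := Rle_trans _ _ _ P H). apply Rabs_le_between in P'. simpl in P'. lra.
    - rewrite (RInt_const (V := R_CompleteNormedModule)). unfold scal; simpl; unfold mult; simpl. ring. }
  rewrite (HM s) in Hlow by assumption.
  apply Rmult_le_reg_l with (2 * PI); [lra|]. lra.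
Qed.

(** * Subsequences, Bolzano-Weierstrass and maxima on a closed disc *)

Definition strictly_inc (s : nat -> nat) : Prop := forall k, (s k < s (S k))%nat.

Lemma strictly_inc_ge s : strictly_inc s -> forall n, (n <= s n)%nat.
Proof. intros H n. induction n; [lia|]. specialize (H n). lia. Qed.

Lemma strictly_inc_lt s : strictly_inc s -> forall m n, (m < n)%nat -> (s m < s n)%nat.
Proof. intros H m n Hmn. induction Hmn; [apply H|]. specialize (H m0). lia. Qed.

Lemma strictly_inc_comp s t : strictly_inc s -> strictly_inc t -> strictly_inc (fun k => s (t k)).
Proof. intros Hs Ht k. apply strictly_inc_lt; auto. Qed.

Lemma Un_cv_subseq u l s : strictly_inc s -> Un_cv u l -> Un_cv (fun k => u (s k)) l.
Proof.
  intros Hs H eps He. destruct (H eps He) as [n0 Hn]. exists n0. intros n h. apply Hn.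
  pose proof (strictly_inc_ge s Hs n). lia.
Qed.

Lemma bounded_subsequence (x : nat -> R) (M : R) : (forall n, Rabs (x n) <= M) ->
  exists s l, strictly_inc s /\ Un_cv (fun k => x (s k)) l.
Proof.
  intros HM.
  destruct (Bolzano_Weierstrass x (fun c => - M <= c <= M)) as [l Hl].
  - apply compact_P3.
  - intros n. apply Rabs_le_between, HM.
  (* The pair holds the last index chosen and the precision wanted next, so that one choice function
     drives the recursion for s. *)
  - assert (near : forall p, exists q, (fst p < q)%nat /\ Rabs (x q - l) < / INR (S (snd p))).
    { intros [m n]; cbn [fst snd].
      assert (Hp : 0 < / INR (S n)) by (apply Rinv_0_lt_compat, lt_0_INR; lia).
      destruct (Hl (disc l (mkposreal _ Hp)) (S m)) as [q [Hq1 Hq2]].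
      - exists (mkposreal _ Hp). intros y Hy. exact Hy.
      - exists q. split; [lia|exact Hq2]. }
    set (nxt := fun p => proj1_sig (constructive_indefinite_description _ (near p))).
    assert (Hnxt : forall p, (fst p < nxt p)%nat /\ Rabs (x (nxt p) - l) < / INR (S (snd p))).
    { intros p. unfold nxt. now destruct (constructive_indefinite_description _ (near p)). }
    set (s := fix s k := match k with O => nxt (O, O) | S j => nxt (s j, S j) end).
    exists s, l. split.
    + intros k. exact (proj1 (Hnxt (s k, S k))).
    + intros eps He. destruct (archimed_cor1 eps He) as [n0 [H1 H2]].
      exists n0. intros n Hn. unfold Rdist.
      assert (E : Rabs (x (s n) - l) < / INR (S n)).
      { destruct n; [exact (proj2 (Hnxt (O, O)))|exact (proj2 (Hnxt (s n, S n)))]. }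
      eapply Rlt_le_trans; [exact E|]. apply Rle_trans with (/ INR n0); [|lra].
      apply Rinv_le_contravar; [apply lt_0_INR; lia|apply le_INR; lia].
Qed.

Lemma bounded_subsequence_C (x : nat -> C) (M : R) : (forall n, Cmod (x n) <= M) ->
  exists s l, strictly_inc s /\ Ccv (fun k => x (s k)) l.
Proof.
  intros HM.
  destruct (bounded_subsequence (fun n => re (x n)) M) as [s [a [Hs Ha]]].
  { intros n. eapply Rle_trans; [apply Rabs_re_le|apply HM]. }
  destruct (bounded_subsequence (fun n => im (x (s n))) M) as [t [b [Ht Hb]]].
  { intros n. eapply Rle_trans; [apply Rabs_im_le|apply HM]. }
  exists (fun k => s (t k)), (mkC a b). split; [now apply strictly_inc_comp|].
  intros eps He. apply (Un_cv_subseq _ _ t Ht) in Ha.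
  destruct (Ha (eps / 2)) as [n1 H1]; [lra|]. destruct (Hb (eps / 2)) as [n2 H2]; [lra|].
  exists (Nat.max n1 n2). intros n Hn.
  specialize (H1 n ltac:(lia)). specialize (H2 n ltac:(lia)). unfold Rdist in *.
  eapply Rle_lt_trans; [apply Cmod_le_abs|]. simpl. unfold Rminus in *. lra.
Qed.

Lemma Ccv_subseq u l s : strictly_inc s -> Ccv u l -> Ccv (fun k => u (s k)) l.
Proof.
  intros Hs H eps He. destruct (H eps He) as [n0 Hn]. exists n0. intros n h. apply Hn.
  pose proof (strictly_inc_ge s Hs n). lia.
Qed.

Lemma Ccv_Cmod_le u l r : Ccv u l -> (forall n, Cmod (u n) <= r) -> Cmod l <= r.
Proof.
  intros H Hr. apply le_epsilon. intros eps He. destruct (H eps He) as [n Hn].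
  specialize (Hn n (Nat.le_refl _)). pose proof (Cmod_sub_ge l (u n)) as P.
  rewrite Cmod_sub_sym in P. specialize (Hr n). lra.
Qed.

(* The bounded gauge G / (1 + G) has a supremum even before G is known to be bounded. *)
Lemma max_on_disc (G : C -> R) (r : R) : 0 <= r -> (forall z, 0 <= G z) ->
  (forall z, Cmod z <= r -> forall eps, 0 < eps -> exists delta, 0 < delta /\
     forall h, Cmod h < delta -> Rabs (G (Cadd z h) - G z) <= eps) ->
  exists z0, Cmod z0 <= r /\ forall z, Cmod z <= r -> G z <= G z0.
Proof.
  intros Hr HG Hc. set (g := fun z => G z / (1 + G z)).
  assert (Hg : forall z, 0 <= g z < 1).
  { intros z. specialize (HG z). unfold g. split.
    - apply Rdiv_le_0_compat; lra.
    - apply Rmult_lt_reg_r with (1 + G z); [lra|]. field_simplify; lra. }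
  destruct (completeness (fun y => exists z, Cmod z <= r /\ y = g z)) as [S [HS1 HS2]].
  { exists 1. intros y [z [_ ->]]. specialize (Hg z). lra. }
  { exists (g C0), C0. rewrite Cmod_0. auto. }
  assert (Hn : forall n : nat, exists z, Cmod z <= r /\ S - / INR (n + 1) < g z).
  { intros n. destruct (excluded_middle_informative
      (exists z, Cmod z <= r /\ S - / INR (n + 1) < g z)) as [h|h]; [exact h|exfalso].
    assert (Hp : 0 < / INR (n + 1)) by (apply Rinv_0_lt_compat, lt_0_INR; lia).
    assert (S <= S - / INR (n + 1)); [|lra]. apply HS2. intros y [z [Hz ->]].
    destruct (Rle_lt_dec (g z) (S - / INR (n + 1))); [assumption|].
    exfalso; apply h; eauto. }
  set (x := fun n => proj1_sig (constructive_indefinite_description _ (Hn n))).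
  assert (Hx : forall n, Cmod (x n) <= r /\ S - / INR (n + 1) < g (x n)).
  { intros n. unfold x. now destruct (constructive_indefinite_description _ (Hn n)). }
  destruct (bounded_subsequence_C x r (fun n => proj1 (Hx n))) as [s [z0 [Hs Hz0]]].
  assert (Hz0r : Cmod z0 <= r) by (eapply Ccv_Cmod_le; [exact Hz0|intros n; apply Hx]).
  exists z0. split; [exact Hz0r|]. intros z Hz.
  assert (HSg : S <= g z0).
  { apply le_epsilon. intros eps He.
    destruct (Hc z0 Hz0r (eps / 2)) as [dl [Hdl Hcz]]; [lra|].
    destruct (Hz0 dl Hdl) as [n1 H1]. destruct (archimed_cor1 (eps / 2)) as [n2 [H2 H3]]; [lra|].
    set (n := Nat.max n1 n2). specialize (H1 n ltac:(lia)).
    specialize (Hcz _ H1). replace (Cadd z0 (Csub (x (s n)) z0)) with (x (s n)) in Hcz by ring.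
    destruct (Hx (s n)) as [_ H4].
    assert (/ INR (s n + 1) <= / INR n2).
    { apply Rinv_le_contravar; [apply lt_0_INR; lia|apply le_INR].
      pose proof (strictly_inc_ge s Hs n). lia. }
    (* The map t / (1 + t) is 1-Lipschitz on t >= 0, so g inherits the continuity of G. *)
    assert (Hlip : g (x (s n)) - g z0 <= eps / 2).
    { pose proof (HG (x (s n))) as p1. pose proof (HG z0) as p2. unfold g.
      apply Rabs_le_between in Hcz.
      replace (G (x (s n)) / (1 + G (x (s n))) - G z0 / (1 + G z0)) with
        ((G (x (s n)) - G z0) / ((1 + G (x (s n))) * (1 + G z0))) by (field; lra).
      apply Rmult_le_reg_r with ((1 + G (x (s n))) * (1 + G z0)); [nra|].
      unfold Rdiv. rewrite Rmult_assoc, Rinv_l, Rmult_1_r by nra.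
      assert (E1 : 1 <= (1 + G (x (s n))) * (1 + G z0)) by nra.
      pose proof (Rmult_le_compat_l (eps * / 2) _ _ ltac:(lra) E1). unfold Rdiv in *. lra. }
    lra. }
  assert (Hgz : g z <= g z0) by (eapply Rle_trans; [apply HS1; eauto|exact HSg]).
  pose proof (HG z) as p1. pose proof (HG z0) as p2. unfold g in Hgz.
  apply Rmult_le_compat_r with (r := (1 + G z) * (1 + G z0)) in Hgz; [|nra].
  replace (G z / (1 + G z) * ((1 + G z) * (1 + G z0))) with (G z * (1 + G z0)) in Hgz by (field; lra).
  replace (G z0 / (1 + G z0) * ((1 + G z) * (1 + G z0))) with (G z0 * (1 + G z)) in Hgz by (field; lra).
  lra.
Qed.

(* The exceptional point 0 spares the removable singularity theorem in Schwarz's lemma. *)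
Lemma max_principle (g : C -> C) (M : R) : 0 <= M ->
  (forall z, Cmod z < 1 -> ccont g z) ->
  (forall z, 0 < Cmod z < 1 -> exists d, cderiv g z d) ->
  (forall eta, 0 < eta -> exists r, r < 1 /\ forall z, r < Cmod z < 1 -> Cmod (g z) <= M + eta) ->
  forall z, Cmod z < 1 -> Cmod (g z) <= M.
Proof.
  intros HM Hc Hd Hb z1 Hz1. apply Rnot_lt_le. intros Hlt.
  set (e := (Cmod (g z1) - M) / 4). assert (He : 0 < e) by (unfold e; lra).
  destruct (Hb e He) as [r [Hr Hbr]].
  set (R1 := (Rmax r (Cmod z1) + 1) / 2).
  assert (Hmx : r <= Rmax r (Cmod z1) /\ Cmod z1 <= Rmax r (Cmod z1) /\ Rmax r (Cmod z1) < 1)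
    by (split; [apply Rmax_l|split; [apply Rmax_r|now apply Rmax_lub_lt]]).
  pose proof (Cmod_ge0 z1) as z10.
  (* The perturbation makes a maximum impossible inside: the mean of e |z0 + h|^2 over |h| = t
     exceeds e |z0|^2 by e t^2. Since e is a quarter of the excess of |g z1| over M, it is too small
     to move the maximum into the collar where |g| <= M + e. *)
  set (G := fun z => Cmod (g z) + e * Cmod2 z).
  destruct (max_on_disc G R1) as [z0 [Hz0 Hmax]].
  - unfold R1; lra.
  - intros z. unfold G. pose proof (Cmod_ge0 (g z)). pose proof (Cmod2_ge0 z).
    pose proof (Rmult_le_pos e (Cmod2 z)). lra.
  - intros z Hz eps Heps. destruct (Hc z ltac:(unfold R1 in Hz; lra) (eps / 2)) as [d1 [Hd1 H1]]; [lra|].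
    exists (Rmin (Rmin d1 1) (eps / (6 * e))). split.
    { repeat apply Rmin_glb_lt; try lra. apply Rdiv_lt_0_compat; lra. }
    intros h Hh. split_Rmin. specialize (H1 h ltac:(assumption)). unfold G.
    pose proof (Cmod_sub_ge (g (Cadd z h)) (g z)) as P1.
    pose proof (Cmod_sub_ge (g z) (g (Cadd z h))) as P2. rewrite Cmod_sub_sym in P2.
    assert (Q : Rabs (Cmod2 (Cadd z h) - Cmod2 z) <= 3 * Cmod h).
    { rewrite <- !Cmod_sqr. pose proof (Cmod_ge0 h) as h0. pose proof (Cmod_ge0 z) as zz.
      pose proof (Cmod_triangle z h) as T1.
      pose proof (Cmod_sub_ge z (Copp h)) as T2. rewrite Cmod_opp in T2.
      replace (Csub z (Copp h)) with (Cadd z h) in T2 by ring.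
      pose proof (Cmod_ge0 (Cadd z h)).
      assert (Cmod z < 1) by (unfold R1 in Hz; lra).
      apply Rabs_le_between. split; nra. }
    assert (Q2 : e * (3 * Cmod h) <= eps / 2).
    { replace (eps / 2) with (e * (3 * (eps / (6 * e)))) by (field; lra).
      apply Rmult_le_compat_l; lra. }
    apply Rabs_le_between in Q. apply Rabs_le_between. split; nra.
  - assert (HGz1 : Cmod (g z1) <= G z0).
    { eapply Rle_trans; [|apply (Hmax z1); unfold R1; lra].
      unfold G. pose proof (Cmod2_ge0 z1). pose proof (Rmult_le_pos e (Cmod2 z1)). lra. }
    assert (Hz01 : Cmod z0 < 1) by (unfold R1 in Hz0; lra).
    assert (Hz02 : Cmod2 z0 < 1).
    { rewrite <- Cmod_sqr. pose proof (Cmod_ge0 z0). nra. }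
    assert (Hg0 : M + 2 * e < Cmod (g z0)).
    { unfold G in HGz1. assert (e * Cmod2 z0 <= e * 1) by (apply Rmult_le_compat_l; lra).
      unfold e in *; lra. }
    assert (Hz0r : Cmod z0 <= r).
    { apply Rnot_lt_le. intros h. specialize (Hbr z0 (conj h Hz01)). lra. }
    (* The punctured disc around z0 must avoid the exceptional point 0. If z0 = 0, that point is the
       centre, where [circle_mean_bound] asks for continuity only. *)
    set (rho := if excluded_middle_informative (z0 = C0) then R1 - Cmod z0
                else Rmin (R1 - Cmod z0) (Cmod z0)).
    assert (Hrho : 0 < rho /\ rho <= R1 - Cmod z0 /\ (z0 <> C0 -> rho <= Cmod z0)).
    { assert (0 < R1 - Cmod z0) by (unfold R1; lra).
      unfold rho; destruct excluded_middle_informative as [E|E].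
      - repeat split; [assumption|lra|contradiction].
      - pose proof (Cmod_pos z0 E). split; [now apply Rmin_glb_lt|].
        split; [apply Rmin_l|intros _; apply Rmin_r]. }
    destruct Hrho as [Hrho0 [Hrho1 Hrho2]].
    (* In f, the factor [Cconj (g z0)] makes the value at h = 0 equal to |g z0|^2, and the term c h
       cancels the first order part 2 e re (conj z0 h) of e |z0 + h|^2. Maximality of G then leaves
       re (f h) <= |g z0| (|g z0| - e t^2) on |h| = t. *)
    set (c := Cmul (CR (2 * e * Cmod (g z0))) (Cconj z0)).
    set (f := fun h => Cadd (Cmul (Cconj (g z0)) (g (Cadd z0 h))) (Cmul c h)).
    assert (Hshift : forall h d, cderiv g (Cadd z0 h) d -> cderiv (fun x => g (Cadd z0 x)) h (Cmul d C1)).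
    { intros h d Hg. apply (cderiv_comp (fun x => Cadd z0 x) g); [|exact Hg].
      eapply cderiv_eq; [|apply cderiv_add; [apply cderiv_const|apply cderiv_id]]. ring. }
    set (t := rho / 2).
    assert (Hf : re (f C0) <= Cmod (g z0) * (Cmod (g z0) - e * (t * t))).
    { apply (circle_mean_bound f rho t).
      - intros eps Heps. destruct (Hc z0 Hz01 (eps / (2 * (Cmod (g z0) + 1)))) as [d1 [Hd1 H1]].
        { apply Rdiv_lt_0_compat; [lra|]. pose proof (Cmod_ge0 (g z0)); lra. }
        pose proof (Cmod_ge0 (g z0)) as g00. pose proof (Cmod_ge0 c) as c0.
        exists (Rmin d1 (eps / (2 * (Cmod c + 1)))). split.
        { apply Rmin_glb_lt; [lra|]. apply Rdiv_lt_0_compat; lra. }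
        intros h Hh. split_Rmin. specialize (H1 h ltac:(assumption)). unfold f.
        replace (Cadd C0 h) with h by ring. replace (Cadd z0 C0) with z0 by ring.
        replace (Csub (Cadd (Cmul (Cconj (g z0)) (g (Cadd z0 h))) (Cmul c h))
           (Cadd (Cmul (Cconj (g z0)) (g z0)) (Cmul c C0))) with
          (Cadd (Cmul (Cconj (g z0)) (Csub (g (Cadd z0 h)) (g z0))) (Cmul c h)) by ring.
        eapply Rle_trans; [apply Cmod_triangle|]. rewrite !Cmod_mul, Cmod_conj.
        assert (A1 : Cmod (g z0) * Cmod (Csub (g (Cadd z0 h)) (g z0)) <= eps / 2).
        { replace (eps / 2) with ((Cmod (g z0) + 1) * (eps / (2 * (Cmod (g z0) + 1)))) by (field; lra).
          apply Rmult_le_compat; auto using Cmod_ge0; lra. }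
        assert (A2 : Cmod c * Cmod h <= eps / 2).
        { replace (eps / 2) with ((Cmod c + 1) * (eps / (2 * (Cmod c + 1)))) by (field; lra).
          apply Rmult_le_compat; auto using Cmod_ge0; lra. }
        lra.
      - intros h [Hh1 Hh2]. destruct (Hd (Cadd z0 h)) as [d Hgd].
        + split.
          * apply Cmod_pos. intros E. destruct (excluded_middle_informative (z0 = C0)) as [E0|E0].
            { rewrite E0 in E. apply (Cmod_gt0_neq h Hh1). rewrite <- E. ring. }
            specialize (Hrho2 E0). assert (h = Copp z0).
            { replace h with (Csub (Cadd z0 h) z0) by ring. rewrite E. ring. }
            subst h. rewrite Cmod_opp in Hh2. lra.
          * eapply Rle_lt_trans; [apply Cmod_triangle|]. unfold R1 in *; lra.
        + eexists. apply cderiv_add.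
          * apply cderiv_mul; [apply cderiv_const|]. apply Hshift, Hgd.
          * apply cderiv_mul; [apply cderiv_const|apply cderiv_id].
      - unfold t; lra.
      - intros h Hh. unfold f.
        assert (Hin : Cmod (Cadd z0 h) <= R1).
        { eapply Rle_trans; [apply Cmod_triangle|]. unfold t in *; lra. }
        specialize (Hmax _ Hin). unfold G in Hmax.
        pose proof (re_le_Cmod (Cmul (Cconj (g z0)) (g (Cadd z0 h)))) as P.
        rewrite Cmod_mul, Cmod_conj in P.
        assert (E : Cmod2 (Cadd z0 h) = Cmod2 z0 + t * t + 2 * re (Cmul (Cconj z0) h)).
        { rewrite <- Hh, Cmod_sqr. unfold Cmod2; simpl; ring. }
        rewrite E in Hmax.
        change (re (Cmul (Cconj (g z0)) (g (Cadd z0 h))) + re (Cmul c h) <=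
          Cmod (g z0) * (Cmod (g z0) - e * (t * t))).
        assert (Ec : re (Cmul c h) = 2 * e * Cmod (g z0) * re (Cmul (Cconj z0) h))
          by (unfold c; simpl; ring).
        rewrite Ec. pose proof (Cmod_ge0 (g z0)) as g00.
        assert (Hmul : Cmod (g z0) * Cmod (g (Cadd z0 h)) <=
           Cmod (g z0) * (Cmod (g z0) - e * (t * t) - 2 * e * re (Cmul (Cconj z0) h)))
          by (apply Rmult_le_compat_l; lra).
        lra. }
    assert (Ef : re (f C0) = Cmod (g z0) * Cmod (g z0)).
    { unfold f. replace (Cadd z0 C0) with z0 by ring. rewrite Cmod_sqr. unfold Cmod2; simpl; ring. }
    rewrite Ef in Hf. assert (0 < t * t) by (unfold t; nra).
    assert (0 < Cmod (g z0) * (e * (t * t))) by (repeat apply Rmult_lt_0_compat; lra). lra.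
Qed.

(** * Schwarz's lemma *)

Definition cdiff_disc (h : C -> C) : Prop := forall z, Cmod z < 1 -> exists d, cderiv h z d.

Lemma schwarz (h : C -> C) (M : R) : cdiff_disc h -> h C0 = C0 -> 0 <= M ->
  (forall z, Cmod z < 1 -> Cmod (h z) <= M) ->
  forall z, Cmod z < 1 -> Cmod (h z) <= M * Cmod z.
Proof.
  intros Hd H0 HM Hb.
  destruct (Hd C0) as [d0 Hd0]; [rewrite Cmod_0; lra|].
  set (q := fun z => if excluded_middle_informative (z = C0) then d0 else Cdiv (h z) z).
  assert (Hq : forall z, z <> C0 -> q z = Cdiv (h z) z).
  { intros z Hz. unfold q. destruct excluded_middle_informative; [contradiction|reflexivity]. }
  assert (Hq0 : q C0 = d0).
  { unfold q. destruct excluded_middle_informative; [reflexivity|congruence]. }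
  assert (Hqd : forall z, 0 < Cmod z < 1 -> exists d, cderiv q z d).
  { intros z [Hz1 Hz2]. destruct (Hd z Hz2) as [d Hdz].
    destruct (cderiv_div h (fun x => x) z d C1 (Cmod_gt0_neq z Hz1) Hdz (cderiv_id z)) as [e He].
    exists e. apply (cderiv_local (fun x => Cdiv (h x) x) q z e (Cmod z) Hz1); [|exact He]. intros k Hk.
    symmetry. apply Hq. intros E. assert (k = Copp z) by (replace k with (Csub (Cadd z k) z) by ring; rewrite E; ring).
    subst k. rewrite Cmod_opp in Hk. lra. }
  assert (Hmax : forall z, Cmod z < 1 -> Cmod (q z) <= M).
  { apply max_principle; [exact HM| |exact Hqd|].
    - intros z Hz. destruct (excluded_middle_informative (z = C0)) as [->|n].
      + intros eps He. destruct Hd0 as [_ Hd0]. destruct (Hd0 eps He) as [dl [Hdl HH]].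
        exists dl; split; [exact Hdl|]. intros k Hk. specialize (HH k I Hk).
        replace (Cadd C0 k) with k in * by ring. rewrite Hq0.
        destruct (excluded_middle_informative (k = C0)) as [->|nk].
        { rewrite Hq0. replace (Csub d0 d0) with C0 by ring. rewrite Cmod_0; lra. }
        rewrite Hq by exact nk. rewrite H0 in HH.
        replace (Csub (Cdiv (h k) k) d0) with (Cdiv (Csub (Csub (h k) C0) (Cmul d0 k)) k)
          by (field; exact nk).
        rewrite Cmod_div by exact nk. pose proof (Cmod_pos k nk).
        apply Rmult_le_reg_r with (Cmod k); [lra|]. unfold Rdiv.
        rewrite Rmult_assoc, Rinv_l, Rmult_1_r by lra. exact HH.
      + destruct (Hqd z) as [d Hdz]; [split; [now apply Cmod_pos|exact Hz]|].
        exact (cderiv_ccont q z d Hdz).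
    (* Beyond this radius M / |z| is below M + eta. *)
    - intros eta He. exists (M / (M + eta)). split.
      + apply Rmult_lt_reg_r with (M + eta); [lra|]. unfold Rdiv.
        rewrite Rmult_assoc, Rinv_l by lra. lra.
      + intros z [Hz1 Hz2].
        assert (0 <= M / (M + eta)) by (apply Rmult_le_pos; [lra|left; apply Rinv_0_lt_compat; lra]).
        assert (Hz0 : z <> C0) by (apply Cmod_gt0_neq; lra).
        rewrite Hq by exact Hz0. rewrite Cmod_div by exact Hz0.
        apply Rmult_le_reg_r with (Cmod z); [lra|]. unfold Rdiv.
        rewrite Rmult_assoc, Rinv_l, Rmult_1_r by lra.
        eapply Rle_trans; [now apply Hb|].
        apply Rmult_lt_compat_l with (r := M + eta) in Hz1; [|lra].
        replace ((M + eta) * (M / (M + eta))) with M in Hz1 by (field; lra). lra. }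
  intros z Hz. destruct (excluded_middle_informative (z = C0)) as [->|n].
  - rewrite H0, Cmod_0. lra.
  - specialize (Hmax z Hz). rewrite Hq, Cmod_div in Hmax by exact n. pose proof (Cmod_pos z n).
    apply Rmult_le_compat_r with (r := Cmod z) in Hmax; [|lra]. unfold Rdiv in Hmax.
    rewrite Rmult_assoc, Rinv_l, Rmult_1_r in Hmax by lra. exact Hmax.
Qed.

(** Division by z keeps the vanishing near 0 and, by [schwarz], the bound M. Iterating gives |h z|
    <= M |z|^m for every m. *)
Lemma identity_near_0 (h : C -> C) (M rho : R) : cdiff_disc h -> 0 < rho ->
  (forall z, Cmod z < rho -> h z = C0) -> 0 <= M -> (forall z, Cmod z < 1 -> Cmod (h z) <= M) ->
  forall z, Cmod z < 1 -> h z = C0.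
Proof.
  intros Hd Hrho H0 HM Hb.
  assert (Hm : forall m h, cdiff_disc h -> (forall z, Cmod z < rho -> h z = C0) ->
    (forall z, Cmod z < 1 -> Cmod (h z) <= M) ->
    forall z, Cmod z < 1 -> Cmod (h z) <= M * Cmod z ^ m).
  { clear h Hd H0 Hb. induction m as [|m IH]; intros h Hd H0 Hb z Hz.
    - simpl. specialize (Hb z Hz). lra.
    - assert (h00 : h C0 = C0) by (apply H0; rewrite Cmod_0; lra).
      pose proof (schwarz h M Hd h00 HM Hb) as HS.
      (* The numerator vanishes near 0, so q is 0 there, the point 0 included, and no separate value
         has to be assigned. *)
      set (q := fun z => Cdiv (h z) z).
      assert (Hq0 : forall z, Cmod z < rho -> q z = C0).
      { intros x Hx. unfold q. rewrite H0 by exact Hx. unfold Cdiv. ring. }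
      assert (Hq : forall z, Cmod z < 1 -> Cmod (q z) <= M * Cmod z ^ m).
      { apply IH.
        - intros x Hx. destruct (excluded_middle_informative (x = C0)) as [->|n].
          + exists C0. apply (cderiv_local (fun _ => C0) q C0 C0 rho Hrho); [|apply cderiv_const].
            intros k Hk. symmetry. apply Hq0. now replace (Cadd C0 k) with k by ring.
          + destruct (Hd x Hx) as [d Hdx].
            exact (cderiv_div h (fun x => x) x d C1 n Hdx (cderiv_id x)).
        - exact Hq0.
        - intros x Hx. destruct (excluded_middle_informative (x = C0)) as [->|n].
          + rewrite Hq0 by (rewrite Cmod_0; lra). rewrite Cmod_0; lra.
          + unfold q. rewrite Cmod_div by exact n. pose proof (Cmod_pos x n).
            apply Rmult_le_reg_r with (Cmod x); [lra|]. unfold Rdiv.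
            rewrite Rmult_assoc, Rinv_l, Rmult_1_r by lra. now apply HS. }
      specialize (Hq z Hz).
      destruct (excluded_middle_informative (z = C0)) as [->|n].
      + rewrite h00, Cmod_0. simpl. rewrite Rmult_0_l. lra.
      + unfold q in Hq. rewrite Cmod_div in Hq by exact n. pose proof (Cmod_pos z n).
        apply Rmult_le_compat_r with (r := Cmod z) in Hq; [|lra]. unfold Rdiv in Hq.
        rewrite Rmult_assoc, Rinv_l, Rmult_1_r in Hq by lra. simpl. lra. }
  intros z Hz. apply Cmod_eq0. apply Rle_antisym; [|apply Cmod_ge0].
  apply le_epsilon. intros eps He.
  destruct (pow_lt_1_zero (Cmod z)) with (y := eps / (M + 1)) as [n Hn].
  - rewrite Rabs_pos_eq by apply Cmod_ge0. exact Hz.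
  - apply Rdiv_lt_0_compat; lra.
  - specialize (Hn n (Nat.le_refl _)). rewrite Rabs_pos_eq in Hn by (apply pow_le, Cmod_ge0).
    specialize (Hm n h Hd H0 Hb z Hz).
    assert (M * Cmod z ^ n <= (M + 1) * (eps / (M + 1))).
    { apply Rmult_le_compat; try lra. apply pow_le, Cmod_ge0. }
    replace ((M + 1) * (eps / (M + 1))) with eps in H by (field; lra). lra.
Qed.

Lemma Cpow_mul_2 (x : C) (n : nat) : Cpow x (2 * n) = Cmul (Cpow x n) (Cpow x n).
Proof.
  induction n as [|n IH]; [simpl; ring|].
  replace (2 * S n)%nat with (S (S (2 * n))) by lia. cbn [Cpow]. rewrite IH. ring.
Qed.

(* Squaring multiplies the distance to 1 by at least 3/2 as long as it stays below 1/2. *)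
Lemma powers_near_1 (x : C) : (forall n, Cmod (Csub C1 (Cpow x n)) <= 1 / 2) -> x = C1.
Proof.
  intros H.
  assert (Hk : forall k, exists n, (3 / 2) ^ k * Cmod (Csub C1 x) <= Cmod (Csub C1 (Cpow x n))).
  { induction k as [|k [n IH]].
    - exists 1%nat. simpl. replace (Cmul x C1) with x by ring. lra.
    - exists (2 * n)%nat. rewrite Cpow_mul_2. set (y := Cpow x n) in *.
      replace (Csub C1 (Cmul y y)) with (Cmul (Csub C1 y) (Cadd C1 y)) by ring.
      rewrite Cmod_mul.
      assert (3 / 2 <= Cmod (Cadd C1 y)).
      { pose proof (Cmod_sub_ge (Cadd C1 C1) (Csub C1 y)) as P.
        replace (Csub (Cadd C1 C1) (Csub C1 y)) with (Cadd C1 y) in P by ring.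
        specialize (H n). fold y in H.
        replace (Cadd C1 C1) with (CR 2) in P by Csolve. rewrite Cmod_CR, Rabs_pos_eq in P by lra. lra. }
      pose proof (Cmod_ge0 (Csub C1 y)). simpl. nra. }
  symmetry. apply Csub_eq0, Cmod_eq0. destruct (Rle_lt_or_eq_dec _ _ (Cmod_ge0 (Csub C1 x))) as [h|h]; [|now symmetry].
  exfalso. destruct (Pow_x_infinity (3 / 2)) with (b := / Cmod (Csub C1 x)) as [k Hk'].
  - rewrite Rabs_pos_eq; lra.
  - specialize (Hk' k (Nat.le_refl _)). rewrite Rabs_pos_eq in Hk' by (apply pow_le; lra).
    destruct (Hk k) as [n Hn]. specialize (H n).
    apply Rge_le in Hk'. apply Rmult_le_compat_r with (r := Cmod (Csub C1 x)) in Hk'; [|lra].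
    rewrite Rinv_l in Hk' by lra. lra.
Qed.

(** Every power of f is bounded by 1 and equals 1 at 0, so Schwarz's lemma gives |1 - f(z)^n| <= 2
    |z| for all n at once. For |z| < 1/4 all powers of f(z) stay within 1/2 of 1, hence f(z) = 1,
    and [identity_near_0] spreads this to the disc. *)
Lemma strong_max_principle (f : C -> C) : cdiff_disc f ->
  (forall z, Cmod z < 1 -> Cmod (f z) <= 1) -> f C0 = C1 ->
  forall z, Cmod z < 1 -> f z = C1.
Proof.
  intros Hd Hb H0.
  assert (Hn : forall n z, Cmod z < 1 -> Cmod (Csub C1 (Cpow (f z) n)) <= 2 * Cmod z).
  { intros n. apply schwarz; [| |lra|].
    - intros z Hz. destruct (Hd z Hz) as [d Hdz]. destruct (cderiv_pow f n z d Hdz) as [e He].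
      eexists. apply cderiv_sub; [apply cderiv_const|exact He].
    - rewrite H0. replace (Cpow C1 n) with C1; [ring|].
      induction n; simpl; [reflexivity|]. rewrite <- IHn. ring.
    - intros z Hz. eapply Rle_trans; [apply Cmod_sub_le|]. rewrite Cmod_1, Cmod_pow.
      specialize (Hb z Hz). pose proof (pow_incr (Cmod (f z)) 1 n (conj (Cmod_ge0 _) Hb)) as P.
      rewrite pow1 in P. lra. }
  intros z Hz. symmetry. apply Csub_eq0.
  apply (identity_near_0 (fun z => Csub C1 (f z)) 2 (1 / 4)); [| lra| |lra| |exact Hz].
  - intros x Hx. destruct (Hd x Hx) as [d Hdx]. eexists. apply cderiv_sub; [apply cderiv_const|exact Hdx].
  - intros x Hx. rewrite (powers_near_1 (f x)); [ring|]. intros n. specialize (Hn n x). lra.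
  - intros x Hx. eapply Rle_trans; [apply Cmod_sub_le|]. rewrite Cmod_1. specialize (Hb x Hx). lra.
Qed.

(** * Holomorphic functions on the ball *)

Definition vdot (N : nat) (z w : vec) : C :=
  Csum (map (fun i => Cmul (z i) (Cconj (w i))) (seq 0 N)).
Definition vscal (c : C) (z : vec) : vec := fun i => Cmul c (z i).
Definition vzero : vec := fun _ => C0.

Section Vectors.
Variable N : nat.
Implicit Types z w x h : vec.

Lemma vdot_conj z w : Cconj (vdot N z w) = vdot N w z.
Proof.
  unfold vdot. rewrite <- Csum_conj. apply Csum_ext. intros i _.
  rewrite Cconj_mul, Cconj_conj. ring.
Qed.

Lemma vdot_self z : vdot N z z = CR (vnorm2 N z).
Proof.
  unfold vdot, vnorm2. induction (seq 0 N) as [|i l IH]; simpl; [reflexivity|].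
  rewrite IH, Cmul_conj, CR_add. reflexivity.
Qed.

Lemma vdot_add_l z x w : vdot N (vadd z x) w = Cadd (vdot N z w) (vdot N x w).
Proof. unfold vdot. rewrite <- Csum_add. apply Csum_ext. intros i _. unfold vadd. ring. Qed.

Lemma vdot_scal_l c z w : vdot N (vscal c z) w = Cmul c (vdot N z w).
Proof. unfold vdot. rewrite <- Csum_mul_l. apply Csum_ext. intros i _. unfold vscal. ring. Qed.

Lemma vdot_add_r z x w : vdot N w (vadd z x) = Cadd (vdot N w z) (vdot N w x).
Proof. rewrite <- vdot_conj, vdot_add_l, Cconj_add, !vdot_conj. reflexivity. Qed.

Lemma vdot_scal_r c z w : vdot N w (vscal c z) = Cmul (Cconj c) (vdot N w z).
Proof. rewrite <- vdot_conj, vdot_scal_l, Cconj_mul, !vdot_conj. reflexivity. Qed.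

Lemma vdot_zero_l w : vdot N vzero w = C0.
Proof. apply Csum_zero. intros i _. unfold vzero. ring. Qed.

Lemma vnorm2_ge0 z : 0 <= vnorm2 N z.
Proof. apply Rsum_ge0. intros i _. apply Cmod2_ge0. Qed.

Lemma vnorm_ge0 z : 0 <= vnorm N z.
Proof. apply sqrt_pos. Qed.

Lemma vnorm_sqr z : vnorm N z * vnorm N z = vnorm2 N z.
Proof. apply sqrt_sqrt, vnorm2_ge0. Qed.

Lemma vnorm2_scal c z : vnorm2 N (vscal c z) = Cmod2 c * vnorm2 N z.
Proof. unfold vnorm2. rewrite <- Rsum_scal. apply Rsum_ext. intros i _. apply Cmod2_mul. Qed.

Lemma vnorm_scal c z : vnorm N (vscal c z) = Cmod c * vnorm N z.
Proof. unfold vnorm. rewrite vnorm2_scal. apply sqrt_mult; [apply Cmod2_ge0|apply vnorm2_ge0]. Qed.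

Lemma coord_le_vnorm z i : (i < N)%nat -> Cmod (z i) <= vnorm N z.
Proof.
  intros Hi. apply sqrt_le_1_alt.
  apply (Rsum_ge_term (fun i => Cmod2 (z i)) (seq 0 N) i).
  - intros; apply Cmod2_ge0.
  - apply in_seq; lia.
Qed.

Lemma vnorm2_eq0 z : vnorm2 N z = 0 -> forall i, (i < N)%nat -> z i = C0.
Proof.
  intros H i Hi. pose proof (coord_le_vnorm z i Hi) as P.
  unfold vnorm in P. rewrite H, sqrt_0 in P. apply Cmod_eq0.
  pose proof (Cmod_ge0 (z i)); lra.
Qed.

Lemma vnorm2_zero : vnorm2 N vzero = 0.
Proof.
  pose proof (vdot_self vzero) as E. rewrite vdot_zero_l in E.
  symmetry. exact (f_equal re E).
Qed.

Lemma vnorm2_add z h : vnorm2 N (vadd z h) = vnorm2 N z + vnorm2 N h + 2 * re (vdot N z h).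
Proof.
  assert (E : CR (vnorm2 N (vadd z h)) =
    Cadd (Cadd (CR (vnorm2 N z)) (CR (vnorm2 N h))) (Cadd (vdot N z h) (Cconj (vdot N z h)))).
  { rewrite <- !vdot_self, vdot_conj, vdot_add_l, !vdot_add_r. ring. }
  apply (f_equal re) in E. simpl in E. lra.
Qed.

Lemma cauchy_schwarz2 z w : Cmod2 (vdot N z w) <= vnorm2 N z * vnorm2 N w.
Proof.
  pose proof (vnorm2_ge0 w) as Hw. destruct (Rle_lt_or_eq_dec _ _ Hw) as [h|h].
  - pose proof (vnorm2_ge0 (vadd (vscal (CR (vnorm2 N w)) z) (vscal (Copp (vdot N z w)) w))) as P.
    rewrite vnorm2_add, !vnorm2_scal, vdot_scal_l, vdot_scal_r in P.
    unfold Cmod2 in *. simpl in P. set (a := re (vdot N z w)) in *. set (b := im (vdot N z w)) in *.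
    assert (0 <= vnorm2 N w * (vnorm2 N w * vnorm2 N z - (a * a + b * b))) by nra.
    assert (0 <= vnorm2 N w * vnorm2 N z - (a * a + b * b)); [|lra].
    apply Rmult_le_reg_l with (vnorm2 N w); [exact h|]. lra.
  - assert (E : vdot N z w = C0).
    { apply Csum_zero. intros i Hi. apply in_seq in Hi.
      rewrite (vnorm2_eq0 w (eq_sym h) i) by lia. Csolve. }
    rewrite E, <- h. unfold Cmod2; simpl. lra.
Qed.

Lemma cauchy_schwarz z w : Cmod (vdot N z w) <= vnorm N z * vnorm N w.
Proof.
  apply Cmod_le_of_sqr; [apply Rmult_le_pos; apply vnorm_ge0|].
  replace (vnorm N z * vnorm N w * (vnorm N z * vnorm N w)) with
    ((vnorm N z * vnorm N z) * (vnorm N w * vnorm N w)) by ring.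
  rewrite !vnorm_sqr. apply cauchy_schwarz2.
Qed.

Lemma vnorm_triangle z h : vnorm N (vadd z h) <= vnorm N z + vnorm N h.
Proof.
  pose proof (vnorm_ge0 z). pose proof (vnorm_ge0 h). pose proof (vnorm_ge0 (vadd z h)).
  pose proof (vnorm_sqr z). pose proof (vnorm_sqr h). pose proof (vnorm_sqr (vadd z h)) as E.
  rewrite vnorm2_add in E. pose proof (cauchy_schwarz z h). pose proof (re_le_Cmod (vdot N z h)). nra.
Qed.

Lemma vnorm_le_sum z : vnorm N z <= Rsum (map (fun i => Cmod (z i)) (seq 0 N)).
Proof.
  assert (H : vnorm2 N z <= Rsum (map (fun i => Cmod (z i)) (seq 0 N)) * Rsum (map (fun i => Cmod (z i)) (seq 0 N))).
  { unfold vnorm2. induction (seq 0 N) as [|i l IH]; simpl; [lra|].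
    pose proof (Cmod_sqr (z i)). pose proof (Cmod_ge0 (z i)).
    pose proof (Rsum_ge0 (fun i => Cmod (z i)) l (fun i _ => Cmod_ge0 _)). nra. }
  pose proof (Rsum_ge0 (fun i => Cmod (z i)) (seq 0 N) (fun i _ => Cmod_ge0 _)) as P.
  unfold vnorm. rewrite <- (sqrt_square _ P). now apply sqrt_le_1_alt.
Qed.

Lemma in_ball_vnorm z : in_ball N z -> vnorm N z < 1.
Proof.
  intros [_ H]. pose proof (vnorm_sqr z). pose proof (vnorm_ge0 z). nra.
Qed.

Lemma vnorm_in_ball z : supp_in N z -> vnorm N z < 1 -> in_ball N z.
Proof. intros Hs H. split; [exact Hs|]. rewrite <- vnorm_sqr. pose proof (vnorm_ge0 z). nra. Qed.

Lemma vdot_ball_lt1 z w : in_ball N z -> in_ball N w -> Cmod (vdot N z w) < 1.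
Proof.
  intros Hz Hw. apply in_ball_vnorm in Hz. apply in_ball_vnorm in Hw.
  pose proof (cauchy_schwarz z w). pose proof (vnorm_ge0 z). pose proof (vnorm_ge0 w). nra.
Qed.

Lemma supp_add z h : supp_in N z -> supp_in N h -> supp_in N (vadd z h).
Proof. intros Hz Hh i Hi. unfold vadd. rewrite Hz, Hh by exact Hi. ring. Qed.

Lemma supp_scal c z : supp_in N z -> supp_in N (vscal c z).
Proof. intros Hz i Hi. unfold vscal. rewrite Hz by exact Hi. ring. Qed.

Lemma in_ball_zero : in_ball N vzero.
Proof. split; [intros i _; reflexivity|]. rewrite vnorm2_zero. lra. Qed.

Lemma in_ball_scal c z : Cmod c <= 1 -> in_ball N z -> in_ball N (vscal c z).
Proof.
  intros Hc Hz. apply vnorm_in_ball; [apply supp_scal, Hz|]. rewrite vnorm_scal.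
  apply in_ball_vnorm in Hz. pose proof (vnorm_ge0 z). pose proof (Cmod_ge0 c). nra.
Qed.

Lemma in_ball_add z h : in_ball N z -> supp_in N h -> vnorm N h < 1 - vnorm N z ->
  in_ball N (vadd z h).
Proof.
  intros Hz Hs Hh. apply vnorm_in_ball; [apply supp_add; [apply Hz|exact Hs]|].
  pose proof (vnorm_triangle z h). lra.
Qed.

Lemma vec_ext z w : supp_in N z -> supp_in N w -> (forall i, (i < N)%nat -> z i = w i) -> z = w.
Proof.
  intros Hz Hw H. apply functional_extensionality. intros i.
  destruct (Nat.lt_ge_cases i N); [auto|]. rewrite Hz, Hw by assumption. reflexivity.
Qed.

Lemma vadd_zero_r z : vadd z vzero = z.
Proof. apply functional_extensionality. intros i. unfold vadd, vzero. ring. Qed.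

Lemma vzero_of_vnorm h : supp_in N h -> vnorm N h = 0 -> h = vzero.
Proof.
  intros Hs H. apply vec_ext; [exact Hs|intros i _; reflexivity|].
  apply vnorm2_eq0. rewrite <- vnorm_sqr, H. ring.
Qed.

Definition linear_form (d : nat -> C) (h : vec) : C :=
  Csum (map (fun i => Cmul (d i) (h i)) (seq 0 N)).

Definition vderiv (f : vec -> C) (z : vec) (d : nat -> C) : Prop :=
  frechet vadd (vnorm N) (supp_in N) f z (linear_form d).

Lemma linear_form_bound d h : Cmod (linear_form d h) <=
  Rsum (map (fun i => Cmod (d i)) (seq 0 N)) * vnorm N h.
Proof.
  unfold linear_form. eapply Rle_trans; [apply Cmod_Csum_le|].
  rewrite Rmult_comm, <- Rsum_scal. apply Rsum_le. intros i Hi. apply in_seq in Hi.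
  rewrite Cmod_mul, (Rmult_comm (vnorm N h)).
  apply Rmult_le_compat_l; [apply Cmod_ge0|apply coord_le_vnorm; lia].
Qed.

Lemma linear_form_vdot w h : linear_form (fun i => Cconj (w i)) h = vdot N h w.
Proof. apply Csum_ext. intros i _. ring. Qed.

Lemma linear_form_zero d : linear_form d vzero = C0.
Proof. apply Csum_zero. intros i _. unfold vzero. ring. Qed.

Lemma linear_form_scal d c h : linear_form d (vscal c h) = Cmul c (linear_form d h).
Proof. unfold linear_form. rewrite <- Csum_mul_l. apply Csum_ext. intros i _. unfold vscal. ring. Qed.

Lemma linear_form_add d h k : linear_form d (vadd h k) = Cadd (linear_form d h) (linear_form d k).
Proof. unfold linear_form. rewrite <- Csum_add. apply Csum_ext. intros i _. unfold vadd. ring. Qed.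

(** [holo] speaks of nonzero increments and states no bound on the differential. The bound holds for
    every linear form, and h = 0 is immediate. *)
Lemma holo_vderiv f : holo N f <-> forall z, in_ball N z -> exists d, vderiv f z d.
Proof.
  split; intros H z Hz; destruct (H z Hz) as [d Hd]; exists d.
  - split.
    + exists (Rsum (map (fun i => Cmod (d i)) (seq 0 N))). split.
      * apply Rsum_ge0. intros; apply Cmod_ge0.
      * intros h _. apply linear_form_bound.
    + intros eps He. destruct (Hd eps He) as [dl [Hdl HH]]. exists dl; split; [exact Hdl|].
      intros h Hs Hh. destruct (Rle_lt_or_eq_dec _ _ (vnorm_ge0 h)) as [p|p].
      * apply HH; [exact Hs|split; assumption].
      * pose proof (vzero_of_vnorm h Hs (eq_sym p)) as E. subst h. rewrite vadd_zero_r, linear_form_zero.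
        replace (Csub (Csub (f z) (f z)) C0) with C0 by ring. rewrite Cmod_0, <- p. lra.
  - intros eps He. destruct Hd as [_ Hd]. destruct (Hd eps He) as [dl [Hdl HH]].
    exists dl; split; [exact Hdl|]. intros h Hs [_ Hh]. now apply HH.
Qed.

Lemma vderiv_const c z : vderiv (fun _ => c) z (fun _ => C0).
Proof.
  eapply frechet_ext; [|apply frechet_const, vnorm_ge0].
  intros h _. simpl. symmetry. apply Csum_zero. intros i _. ring.
Qed.

Lemma vderiv_add f g z df dg : vderiv f z df -> vderiv g z dg ->
  vderiv (fun x => Cadd (f x) (g x)) z (fun i => Cadd (df i) (dg i)).
Proof.
  intros Hf Hg. eapply frechet_ext; [|exact (frechet_add _ _ _ _ _ _ _ _ Hf Hg)].
  intros h _. simpl. unfold linear_form. rewrite <- Csum_add. apply Csum_ext. intros i _. ring.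
Qed.

Lemma vderiv_mul f g z df dg : vderiv f z df -> vderiv g z dg ->
  vderiv (fun x => Cmul (f x) (g x)) z (fun i => Cadd (Cmul (f z) (dg i)) (Cmul (g z) (df i))).
Proof.
  intros Hf Hg. eapply frechet_ext; [|exact (frechet_mul _ _ _ vnorm_ge0 _ _ _ _ _ Hf Hg)].
  intros h _. simpl. unfold linear_form. rewrite <- !Csum_mul_l, <- Csum_add.
  apply Csum_ext. intros i _. ring.
Qed.

Lemma vderiv_comp f g z df dg : vderiv f z df -> cderiv g (f z) dg ->
  vderiv (fun x => g (f x)) z (fun i => Cmul dg (df i)).
Proof.
  intros Hf Hg. eapply frechet_ext; [|exact (frechet_comp _ _ _ vnorm_ge0 _ _ _ _ _ Hf Hg)].
  intros h _. simpl. unfold linear_form. rewrite <- Csum_mul_l. apply Csum_ext. intros i _. ring.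
Qed.

Lemma vderiv_vdot w z : vderiv (fun x => vdot N x w) z (fun i => Cconj (w i)).
Proof.
  split.
  - eexists. split; [|intros h _; apply linear_form_bound].
    apply Rsum_ge0. intros; apply Cmod_ge0.
  - intros eps He. exists 1; split; [lra|]. intros h _ _.
    rewrite vdot_add_l, linear_form_vdot.
    replace (Csub (Csub (Cadd (vdot N z w) (vdot N h w)) (vdot N z w)) (vdot N h w)) with C0 by ring.
    rewrite Cmod_0. apply Rmult_le_pos; [lra|apply vnorm_ge0].
Qed.

Lemma vderiv_coord j z : (j < N)%nat ->
  vderiv (fun x => x j) z (fun i => if Nat.eqb i j then C1 else C0).
Proof.
  intros Hj.
  assert (E : forall h, linear_form (fun i => if Nat.eqb i j then C1 else C0) h = h j).
  { intros h. unfold linear_form.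
    assert (Gen : forall n, Csum (map (fun i => Cmul (if Nat.eqb i j then C1 else C0) (h i)) (seq 0 n))
       = if Nat.ltb j n then h j else C0).
    { induction n as [|n IH]; [reflexivity|]. rewrite Csum_seq_S, IH.
      destruct (Nat.eqb_spec n j) as [->|ne].
      - rewrite Nat.ltb_irrefl. replace (Nat.ltb j (S j)) with true by (symmetry; apply Nat.ltb_lt; lia). ring.
      - destruct (Nat.ltb_spec j n) as [p|p].
        + replace (Nat.ltb j (S n)) with true by (symmetry; apply Nat.ltb_lt; lia). ring.
        + replace (Nat.ltb j (S n)) with false by (symmetry; apply Nat.ltb_ge; lia). ring. }
    rewrite Gen. replace (Nat.ltb j N) with true by (symmetry; apply Nat.ltb_lt; lia). reflexivity. }
  split.
  - eexists. split; [|intros h _; apply linear_form_bound].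
    apply Rsum_ge0. intros; apply Cmod_ge0.
  - intros eps He. exists 1; split; [lra|]. intros h _ _. rewrite E. unfold vadd.
    replace (Csub (Csub (Cadd (z j) (h j)) (z j)) (h j)) with C0 by ring.
    rewrite Cmod_0. apply Rmult_le_pos; [lra|apply vnorm_ge0].
Qed.

Lemma vderiv_slice f z x d : supp_in N x -> vderiv f z d ->
  cderiv (fun l => f (vadd z (vscal l x))) C0 (linear_form d x).
Proof.
  intros Hx [_ H].
  assert (Ez : vadd z (vscal C0 x) = z).
  { apply functional_extensionality; intros i; unfold vadd, vscal; ring. }
  split.
  - exists (Cmod (linear_form d x)). split; [apply Cmod_ge0|]. intros h _. rewrite Cmod_mul. lra.
  - intros eps He. pose proof (vnorm_ge0 x) as X0.
    destruct (H (eps / (vnorm N x + 1))) as [dl [Hdl HH]]; [apply Rdiv_lt_0_compat; lra|].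
    exists (dl / (vnorm N x + 1)). split; [apply Rdiv_lt_0_compat; lra|].
    intros h _ Hh. pose proof (Cmod_ge0 h) as h0.
    specialize (HH (vscal h x) (supp_scal h x Hx)). rewrite vnorm_scal in HH.
    rewrite Ez. replace (Cadd C0 h) with h by ring.
    rewrite linear_form_scal in HH. replace (Cmul (linear_form d x) h) with (Cmul h (linear_form d x)) by ring.
    eapply Rle_trans; [apply HH|].
    + apply Rle_lt_trans with (Cmod h * (vnorm N x + 1)); [nra|].
      replace dl with (dl / (vnorm N x + 1) * (vnorm N x + 1)) by (field; lra).
      apply Rmult_lt_compat_r; lra.
    + replace (eps * Cmod h) with (eps / (vnorm N x + 1) * (Cmod h * (vnorm N x + 1))) by (field; lra).
      apply Rmult_le_compat_l; [left; apply Rdiv_lt_0_compat; lra|nra].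
Qed.

(** Restriction to complex lines is what makes the one-variable Schwarz lemma and maximum principle
    available on the ball. *)
Lemma holo_slice f z x l : holo N f -> supp_in N x -> in_ball N (vadd z (vscal l x)) ->
  exists d, cderiv (fun l => f (vadd z (vscal l x))) l d.
Proof.
  intros Hf Hx Hin. destruct (proj1 (holo_vderiv f) Hf _ Hin) as [d Hd].
  pose proof (vderiv_slice f _ x d Hx Hd) as HS. exists (Cmul (linear_form d x) C1).
  assert (Hc : cderiv (fun k => Csub k l) l C1).
  { eapply cderiv_eq; [|apply cderiv_sub; [apply cderiv_id|apply cderiv_const]]. ring. }
  assert (E : forall m, vadd (vadd z (vscal l x)) (vscal (Csub m l) x) = vadd z (vscal m x)).
  { intros m. apply functional_extensionality; intros i; unfold vadd, vscal; ring. }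
  apply (cderiv_local (fun m => f (vadd (vadd z (vscal l x)) (vscal (Csub m l) x))) _ _ _ 1 Rlt_0_1).
  - intros h _. now rewrite E.
  - apply (cderiv_comp (fun k => Csub k l) (fun m => f (vadd (vadd z (vscal l x)) (vscal m x)))); [exact Hc|].
    replace (Csub l l) with C0 by ring. exact HS.
Qed.

Lemma uniform_delta (P : nat -> R -> Prop) (n : nat) :
  (forall i d d', P i d -> 0 < d' <= d -> P i d') ->
  (forall i, (i < n)%nat -> exists d, 0 < d /\ P i d) ->
  exists d, 0 < d /\ forall i, (i < n)%nat -> P i d.
Proof.
  intros Hm. induction n as [|n IH]; intros H.
  - exists 1; split; [lra|]. intros i Hi; lia.
  - destruct IH as [d1 [Hd1 H1]]; [intros; apply H; lia|].
    destruct (H n) as [d2 [Hd2 H2]]; [lia|].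
    assert (0 < Rmin d1 d2) by now apply Rmin_glb_lt.
    exists (Rmin d1 d2). split; [assumption|]. intros i Hi.
    destruct (Nat.eq_dec i n) as [->|ne].
    + apply (Hm _ d2); [exact H2|split; [assumption|apply Rmin_r]].
    + apply (Hm _ d1); [apply H1; lia|split; [assumption|apply Rmin_l]].
Qed.

(** [holo_map] gives differentiability coordinate by coordinate. Hence a Lipschitz bound for the
    vector phi (z + h) - phi z and a radius common to all coordinates are assembled before the outer
    function is expanded. *)
Lemma holo_comp f phi : holo N f -> holo_map N phi -> self_map N phi -> holo N (Ccomp f phi).
Proof.
  intros Hf Hphi Hself. apply holo_vderiv. intros z Hz. unfold Ccomp.
  destruct (proj1 (holo_vderiv f) Hf (phi z) (Hself z Hz)) as [d Hd].
  assert (He : exists e : nat -> nat -> C, forall i, (i < N)%nat -> vderiv (fun x => phi x i) z (e i)).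
  { assert (H : forall i, exists e, (i < N)%nat -> vderiv (fun x => phi x i) z e).
    { intros i. destruct (Nat.lt_ge_cases i N) as [h|h].
      - destruct (proj1 (holo_vderiv _) (Hphi i h) z Hz) as [e E]. exists e. auto.
      - exists (fun _ => C0). intros; lia. }
    exists (fun i => proj1_sig (constructive_indefinite_description _ (H i))).
    intros i. destruct (constructive_indefinite_description _ (H i)); auto. }
  destruct He as [e He].
  set (D := fun j => Csum (map (fun i => Cmul (d i) (e i j)) (seq 0 N))).
  assert (HD : forall h, linear_form D h = linear_form d (fun i => linear_form (e i) h)).
  { intros h. unfold linear_form, D.
    assert (Gen : forall l, Csum (map (fun j => Cmul (Csum (map (fun i => Cmul (d i) (e i j)) l)) (h j)) (seq 0 N))
       = Csum (map (fun i => Cmul (d i) (Csum (map (fun j => Cmul (e i j) (h j)) (seq 0 N)))) l)).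
    { induction l as [|i l IH].
      - simpl. apply Csum_zero. intros; ring.
      - cbn [map Csum fold_right]. unfold Csum in IH at 3. rewrite <- IH.
        fold (Csum (map (fun j => Cmul (e i j) (h j)) (seq 0 N))).
        rewrite <- Csum_mul_l, <- Csum_add. apply Csum_ext. intros j _.
        unfold Csum. ring. }
    apply Gen. }
  assert (HL : exists K dl, 0 < K /\ 0 < dl /\ forall h, supp_in N h -> vnorm N h < dl ->
     vnorm N (vadd (phi (vadd z h)) (vscal (Copp C1) (phi z))) <= K * vnorm N h).
  { assert (HLi : forall n, (n <= N)%nat -> exists K dl, 0 < K /\ 0 < dl /\ forall h, supp_in N h -> vnorm N h < dl ->
     Rsum (map (fun i => Cmod (Csub (phi (vadd z h) i) (phi z i))) (seq 0 n)) <= K * vnorm N h).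
    { induction n as [|n IH]; intros Hn.
      - exists 1, 1. repeat split; try lra. intros h _ _. simpl. rewrite Rmult_1_l. apply vnorm_ge0.
      - destruct IH as [K1 [d1 [HK1 [Hd1 H1]]]]; [lia|].
        destruct (frechet_lipschitz _ _ _ _ _ _ (He n ltac:(lia))) as [K2 [d2 [HK2 [Hd2 H2]]]].
        exists (K1 + K2), (Rmin d1 d2). split; [lra|]. split; [now apply Rmin_glb_lt|].
        intros h Hs Hh. apply lt_Rmin in Hh. rewrite Rsum_seq_S.
        specialize (H1 h Hs (proj1 Hh)). specialize (H2 h Hs (proj2 Hh)). cbv beta in H2. lra. }
    destruct (HLi N (Nat.le_refl _)) as [K [dl [HK [Hdl H]]]].
    exists K, dl. repeat split; try assumption. intros h Hs Hh.
    eapply Rle_trans; [apply vnorm_le_sum|]. eapply Rle_trans; [|apply (H h Hs Hh)].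
    right. apply Rsum_ext. intros i _. f_equal. unfold vadd, vscal. ring. }
  destruct HL as [K [dK [HK [HdK HL]]]].
  exists D. destruct Hd as [_ Hd]. split.
  { eexists. split; [|intros h _; apply linear_form_bound]. apply Rsum_ge0. intros; apply Cmod_ge0. }
  intros eps Heps.
  set (S := Rsum (map (fun i => Cmod (d i)) (seq 0 N))).
  assert (S0 : 0 <= S) by (apply Rsum_ge0; intros; apply Cmod_ge0).
  destruct (Hd (eps / (2 * K))) as [d1 [Hd1 H1]]; [apply Rdiv_lt_0_compat; lra|].
  destruct (uniform_delta (fun i dl => forall h, supp_in N h -> vnorm N h < dl ->
    Cmod (Csub (Csub (phi (vadd z h) i) (phi z i)) (linear_form (e i) h)) <= eps / (2 * (S + 1)) * vnorm N h) N)
    as [d2 [Hd2 H2]].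
  { intros i x y Hx Hy h Hs Hh. apply Hx; [exact Hs|lra]. }
  { intros i Hi. destruct (He i Hi) as [_ Hei].
    destruct (Hei (eps / (2 * (S + 1)))) as [dl [Hdl HH]]; [apply Rdiv_lt_0_compat; lra|].
    exists dl. split; assumption. }
  pose proof (in_ball_vnorm z Hz) as Hz1.
  assert (HdK1 : 0 < d1 / K) by now apply Rdiv_lt_0_compat.
  exists (Rmin (Rmin dK (1 - vnorm N z)) (Rmin d2 (d1 / K))).
  split; [repeat apply Rmin_glb_lt; lra|].
  intros h Hs Hh. split_Rmin. specialize (HL h Hs ltac:(assumption)).
  set (w := vadd (phi (vadd z h)) (vscal (Copp C1) (phi z))) in *.
  assert (Hsw : supp_in N w).
  { apply supp_add; [|apply supp_scal]; apply Hself; [|exact Hz]. apply in_ball_add; assumption. }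
  assert (Ew : vadd (phi z) w = phi (vadd z h)).
  { apply functional_extensionality; intros i; unfold w, vadd, vscal; ring. }
  specialize (H1 w Hsw). rewrite Ew in H1. rewrite HD.
  assert (Hw1 : vnorm N w < d1).
  { eapply Rle_lt_trans; [exact HL|]. replace d1 with (K * (d1 / K)) by (field; lra).
    apply Rmult_lt_compat_l; lra. }
  specialize (H1 Hw1).
  replace (Csub (Csub (f (phi (vadd z h))) (f (phi z))) (linear_form d (fun i => linear_form (e i) h)))
    with (Cadd (Csub (Csub (f (phi (vadd z h))) (f (phi z))) (linear_form d w))
      (Csub (linear_form d w) (linear_form d (fun i => linear_form (e i) h)))) by ring.
  eapply Rle_trans; [apply Cmod_triangle|].
  assert (A1 : eps / (2 * K) * vnorm N w <= eps / 2 * vnorm N h).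
  { replace (eps / 2 * vnorm N h) with (eps / (2 * K) * (K * vnorm N h)) by (field; lra).
    apply Rmult_le_compat_l; [left; apply Rdiv_lt_0_compat; lra|exact HL]. }
  assert (A2 : Cmod (Csub (linear_form d w) (linear_form d (fun i => linear_form (e i) h))) <= eps / 2 * vnorm N h).
  { unfold linear_form at 1 2. rewrite <- Csum_sub.
    eapply Rle_trans; [apply Cmod_Csum_le|].
    apply Rle_trans with (S * (eps / (2 * (S + 1)) * vnorm N h)).
    - unfold S. rewrite (Rmult_comm (Rsum _)), <- Rsum_scal. apply Rsum_le. intros i Hi.
      apply in_seq in Hi. fold S.
      replace (Csub (Cmul (d i) (w i)) (Cmul (d i) (linear_form (e i) h))) with
        (Cmul (d i) (Csub (Csub (phi (vadd z h) i) (phi z i)) (linear_form (e i) h)))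
        by (unfold w, vadd, vscal; ring).
      rewrite Cmod_mul, Rmult_comm. apply Rmult_le_compat_r; [apply Cmod_ge0|].
      apply H2; [lia|exact Hs|assumption].
    - pose proof (vnorm_ge0 h).
      replace (eps / 2 * vnorm N h) with ((S + 1) * (eps / (2 * (S + 1)) * vnorm N h)) by (field; lra).
      apply Rmult_le_compat_r; [|lra]. apply Rmult_le_pos; [|lra]. left. apply Rdiv_lt_0_compat; lra. }
  lra.
Qed.

Lemma holo_const c : holo N (fun _ => c).
Proof. apply holo_vderiv. intros z _. eexists. apply vderiv_const. Qed.

Lemma holo_add f g : holo N f -> holo N g -> holo N (fun z => Cadd (f z) (g z)).
Proof.
  intros Hf Hg. apply holo_vderiv. intros z Hz.
  destruct (proj1 (holo_vderiv f) Hf z Hz) as [d Hd]. destruct (proj1 (holo_vderiv g) Hg z Hz) as [e He].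
  eexists. apply vderiv_add; eassumption.
Qed.

Lemma holo_mul f g : holo N f -> holo N g -> holo N (fun z => Cmul (f z) (g z)).
Proof.
  intros Hf Hg. apply holo_vderiv. intros z Hz.
  destruct (proj1 (holo_vderiv f) Hf z Hz) as [d Hd]. destruct (proj1 (holo_vderiv g) Hg z Hz) as [e He].
  eexists. apply vderiv_mul; eassumption.
Qed.

Lemma holo_comp_cderiv f (g : C -> C) : holo N f ->
  (forall z, in_ball N z -> exists d, cderiv g (f z) d) -> holo N (fun z => g (f z)).
Proof.
  intros Hf Hg. apply holo_vderiv. intros z Hz.
  destruct (proj1 (holo_vderiv f) Hf z Hz) as [d Hd]. destruct (Hg z Hz) as [e He].
  eexists. apply vderiv_comp; eassumption.
Qed.

Lemma holo_vdot w : holo N (fun z => vdot N z w).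
Proof. apply holo_vderiv. intros z _. eexists. apply vderiv_vdot. Qed.

Lemma holo_coord j : (j < N)%nat -> holo N (fun z => z j).
Proof. intros Hj. apply holo_vderiv. intros z _. eexists. now apply vderiv_coord. Qed.

Lemma holo_ext f g : (forall z, f z = g z) -> holo N f -> holo N g.
Proof. intros E. replace g with f; [auto|]. now apply functional_extensionality. Qed.

Lemma holo_sub f g : holo N f -> holo N g -> holo N (fsub f g).
Proof.
  intros Hf Hg. apply (holo_ext (fun z => Cadd (f z) (Cmul (Copp C1) (g z)))).
  - intros z. unfold fsub. ring.
  - apply holo_add; [exact Hf|]. apply holo_mul; [apply holo_const|exact Hg].
Qed.
End Vectors.

(** * Automorphisms of the ball *)

(** A symmetric form of [automorphism] with the inverse exposed, convenient for inverting and
    composing. *)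
Definition inverse_pair (N : nat) (phi chi : vec -> vec) : Prop :=
  holo_map N phi /\ self_map N phi /\ holo_map N chi /\ self_map N chi /\
  forall z, in_ball N z -> chi (phi z) = z /\ phi (chi z) = z.

Section Automorphisms.
Variable N : nat.

Lemma inverse_pair_sym phi chi : inverse_pair N phi chi -> inverse_pair N chi phi.
Proof. intros (H1 & H2 & H3 & H4 & H5). unfold inverse_pair. intuition; now apply H5. Qed.

Lemma automorphism_inverse phi : automorphism N phi -> exists chi, inverse_pair N phi chi.
Proof.
  intros (H1 & H2 & chi & H3 & H4 & H5). exists chi. exact (conj H1 (conj H2 (conj H3 (conj H4 H5)))).
Qed.

Lemma inverse_pair_comp phi chi phi' chi' : inverse_pair N phi chi -> inverse_pair N phi' chi' ->
  inverse_pair N (fun z => phi (phi' z)) (fun z => chi' (chi z)).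
Proof.
  intros (H1 & H2 & H3 & H4 & H5) (K1 & K2 & K3 & K4 & K5).
  split; [|split; [|split; [|split]]].
  - intros i Hi. exact (holo_comp N (fun z => phi z i) phi' (H1 i Hi) K1 K2).
  - intros z Hz. auto.
  - intros i Hi. exact (holo_comp N (fun z => chi' z i) chi (K3 i Hi) H3 H4).
  - intros z Hz. auto.
  - intros z Hz. split.
    + rewrite (proj1 (H5 _ (K2 z Hz))). now apply K5.
    + rewrite (proj2 (K5 _ (H4 z Hz))). now apply H5.
Qed.

(** * The involutive automorphism exchanging 0 and [a] *)

Definition mob_s (a : vec) : R := sqrt (1 - vnorm2 N a).
(** The classical formula is (a - P z - s (z - P z)) / (1 - <z, a>), with P the projection onto the
    line of a and s = [mob_s a]. Since (1 - s) / |a|^2 = 1 / (1 + s), it can be written without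
    dividing by |a|^2, so a = 0 is covered as well. *)
Definition mob (a z : vec) : vec :=
  vscal (Cinv (Csub C1 (vdot N z a)))
    (vadd a (vadd (vscal (CR (- mob_s a)) z)
                  (vscal (Cmul (CR (- / (1 + mob_s a))) (vdot N z a)) a))).

Lemma mob_s_spec a : in_ball N a ->
  0 < mob_s a /\ CR (vnorm2 N a) = Csub C1 (Cmul (CR (mob_s a)) (CR (mob_s a))).
Proof.
  intros [_ Ha]. assert (0 < 1 - vnorm2 N a) by lra. split.
  - now apply sqrt_lt_R0.
  - apply C_ext; simpl; [|ring]. unfold mob_s. rewrite sqrt_sqrt by lra. ring.
Qed.

Lemma one_minus_vdot_neq0 z w : in_ball N z -> in_ball N w -> Csub C1 (vdot N z w) <> C0.
Proof. intros Hz Hw. apply one_minus_neq0. now apply vdot_ball_lt1. Qed.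

Lemma mob_vdot a z w : in_ball N a -> in_ball N z -> in_ball N w ->
  Cmul (Csub C1 (vdot N (mob a z) (mob a w)))
       (Cmul (Csub C1 (vdot N z a)) (Csub C1 (vdot N a w)))
  = Cmul (CR (1 - vnorm2 N a)) (Csub C1 (vdot N z w)).
Proof.
  intros Ha Hz Hw. destruct (mob_s_spec a Ha) as [Hs HA].
  pose proof (one_minus_vdot_neq0 z a Hz Ha) as n1. pose proof (one_minus_vdot_neq0 a w Ha Hw) as n2.
  unfold mob. rewrite !vdot_scal_l, !vdot_scal_r, !vdot_add_l, !vdot_add_r,
    !vdot_scal_l, !vdot_scal_r, vdot_self.
  rewrite CR_sub, !HA, !Cconj_mul, !Cconj_CR, vdot_conj, Cconj_inv, Cconj_sub, vdot_conj.
  replace (Cconj C1) with C1 by Csolve.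
  assert (E : CR (- / (1 + mob_s a)) = Copp (Cinv (Cadd C1 (CR (mob_s a))))).
  { unfold Cinv, Cmod2. apply C_ext; simpl; field; nra. }
  assert (n3 : Cadd C1 (CR (mob_s a)) <> C0).
  { intros e. apply (f_equal re) in e. simpl in e. lra. }
  replace (CR (- mob_s a)) with (Copp (CR (mob_s a))) by Csolve.
  replace (CR 1) with C1 by Csolve.
  rewrite E. set (X := vdot N z a) in *. set (Y := vdot N a w) in *. set (s := CR (mob_s a)) in *.
  field. repeat split; assumption.
Qed.

Lemma supp_mob a z : in_ball N a -> in_ball N z -> supp_in N (mob a z).
Proof.
  intros [Ha _] [Hz _]. unfold mob.
  apply supp_scal, supp_add; [exact Ha|]. apply supp_add; apply supp_scal; assumption.
Qed.

(** For w = z, [mob_vdot] reads (1 - |mob a z|^2) |1 - <z, a>|^2 = (1 - |a|^2) (1 - |z|^2), and the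
    right side is positive. *)
Lemma self_map_mob a : in_ball N a -> self_map N (mob a).
Proof.
  intros Ha z Hz. split; [now apply supp_mob|].
  pose proof (mob_vdot a z z Ha Hz Hz) as E. rewrite !vdot_self in E.
  rewrite <- (vdot_conj N z a) in E.
  replace (Csub C1 (Cconj (vdot N z a))) with (Cconj (Csub C1 (vdot N z a))) in E by Csolve.
  rewrite Cmul_conj in E. apply (f_equal re) in E. simpl in E.
  pose proof (Cmod2_pos _ (one_minus_vdot_neq0 z a Hz Ha)) as P.
  destruct Ha as [_ Ha], Hz as [_ Hz].
  assert (0 < (1 - vnorm2 N a) * (1 - vnorm2 N z)) by (apply Rmult_lt_0_compat; lra).
  assert (Q : 0 < (1 - vnorm2 N (mob a z)) * Cmod2 (Csub C1 (vdot N z a))) by lra.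
  apply Rmult_lt_reg_r with (Cmod2 (Csub C1 (vdot N z a))); [exact P|]. lra.
Qed.

Lemma mob_invol a z : in_ball N a -> in_ball N z -> mob a (mob a z) = z.
Proof.
  intros Ha Hz. destruct (mob_s_spec a Ha) as [Hs HA].
  pose proof (one_minus_vdot_neq0 z a Hz Ha) as n1.
  pose proof (one_minus_vdot_neq0 _ a (self_map_mob a Ha z Hz) Ha) as n2.
  assert (E : CR (- / (1 + mob_s a)) = Copp (Cinv (Cadd C1 (CR (mob_s a))))).
  { unfold Cinv, Cmod2. apply C_ext; simpl; field; nra. }
  assert (n3 : Cadd C1 (CR (mob_s a)) <> C0).
  { intros e. apply (f_equal re) in e. simpl in e. lra. }
  assert (n4 : CR (mob_s a) <> C0) by (apply CR_neq0; lra).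
  (* The outer application sees [mob a z] through this inner product in its denominator; once it is
     known, each coordinate is a rational identity. *)
  assert (Ed : vdot N (mob a z) a = Cdiv (Csub (CR (vnorm2 N a)) (vdot N z a)) (Csub C1 (vdot N z a))).
  { unfold mob at 1. rewrite vdot_scal_l, !vdot_add_l, !vdot_scal_l, vdot_self, !HA, E.
    replace (CR (- mob_s a)) with (Copp (CR (mob_s a))) by Csolve.
    set (s := CR (mob_s a)) in *. set (X := vdot N z a) in *. field. split; assumption. }
  apply functional_extensionality. intros i.
  unfold mob at 1. rewrite Ed. rewrite Ed in n2. unfold vscal, vadd.
  unfold mob, vscal, vadd. rewrite HA in *. rewrite E.
  replace (CR (- mob_s a)) with (Copp (CR (mob_s a))) by Csolve.
  set (s := CR (mob_s a)) in *. set (X := vdot N z a) in *. field.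
  repeat split; try assumption.
  (* The remaining denominator is s^2, the numerator of 1 - <mob a z, a> over 1 - X. *)
  intros e. apply n4. assert (Cmul s s = C0) by (rewrite <- e; ring).
  destruct (excluded_middle_informative (s = C0)); [assumption|].
  exfalso. apply (Cmul_neq0 s s); assumption.
Qed.

Lemma holo_map_mob a : in_ball N a -> holo_map N (mob a).
Proof.
  intros Ha i Hi. unfold mob, vscal, vadd.
  apply holo_mul.
  - apply (holo_comp_cderiv N (fun z => Csub C1 (vdot N z a)) Cinv).
    + exact (holo_sub N (fun _ => C1) _ (holo_const N C1) (holo_vdot N a)).
    + intros z Hz. eexists. apply cderiv_inv. now apply one_minus_vdot_neq0.
  - apply holo_add; [apply holo_const|]. apply holo_add.
    + apply holo_mul; [apply holo_const|now apply holo_coord].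
    + apply holo_mul; [|apply holo_const]. apply holo_mul; [apply holo_const|apply holo_vdot].
Qed.

Lemma mob_inverse_pair a : in_ball N a -> inverse_pair N (mob a) (mob a).
Proof.
  intros Ha. pose proof (holo_map_mob a Ha) as Hh. pose proof (self_map_mob a Ha) as Hs.
  refine (conj Hh (conj Hs (conj Hh (conj Hs _)))). intros z Hz. split; now apply mob_invol.
Qed.

Lemma mob_0 a : mob a vzero = a.
Proof.
  apply functional_extensionality. intros i. unfold mob. rewrite vdot_zero_l.
  unfold vscal, vadd, vzero. field. intros e. apply (f_equal re) in e. simpl in e. lra.
Qed.

(** * Automorphisms fixing the origin *)

Lemma in_ball_unit_scal zeta l : supp_in N zeta -> vnorm N zeta = 1 -> Cmod l < 1 ->
  in_ball N (vscal l zeta).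
Proof.
  intros Hs Hn Hl. apply vnorm_in_ball; [now apply supp_scal|]. rewrite vnorm_scal, Hn. lra.
Qed.

Lemma unit_direction z : in_ball N z -> z <> vzero -> exists zeta,
  supp_in N zeta /\ vnorm N zeta = 1 /\ z = vscal (CR (vnorm N z)) zeta /\ 0 < vnorm N z.
Proof.
  intros [Hs _] Hz. assert (Hn : 0 < vnorm N z).
  { destruct (Rle_lt_or_eq_dec _ _ (vnorm_ge0 N z)) as [p|p]; [exact p|].
    exfalso. apply Hz. now apply (vzero_of_vnorm N). }
  exists (vscal (CR (/ vnorm N z)) z). repeat split; [now apply supp_scal| | |exact Hn].
  - rewrite vnorm_scal, Cmod_CR, Rabs_pos_eq; [field; lra|]. left. now apply Rinv_0_lt_compat.
  - apply functional_extensionality. intros i. unfold vscal. apply C_ext; simpl; field; lra.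
Qed.

Lemma cdiff_slice f zeta : holo N f -> supp_in N zeta -> vnorm N zeta = 1 ->
  cdiff_disc (fun l => f (vscal l zeta)).
Proof.
  intros Hf Hs Hn l Hl.
  assert (E : forall m, vadd vzero (vscal m zeta) = vscal m zeta).
  { intros m. apply functional_extensionality; intros i; unfold vadd, vzero; ring. }
  destruct (holo_slice N f vzero zeta l Hf Hs) as [d Hd].
  - rewrite E. now apply in_ball_unit_scal.
  - exists d. replace (fun l => f (vscal l zeta)) with (fun l => f (vadd vzero (vscal l zeta))); [exact Hd|].
    apply functional_extensionality; intros m. now rewrite E.
Qed.

Lemma holo_vdot_map F w : holo_map N F -> self_map N F -> holo N (fun z => vdot N (F z) w).
Proof. intros H1 H2. exact (holo_comp N (fun z => vdot N z w) F (holo_vdot N w) H1 H2). Qed.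

(** One-variable Schwarz for l |-> <F(l zeta), F z> with zeta = z / |z|: this function is bounded by
    |F z|, and at l = |z| the estimate reads |F z|^2 <= |F z| |z|. *)
Lemma schwarz_ball F : holo_map N F -> self_map N F -> F vzero = vzero ->
  forall z, in_ball N z -> vnorm N (F z) <= vnorm N z.
Proof.
  intros H1 H2 H0 z Hz. destruct (excluded_middle_informative (z = vzero)) as [->|n].
  { rewrite H0. lra. }
  destruct (unit_direction z Hz n) as [zeta [Hs [Hn [Ez Hp]]]].
  set (m := vnorm N (F z)). assert (Hm : 0 <= m) by apply vnorm_ge0.
  pose proof (in_ball_vnorm N z Hz) as Hz1.
  assert (P : Cmod (vdot N (F (vscal (CR (vnorm N z)) zeta)) (F z)) <= m * Cmod (CR (vnorm N z))).
  { apply (schwarz (fun l => vdot N (F (vscal l zeta)) (F z))).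
    - apply (cdiff_slice (fun x => vdot N (F x) (F z))); [now apply holo_vdot_map|exact Hs|exact Hn].
    - replace (vscal C0 zeta) with vzero by (apply functional_extensionality; intros i; unfold vscal, vzero; ring).
      rewrite H0. apply vdot_zero_l.
    - exact Hm.
    - intros l Hl. eapply Rle_trans; [apply cauchy_schwarz|]. fold m.
      pose proof (in_ball_vnorm N _ (H2 _ (in_ball_unit_scal zeta l Hs Hn Hl))). nra.
    - rewrite Cmod_CR, Rabs_pos_eq; lra. }
  rewrite <- Ez, vdot_self, !Cmod_CR, <- vnorm_sqr in P. fold m in P.
  rewrite !Rabs_pos_eq in P by nra. destruct Hm as [Hm|Hm]; [|rewrite <- Hm; lra].
  apply Rmult_le_reg_l with m; assumption.
Qed.

Section Origin.
Variables F G : vec -> vec.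
Hypothesis HFG : inverse_pair N F G.
Hypothesis F0 : F vzero = vzero.

Lemma origin_norm z : in_ball N z -> vnorm N (F z) = vnorm N z.
Proof.
  intros Hz. destruct HFG as (H1 & H2 & H3 & H4 & H5).
  apply Rle_antisym; [now apply schwarz_ball|].
  assert (G0 : G vzero = vzero).
  { rewrite <- F0 at 1. apply H5, in_ball_zero. }
  pose proof (schwarz_ball G H3 H4 G0 (F z) (H2 z Hz)) as P.
  now rewrite (proj1 (H5 z Hz)) in P.
Qed.

(* On the disc of center 1/2 and radius 1/2 the unit-vector valued [F (l zeta) / l] is
   constant, by the maximum principle applied to its inner product with its value at 1/2. *)
Lemma origin_ray zeta t : supp_in N zeta -> vnorm N zeta = 1 -> 0 < t < 1 ->
  F (vscal (CR t) zeta) = vscal (CR (2 * t)) (F (vscal (CR (1 / 2)) zeta)).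
Proof.
  intros Hs Hn Ht. destruct HFG as (H1 & H2 & _ & _ & _).
  assert (Hhalf : in_ball N (vscal (CR (1 / 2)) zeta)).
  { apply in_ball_unit_scal; try assumption. rewrite Cmod_CR, Rabs_pos_eq; lra. }
  set (w := F (vscal (CR (1 / 2)) zeta)) in *.
  assert (Hw : vnorm N w = 1 / 2).
  { unfold w. rewrite origin_norm, vnorm_scal, Hn, Cmod_CR, Rabs_pos_eq; [lra|lra|exact Hhalf]. }
  (* p maps the unit disc onto the disc of centre 1/2 and radius 1/2, which contains the interval
     (0, 1) but not 0, so division by p m is harmless. *)
  set (p := fun m => Cmul (CR (1 / 2)) (Cadd C1 m)).
  assert (Hp : forall m, Cmod m < 1 -> p m <> C0 /\ Cmod (p m) < 1).
  { intros m Hm. unfold p. split.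
    - apply Cmul_neq0; [apply CR_neq0; lra|].
      replace (Cadd C1 m) with (Csub C1 (Copp m)) by ring. apply one_minus_neq0. now rewrite Cmod_opp.
    - rewrite Cmod_mul, Cmod_CR, Rabs_pos_eq by lra.
      pose proof (Cmod_triangle C1 m) as T. rewrite Cmod_1 in T. lra. }
  assert (Hone : forall m, Cmod m < 1 ->
    Cdiv (Cmul (CR 2) (vdot N (F (vscal (p m) zeta)) w)) (p m) = C1).
  { apply strong_max_principle.
    - intros m Hm. destruct (Hp m Hm) as [n1 n2].
      assert (Hpd : cderiv p m (CR (1 / 2))).
      { eapply cderiv_eq; [|apply cderiv_mul; [apply cderiv_const|apply cderiv_add; [apply cderiv_const|apply cderiv_id]]].
        cbv beta. ring. }
      destruct (cdiff_slice (fun x => vdot N (F x) w) zeta (holo_vdot_map F w H1 H2) Hs Hn (p m) n2) as [d Hd].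
      eapply cderiv_div; [exact n1| |exact Hpd].
      apply cderiv_mul; [apply cderiv_const|].
      exact (cderiv_comp p (fun l => vdot N (F (vscal l zeta)) w) m _ _ Hpd Hd).
    - intros m Hm. destruct (Hp m Hm) as [n1 n2]. rewrite Cmod_div by exact n1.
      pose proof (Cmod_pos _ n1) as pp.
      apply Rmult_le_reg_r with (Cmod (p m)); [lra|]. unfold Rdiv.
      rewrite Rmult_assoc, Rinv_l, Rmult_1_r, Rmult_1_l by lra.
      rewrite Cmod_mul, Cmod_CR, Rabs_pos_eq by lra.
      pose proof (cauchy_schwarz N (F (vscal (p m) zeta)) w) as P.
      rewrite origin_norm, vnorm_scal, Hn, Hw in P by now apply in_ball_unit_scal. lra.
    - replace (p C0) with (CR (1 / 2)) by (unfold p; Csolve). fold w.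
      rewrite vdot_self, <- vnorm_sqr, Hw. unfold Cdiv, Cinv, Cmod2. apply C_ext; simpl; field. }
  specialize (Hone (CR (2 * t - 1))).
  replace (p (CR (2 * t - 1))) with (CR t) in Hone by (unfold p; apply C_ext; simpl; field).
  assert (Hm : Cmod (CR (2 * t - 1)) < 1) by (rewrite Cmod_CR; apply Rabs_def1; lra).
  specialize (Hone Hm).
  assert (Hin : in_ball N (vscal (CR t) zeta)).
  { apply in_ball_unit_scal; try assumption. rewrite Cmod_CR, Rabs_pos_eq; lra. }
  set (x := F (vscal (CR t) zeta)) in *.
  assert (Hx : vnorm N x = t).
  { unfold x. rewrite origin_norm, vnorm_scal, Hn, Cmod_CR, Rabs_pos_eq; [lra|lra|exact Hin]. }
  assert (Ed : vdot N x w = CR (t / 2)).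
  { assert (nt : CR t <> C0) by (apply CR_neq0; lra).
    replace (vdot N x w) with (Cmul (CR (1 / 2)) (Cmul (CR t) (Cdiv (Cmul (CR 2) (vdot N x w)) (CR t)))).
    - rewrite Hone. apply C_ext; simpl; field.
    - replace (Cmul (CR t) (Cdiv (Cmul (CR 2) (vdot N x w)) (CR t))) with (Cmul (CR 2) (vdot N x w)) by (field; exact nt).
      apply C_ext; simpl; field. }
  (* Equality case of Cauchy-Schwarz: |x - 2 t w|^2 = t^2 - 2 t^2 + t^2 = 0. *)
  assert (Hz : vadd x (vscal (CR (- (2 * t))) w) = vzero).
  { apply (vzero_of_vnorm N).
    - apply supp_add; [|apply supp_scal]; apply H2; assumption.
    - pose proof (vnorm_sqr N (vadd x (vscal (CR (- (2 * t))) w))) as E.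
      rewrite vnorm2_add, vnorm2_scal, vdot_scal_r, Ed, <- !vnorm_sqr, Hx, Hw in E.
      unfold Cmod2 in E. simpl in E. pose proof (vnorm_ge0 N (vadd x (vscal (CR (- (2 * t))) w))). nra. }
  apply functional_extensionality. intros i. apply (f_equal (fun v => v i)) in Hz.
  unfold vadd, vscal, vzero in *. apply Csub_eq0. rewrite <- Hz. Csolve.
Qed.

(** By [origin_ray] the difference quotients of F at 0 along a ray are constant, hence equal to
    their limit, the differential at 0. *)
Lemma origin_linear : exists d : nat -> nat -> C, forall z i, in_ball N z -> (i < N)%nat ->
  F z i = linear_form N (d i) z.
Proof.
  pose proof HFG as (H1 & H2 & _ & _ & _).
  assert (H : forall i, exists d, (i < N)%nat -> vderiv N (fun x => F x i) vzero d).
  { intros i. destruct (Nat.lt_ge_cases i N) as [h|h].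
    - destruct (proj1 (holo_vderiv N _) (H1 i h) vzero (in_ball_zero N)) as [e E]. exists e. auto.
    - exists (fun _ => C0). intros; lia. }
  exists (fun i => proj1_sig (constructive_indefinite_description _ (H i))).
  intros z i Hz Hi. destruct (constructive_indefinite_description _ (H i)) as [d Hd]. simpl.
  destruct (excluded_middle_informative (z = vzero)) as [->|n].
  { now rewrite F0, linear_form_zero. }
  destruct (unit_direction z Hz n) as [zeta [Hs [Hn [Ez Hp]]]].
  pose proof (in_ball_vnorm N z Hz) as Hz1.
  assert (E : Cmul (CR 2) (F (vscal (CR (1 / 2)) zeta) i) = linear_form N d zeta).
  { apply Csub_eq0, Cmod_eq0, Rle_antisym; [|apply Cmod_ge0]. apply le_epsilon. intros eps He.
    destruct (proj2 (Hd Hi) eps He) as [dl [Hdl HH]].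
    set (t := Rmin (1 / 2) (dl / 2)).
    assert (Ht : 0 < t /\ t <= 1 / 2 /\ t <= dl / 2).
    { unfold t. split; [apply Rmin_glb_lt; lra|]. split; [apply Rmin_l|apply Rmin_r]. }
    specialize (HH (vscal (CR t) zeta) (supp_scal N _ _ Hs)).
    rewrite vnorm_scal, Hn, Cmod_CR, Rabs_pos_eq, Rmult_1_r in HH by lra.
    specialize (HH ltac:(lra)).
    replace (vadd vzero (vscal (CR t) zeta)) with (vscal (CR t) zeta) in HH
      by (apply functional_extensionality; intros j; unfold vadd, vzero; ring).
    rewrite (origin_ray zeta t Hs Hn ltac:(lra)), F0, linear_form_scal in HH.
    unfold vscal at 1, vzero in HH. set (A := F (vscal (CR (1 / 2)) zeta) i) in *.
    replace (Csub (Csub (Cmul (CR (2 * t)) A) C0) (Cmul (CR t) (linear_form N d zeta)))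
      with (Cmul (CR t) (Csub (Cmul (CR 2) A) (linear_form N d zeta))) in HH
      by (rewrite CR_mul; ring).
    rewrite Cmod_mul, Cmod_CR, Rabs_pos_eq in HH by lra.
    apply Rmult_le_reg_l with t; lra. }
  rewrite Ez at 1. rewrite (origin_ray zeta _ Hs Hn (conj Hp Hz1)).
  rewrite Ez at 2. rewrite linear_form_scal, <- E. unfold vscal at 1. rewrite CR_mul. ring.
Qed.

(** F is linear and preserves the norm, so polarisation with c = 1 and c = [Ci] recovers the inner
    product. The factors 1/2 keep the combination of z and c w inside the ball, where alone F is
    controlled. *)
Lemma origin_isometry z w : in_ball N z -> in_ball N w -> vdot N (F z) (F w) = vdot N z w.
Proof.
  intros Hz Hw. destruct origin_linear as [d Hd]. pose proof HFG as (_ & H2 & _).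
  assert (P : forall c, Cmod c = 1 ->
    re (Cmul (Cconj c) (vdot N (F z) (F w))) = re (Cmul (Cconj c) (vdot N z w))).
  { intros c Hc. set (x := vadd (vscal (CR (1 / 2)) z) (vscal (Cmul (CR (1 / 2)) c) w)).
    assert (Hx : in_ball N x).
    { apply vnorm_in_ball.
      - apply supp_add; apply supp_scal; [apply Hz|apply Hw].
      - eapply Rle_lt_trans; [apply vnorm_triangle|].
        rewrite !vnorm_scal, Cmod_mul, Hc, Cmod_CR, Rabs_pos_eq by lra.
        apply in_ball_vnorm in Hz. apply in_ball_vnorm in Hw. lra. }
    assert (EF : F x = vadd (vscal (CR (1 / 2)) (F z)) (vscal (Cmul (CR (1 / 2)) c) (F w))).
    { apply (vec_ext N).
      - now apply H2.
      - apply supp_add; apply supp_scal; now apply H2.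
      - intros i Hi. unfold vadd, vscal. rewrite !Hd by assumption.
        unfold x. rewrite linear_form_add, !linear_form_scal. reflexivity. }
    pose proof (vnorm_sqr N (F x)) as E. rewrite origin_norm, vnorm_sqr in E by exact Hx.
    rewrite EF in E. unfold x in E. rewrite !vnorm2_add, !vnorm2_scal, !vdot_scal_l, !vdot_scal_r in E.
    rewrite <- (vnorm_sqr N (F z)), <- (vnorm_sqr N (F w)), !origin_norm, !vnorm_sqr in E by assumption.
    rewrite !Cconj_mul, Cconj_CR in E. simpl in E. simpl. lra. }
  apply C_ext.
  - specialize (P C1 Cmod_1). simpl in P. lra.
  - specialize (P Ci). simpl in P.
    assert (Hi : Cmod Ci = 1).
    { unfold Cmod, Cmod2; simpl. replace (0 * 0 + 1 * 1) with 1 by ring. apply sqrt_1. }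
    specialize (P Hi). lra.
Qed.
End Origin.

(** The map chi o mob a fixes 0 because mob a 0 = a = kap 0, hence it is an isometry. Writing z =
    mob a (mob a z) then leaves the explicit case [mob_vdot]. *)
Theorem automorphism_vdot chi kap : inverse_pair N chi kap ->
  let a := kap vzero in forall z w, in_ball N z -> in_ball N w ->
  Cmul (Csub C1 (vdot N (chi z) (chi w)))
       (Cmul (Csub C1 (vdot N z a)) (Csub C1 (vdot N a w)))
  = Cmul (CR (1 - vnorm2 N a)) (Csub C1 (vdot N z w)).
Proof.
  intros H a z w Hz Hw. pose proof H as (_ & _ & _ & H4 & H5).
  assert (Ha : in_ball N a) by apply H4, in_ball_zero.
  pose proof (inverse_pair_comp _ _ _ _ H (mob_inverse_pair a Ha)) as HF.
  assert (F0 : chi (mob a vzero) = vzero).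
  { rewrite mob_0. apply H5, in_ball_zero. }
  pose proof (origin_isometry _ _ HF F0 (mob a z) (mob a w)
    (self_map_mob a Ha z Hz) (self_map_mob a Ha w Hw)) as E.
  cbv beta in E. rewrite !mob_invol in E by assumption. rewrite E.
  now apply mob_vdot.
Qed.
End Automorphisms.

(** * The logarithm *)

(* [- log (1 - x)], principal branch, for [re x < 1]. *)
Definition Llog (x : C) : C :=
  mkC (- / 2 * ln (Cmod2 (Csub C1 x))) (atan (im x / (1 - re x))).

Lemma Llog_0 : Llog C0 = C0.
Proof.
  unfold Llog, Cmod2; simpl.
  replace ((1 + - 0) * (1 + - 0) + (0 + - 0) * (0 + - 0)) with 1 by ring.
  rewrite ln_1. replace (0 / (1 - 0)) with 0 by field. rewrite atan_0. apply C_ext; simpl; ring.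
Qed.

Lemma re_Llog (x : C) : Cmod x < 1 -> re (Llog x) = - ln (Cmod (Csub C1 x)).
Proof.
  intros Hx. pose proof (Cmod_pos _ (one_minus_neq0 x Hx)). simpl.
  rewrite <- Cmod_sqr, ln_mult by assumption. field.
Qed.

Definition pderiv (f : R -> C) (t : R) (d : C) : Prop :=
  is_derive (fun t => re (f t)) t (re d) /\ is_derive (fun t => im (f t)) t (im d).

Lemma is_derive_bound (f df : R -> R) (M : R) :
  (forall t, 0 <= t <= 1 -> is_derive f t (df t)) -> (forall t, 0 <= t <= 1 -> Rabs (df t) <= M) ->
  Rabs (f 1 - f 0) <= M.
Proof.
  intros Hd Hb. destruct (MVT_gen f 0 1 df) as [c [Hc E]].
  - intros x Hx. rewrite Rmin_left, Rmax_right in Hx by lra. apply Hd; lra.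
  - intros x Hx. rewrite Rmin_left, Rmax_right in Hx by lra.
    apply continuity_pt_filterlim. apply (ex_derive_continuous (V := R_NormedModule)).
    eexists. apply Hd; lra.
  - rewrite Rmin_left, Rmax_right in Hc by lra. rewrite E.
    replace (df c * (1 - 0)) with (df c) by ring. apply Hb; lra.
Qed.

(** The mean value theorem is applied to real and imaginary parts separately; this costs the factor
    2. *)
Lemma pderiv_bound (f df : R -> C) (M : R) :
  (forall t, 0 <= t <= 1 -> pderiv f t (df t)) -> (forall t, 0 <= t <= 1 -> Cmod (df t) <= M) ->
  Cmod (Csub (f 1) (f 0)) <= 2 * M.
Proof.
  intros Hd Hb. eapply Rle_trans; [apply Cmod_le_abs|].
  pose proof (is_derive_bound (fun t => re (f t)) (fun t => re (df t)) M (fun t h => proj1 (Hd t h))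
    (fun t h => Rle_trans _ _ _ (Rabs_re_le _) (Hb t h))).
  pose proof (is_derive_bound (fun t => im (f t)) (fun t => im (df t)) M (fun t h => proj2 (Hd t h))
    (fun t h => Rle_trans _ _ _ (Rabs_im_le _) (Hb t h))).
  simpl. unfold Rminus in *. lra.
Qed.

Lemma is_derive_eps (f : R -> R) (t l : R) :
  (forall eps, 0 < eps -> exists delta, 0 < delta /\
    forall h, Rabs h < delta -> Rabs (f (t + h) - f t - l * h) <= eps * Rabs h) -> is_derive f t l.
Proof.
  intros H. apply is_derive_Reals. intros eps He.
  destruct (H (eps / 2)) as [d [Hd HH]]; [lra|].
  exists (mkposreal d Hd). intros h n Hh. simpl in Hh. specialize (HH h Hh).
  replace ((f (t + h) - f t) / h - l) with ((f (t + h) - f t - l * h) / h) by (field; exact n).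
  pose proof (Rabs_pos_lt h n). unfold Rdiv. rewrite Rabs_mult, Rabs_inv.
  apply Rmult_lt_reg_r with (Rabs h); [lra|]. rewrite Rmult_assoc, Rinv_l by lra. nra.
Qed.

Lemma cderiv_pderiv (F : C -> C) (t : R) (d : C) : cderiv F (CR t) d -> pderiv (fun t => F (CR t)) t d.
Proof.
  intros [_ H].
  assert (P : forall eps, 0 < eps -> exists delta, 0 < delta /\ forall h, Rabs h < delta ->
    Cmod (Csub (Csub (F (CR (t + h))) (F (CR t))) (Cmul d (CR h))) <= eps * Rabs h).
  { intros eps He. destruct (H eps He) as [dl [Hdl HH]]. exists dl; split; [exact Hdl|].
    intros h Hh. rewrite <- Cmod_CR in *. rewrite CR_add. now apply HH. }
  split; apply is_derive_eps; intros eps He; destruct (P eps He) as [dl [Hdl HH]];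
    exists dl; (split; [exact Hdl|]); intros h Hh; specialize (HH h Hh);
    (eapply Rle_trans; [|exact HH]).
  - eapply Rle_trans; [|apply Rabs_re_le]. right. apply f_equal. simpl. ring.
  - eapply Rle_trans; [|apply Rabs_im_le]. right. apply f_equal. simpl. ring.
Qed.

Lemma Llog_pderiv (a b : R -> R) (t a' b' : R) : a t < 1 ->
  is_derive a t a' -> is_derive b t b' ->
  pderiv (fun t => Llog (mkC (a t) (b t))) t (Cdiv (mkC a' b') (Csub C1 (mkC (a t) (b t)))).
Proof.
  intros Hat Ha Hb.
  assert (ea : ex_derive a t) by (eexists; exact Ha).
  assert (eb : ex_derive b t) by (eexists; exact Hb).
  assert (P : 0 < (1 + - a t) * (1 + - a t) + (0 + - b t) * (0 + - b t)) by nra.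
  assert (Da : @eq R (Derive (fun x : R => a x) t) a') by exact (is_derive_unique _ _ _ Ha).
  assert (Db : @eq R (Derive (fun x : R => b x) t) b') by exact (is_derive_unique _ _ _ Hb).
  split; unfold Llog, Cmod2; simpl.
  - auto_derive; [repeat split; assumption|].
    rewrite Da, Db.
    unfold Cmod2; simpl. field. lra.
  - auto_derive; [repeat split; try assumption; lra|].
    rewrite Da, Db.
    unfold Cmod2; simpl. unfold Rsqr. field. repeat split; try lra; nra.
Qed.

(** Along the segment from x to x + h the real derivative differs from the candidate h / (1 - x) by
    O(|h|^2). The mean value bound turns this into complex differentiability. *)
Lemma Llog_cderiv (x : C) : Cmod x < 1 -> cderiv Llog x (Cinv (Csub C1 x)).
Proof.
  intros Hx. set (rho := 1 - Cmod x). assert (Hrho : 0 < rho) by (unfold rho; lra).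
  assert (Hlow : forall h, Cmod h <= rho / 2 -> rho / 2 <= Cmod (Csub C1 (Cadd x h)) /\ re (Cadd x h) < 1).
  { intros h Hh. pose proof (Cmod_triangle x h). pose proof (re_le_Cmod (Cadd x h)).
    pose proof (Cmod_sub_ge C1 (Cadd x h)). rewrite Cmod_1 in *. unfold rho in *. split; lra. }
  assert (Hx1 : rho <= Cmod (Csub C1 x)).
  { pose proof (Cmod_sub_ge C1 x). rewrite Cmod_1 in *. unfold rho; lra. }
  split.
  - exists (Cmod (Cinv (Csub C1 x))). split; [apply Cmod_ge0|]. intros h _. rewrite Cmod_mul; lra.
  (* The first bound keeps |1 - x - t h| >= rho / 2; the second makes the resulting remainder 4
     |h|^2 / rho^2 at most eps |h|. *)
  - intros eps He. set (dl := Rmin (rho / 2) (eps * (rho * rho) / 4)).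
    assert (Hdl : 0 < dl).
    { apply Rmin_glb_lt; [lra|]. apply Rdiv_lt_0_compat; [|lra]. repeat apply Rmult_lt_0_compat; lra. }
    exists dl; split; [exact Hdl|]. intros h _ Hh. apply lt_Rmin in Hh. destruct Hh as [h1 h2].
    pose proof (Cmod_ge0 h) as h0.
    set (f := fun t => Csub (Llog (mkC (re x + t * re h) (im x + t * im h)))
                            (Cmul (CR t) (Cmul (Cinv (Csub C1 x)) h))).
    set (df := fun t => Csub (Cdiv h (Csub C1 (Cadd x (Cmul (CR t) h)))) (Cmul (Cinv (Csub C1 x)) h)).
    assert (Ht : forall t, 0 <= t <= 1 -> Cmod (Cmul (CR t) h) <= Cmod h).
    { intros t Ht. rewrite Cmod_mul, Cmod_CR, Rabs_pos_eq by lra. nra. }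
    assert (B : Cmod (Csub (f 1) (f 0)) <= 2 * (Cmod h * Cmod h * (2 / (rho * rho)))).
    { apply (pderiv_bound f df).
      - intros t Htt. assert (E : mkC (re x + t * re h) (im x + t * im h) = Cadd x (Cmul (CR t) h)) by Csolve.
        destruct (Hlow (Cmul (CR t) h)) as [_ Hre]; [specialize (Ht t Htt); lra|].
        rewrite <- E in Hre. simpl in Hre.
        destruct (Llog_pderiv (fun t => re x + t * re h) (fun t => im x + t * im h) t (re h) (im h)) as [P1 P2].
        + exact Hre.
        + auto_derive; [exact I|ring].
        + auto_derive; [exact I|ring].
        + rewrite E in P1, P2. replace (mkC (re h) (im h)) with h in P1, P2 by Csolve.
          unfold f, df, Csub at 1 4.
          set (q := Cmul (Cinv (Csub C1 x)) h) in *.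
          split.
          * apply (is_derive_ext (fun t => re (Llog (mkC (re x + t * re h) (im x + t * im h))) + - (t * re q))).
            { intros s. simpl. ring. }
            simpl. apply (is_derive_plus (V := R_NormedModule)); [exact P1|]. auto_derive; [exact I|ring].
          * apply (is_derive_ext (fun t => im (Llog (mkC (re x + t * re h) (im x + t * im h))) + - (t * im q))).
            { intros s. simpl. ring. }
            simpl. apply (is_derive_plus (V := R_NormedModule)); [exact P2|]. auto_derive; [exact I|ring].
      - intros t Htt. specialize (Ht t Htt). destruct (Hlow (Cmul (CR t) h)) as [Hl _]; [lra|].
        assert (n1 : Csub C1 (Cadd x (Cmul (CR t) h)) <> C0) by (apply Cmod_gt0_neq; lra).
        assert (n2 : Csub C1 x <> C0) by (apply Cmod_gt0_neq; lra).
        unfold df.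
        replace (Csub (Cdiv h (Csub C1 (Cadd x (Cmul (CR t) h)))) (Cmul (Cinv (Csub C1 x)) h)) with
          (Cdiv (Cmul h (Cmul (CR t) h)) (Cmul (Csub C1 (Cadd x (Cmul (CR t) h))) (Csub C1 x)))
          by (field; split; assumption).
        rewrite Cmod_div by now apply Cmul_neq0. rewrite (Cmod_mul h), (Cmod_mul (Csub _ _)).
        unfold Rdiv. apply Rmult_le_compat.
        + apply Rmult_le_pos; apply Cmod_ge0.
        + left. apply Rinv_0_lt_compat. apply Rmult_lt_0_compat; lra.
        + apply Rmult_le_compat_l; [exact h0|exact Ht].
        + replace (2 * / (rho * rho)) with (/ (rho / 2 * rho)) by (field; lra).
          apply Rinv_le_contravar; [nra|]. apply Rmult_le_compat; lra. }
    unfold f in B.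
    replace (mkC (re x + 1 * re h) (im x + 1 * im h)) with (Cadd x h) in B by Csolve.
    replace (mkC (re x + 0 * re h) (im x + 0 * im h)) with x in B by Csolve.
    replace (Csub (Csub (Llog (Cadd x h)) (Llog x)) (Cmul (Cinv (Csub C1 x)) h)) with
      (Csub (Csub (Llog (Cadd x h)) (Cmul (CR 1) (Cmul (Cinv (Csub C1 x)) h)))
            (Csub (Llog x) (Cmul (CR 0) (Cmul (Cinv (Csub C1 x)) h))))
      by (change (CR 1) with C1; change (CR 0) with C0; ring).
    eapply Rle_trans; [exact B|].
    replace (2 * (Cmod h * Cmod h * (2 / (rho * rho)))) with (Cmod h * 4 / (rho * rho) * Cmod h) by (field; lra).
    apply Rmult_le_compat_r; [exact h0|].
    replace eps with (eps * (rho * rho) / 4 * 4 / (rho * rho)) by (field; lra).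
    unfold Rdiv. apply Rmult_le_compat_r; [left; apply Rinv_0_lt_compat; nra|]. unfold Rdiv in h2. lra.
Qed.

(** * The power series of the logarithm and its behaviour under automorphisms *)

Definition rinv (k : nat) : R := match k with O => 0 | S _ => / INR k end.
Definition lterm (x : C) (k : nat) : C := Cmul (CR (rinv k)) (Cpow x k).

Lemma cderiv_pow_S (n : nat) (z : C) : cderiv (fun x => Cpow x (S n)) z (Cmul (CR (INR (S n))) (Cpow z n)).
Proof.
  induction n as [|n IH].
  - eapply cderiv_eq; [|apply (cderiv_mul (fun x => x) (fun x => Cpow x 0)); [apply cderiv_id|exact (cderiv_const C1 z)]].
    cbv beta. simpl. change (CR 1) with C1. ring.
  - eapply cderiv_eq; [|apply (cderiv_mul (fun x => x) (fun x => Cpow x (S n))); [apply cderiv_id|exact IH]].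
    cbv beta. rewrite (S_INR (S n)), CR_add. change (CR 1) with C1. cbn [Cpow]. ring.
Qed.

Lemma cderiv_partial_log (n : nat) (z : C) :
  cderiv (fun x => Csum (map (lterm x) (seq 0 (S n)))) z (Csum (map (Cpow z) (seq 0 n))).
Proof.
  induction n as [|n IH].
  - eapply cderiv_eq; [|apply cderiv_local with (f := fun _ => C0) (r := 1); [lra| |apply cderiv_const]].
    + reflexivity.
    + intros h _. simpl. unfold lterm. simpl. change (CR 0) with C0. ring.
  - rewrite Csum_seq_S.
    replace (fun x => Csum (map (lterm x) (seq 0 (S (S n))))) with
      (fun x => Cadd (Csum (map (lterm x) (seq 0 (S n)))) (lterm x (S n)))
      by (apply functional_extensionality; intros x; now rewrite (Csum_seq_S (lterm x) (S n))).
    apply cderiv_add; [exact IH|]. unfold lterm.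
    eapply cderiv_eq; [|apply cderiv_mul; [apply cderiv_const|apply cderiv_pow_S]].
    cbv beta. unfold rinv.
    replace (Cmul (CR (/ INR (S n))) (Cmul (CR (INR (S n))) (Cpow z n))) with (Cpow z n); [ring|].
    assert (E : Cmul (CR (/ INR (S n))) (CR (INR (S n))) = C1).
    { rewrite <- CR_mul, Rinv_l; [reflexivity|]. apply not_0_INR. lia. }
    transitivity (Cmul (Cmul (CR (/ INR (S n))) (CR (INR (S n)))) (Cpow z n)); [rewrite E|]; ring.
Qed.

Lemma geometric_sum (n : nat) (z : C) : Cmul (Csub C1 z) (Csum (map (Cpow z) (seq 0 n))) = Csub C1 (Cpow z n).
Proof.
  induction n as [|n IH]; [simpl; ring|]. rewrite Csum_seq_S. cbn [Cpow].
  transitivity (Cadd (Cmul (Csub C1 z) (Csum (map (Cpow z) (seq 0 n)))) (Cmul (Csub C1 z) (Cpow z n))); [ring|].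
  rewrite IH. ring.
Qed.

Lemma segment_bound (F : C -> C) (x : C) (D : C -> C) (M : R) :
  (forall t, 0 <= t <= 1 -> cderiv F (Cmul (CR t) x) (D (Cmul (CR t) x))) ->
  (forall t, 0 <= t <= 1 -> Cmod (Cmul (D (Cmul (CR t) x)) x) <= M) ->
  Cmod (Csub (F x) (F C0)) <= 2 * M.
Proof.
  intros HF HD.
  assert (P := pderiv_bound (fun t => F (Cmul (CR t) x)) (fun t => Cmul (D (Cmul (CR t) x)) x) M).
  cbv beta in P. replace (Cmul (CR 1) x) with x in P by Csolve.
  replace (Cmul (CR 0) x) with C0 in P by Csolve. apply P; [|exact HD].
  intros t Ht. apply (cderiv_pderiv (fun l => F (Cmul l x))).
  apply (cderiv_comp (fun l => Cmul l x) F); [|now apply HF].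
  eapply cderiv_eq; [|apply cderiv_mul; [apply cderiv_id|apply cderiv_const]]. cbv beta. ring.
Qed.

(** The remainder after degree n has derivative z^n / (1 - z), by the geometric sum. Bounding it on
    the segment from 0 to x gives geometric decay. *)
Lemma Llog_series (x : C) : Cmod x < 1 ->
  Ccv (fun n => Csum (map (lterm x) (seq 0 (S n)))) (Llog x).
Proof.
  intros Hx. pose proof (Cmod_ge0 x) as x0.
  assert (B : forall n, Cmod (Csub (Csum (map (lterm x) (seq 0 (S n)))) (Llog x)) <=
     2 / (1 - Cmod x) * Cmod x ^ n).
  { intros n. rewrite Cmod_sub_sym.
    set (F := fun z => Csub (Llog z) (Csum (map (lterm z) (seq 0 (S n))))).
    set (D := fun z => Cdiv (Cpow z n) (Csub C1 z)).
    assert (Htx : forall t, 0 <= t <= 1 -> Cmod (Cmul (CR t) x) <= Cmod x).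
    { intros t Ht. rewrite Cmod_mul, Cmod_CR, Rabs_pos_eq by lra. nra. }
    pose proof (segment_bound F x D (Cmod x ^ n / (1 - Cmod x))) as P.
    assert (F0 : F C0 = C0).
    { unfold F. rewrite Llog_0. rewrite Csum_zero; [ring|].
      intros [|k] _; unfold lterm; simpl; [change (CR 0) with C0|]; ring. }
    rewrite F0 in P. replace (Csub (F x) C0) with (F x) in P by ring.
    replace (2 / (1 - Cmod x) * Cmod x ^ n) with (2 * (Cmod x ^ n / (1 - Cmod x))) by (field; lra).
    apply P; clear P.
    - intros t Ht. specialize (Htx t Ht). set (z := Cmul (CR t) x) in *.
      assert (n1 : Csub C1 z <> C0) by (apply one_minus_neq0; lra).
      eapply cderiv_eq; [|apply cderiv_sub; [apply Llog_cderiv; lra|apply cderiv_partial_log]].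
      unfold D. pose proof (geometric_sum n z) as G.
      replace (Csum (map (Cpow z) (seq 0 n))) with
        (Cdiv (Cmul (Csub C1 z) (Csum (map (Cpow z) (seq 0 n)))) (Csub C1 z)) by (field; exact n1).
      rewrite G. field. exact n1.
    - intros t Ht. specialize (Htx t Ht). set (z := Cmul (CR t) x) in *.
      assert (n1 : Csub C1 z <> C0) by (apply one_minus_neq0; lra).
      unfold D. rewrite Cmod_mul, Cmod_div, Cmod_pow by exact n1.
      pose proof (Cmod_sub_ge C1 z) as Q. rewrite Cmod_1 in Q. pose proof (Cmod_ge0 z) as z0.
      apply Rle_trans with (Cmod z ^ n / Cmod (Csub C1 z) * 1).
      + apply Rmult_le_compat_l; [|lra]. apply Rdiv_le_0_compat; [now apply pow_le|lra].
      + rewrite Rmult_1_r. unfold Rdiv. apply Rmult_le_compat.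
        * now apply pow_le.
        * left. apply Rinv_0_lt_compat. lra.
        * apply pow_incr. lra.
        * apply Rinv_le_contravar; lra. }
  intros eps He.
  assert (Hc : 0 < 2 / (1 - Cmod x)) by (apply Rdiv_lt_0_compat; lra).
  destruct (pow_lt_1_zero (Cmod x)) with (y := eps / (2 / (1 - Cmod x))) as [n0 Hn].
  - rewrite Rabs_pos_eq; lra.
  - now apply Rdiv_lt_0_compat.
  - exists n0. intros n h. specialize (Hn n h). rewrite Rabs_pos_eq in Hn by now apply pow_le.
    eapply Rle_lt_trans; [apply B|].
    replace eps with (2 / (1 - Cmod x) * (eps / (2 / (1 - Cmod x)))) by (field; lra).
    now apply Rmult_lt_compat_l.
Qed.

(* The two sides have the same logarithmic derivative along [0, 1]; this avoids
   the ambiguity of the argument in taking logarithms of the product identity. *)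
Lemma Llog_mobius (x y K : C) : Cmod x < 1 -> Cmod y < 1 -> K <> C0 ->
  (forall t, 0 <= t <= 1 -> Cmod (Csub C1 (Cdiv (Cmul K (Csub C1 (Cmul (CR t) x)))
                                               (Csub C1 (Cmul (CR t) y)))) < 1) ->
  Cadd (Llog (Csub C1 (Cdiv (Cmul K (Csub C1 x)) (Csub C1 y)))) (Llog y)
  = Cadd (Llog x) (Llog (Csub C1 K)).
Proof.
  intros Hx Hy HK Hu.
  set (u := fun l => Csub C1 (Cmul (Cmul K (Csub C1 (Cmul l x))) (Cinv (Csub C1 (Cmul l y))))).
  set (F := fun l => Csub (Cadd (Llog (u l)) (Llog (Cmul l y))) (Llog (Cmul l x))).
  assert (Hlin : forall c l, cderiv (fun l => Cmul l c) l c).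
  { intros c l. eapply cderiv_eq; [|apply cderiv_mul; [apply cderiv_id|apply cderiv_const]]. cbv beta. ring. }
  assert (Hlin1 : forall c l, cderiv (fun l => Csub C1 (Cmul l c)) l (Copp c)).
  { intros c l. eapply cderiv_eq; [|apply cderiv_sub; [apply cderiv_const|apply Hlin]]. ring. }
  assert (Ht1 : forall t c, 0 <= t <= 1 -> Cmod c < 1 -> Cmod (Cmul (CR t) c) < 1).
  { intros t c Ht Hc. rewrite Cmod_mul, Cmod_CR, Rabs_pos_eq by lra. pose proof (Cmod_ge0 c). nra. }
  assert (HF : forall t, 0 <= t <= 1 -> cderiv F (CR t) C0).
  { intros t Ht. pose proof (one_minus_neq0 _ (Ht1 t y Ht Hy)) as ny.
    pose proof (one_minus_neq0 _ (Ht1 t x Ht Hx)) as nx.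
    unfold F. eapply cderiv_eq; [|apply cderiv_sub; [apply cderiv_add|]].
    2:{ apply (cderiv_comp u Llog); [|apply Llog_cderiv; exact (Hu t Ht)].
        unfold u. apply cderiv_sub; [apply cderiv_const|].
        apply cderiv_mul; [apply cderiv_mul; [apply cderiv_const|apply Hlin1]|].
        apply (cderiv_comp (fun l => Csub C1 (Cmul l y)) Cinv); [apply Hlin1|now apply cderiv_inv]. }
    2:{ apply (cderiv_comp (fun l => Cmul l y) Llog); [apply Hlin|]. apply Llog_cderiv. now apply Ht1. }
    2:{ apply (cderiv_comp (fun l => Cmul l x) Llog); [apply Hlin|]. apply Llog_cderiv. now apply Ht1. }
    cbv beta. set (X := Cmul (CR t) x) in *.
    replace (Csub C1 (u (CR t))) with (Cdiv (Cmul K (Csub C1 X)) (Csub C1 (Cmul (CR t) y)))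
      by (unfold u, Cdiv; fold X; ring).
    unfold X in *. field. repeat split; assumption. }
  pose proof (segment_bound F C1 (fun _ => C0) 0) as P.
  assert (E : Cmod (Csub (F C1) (F C0)) <= 2 * 0).
  { apply P.
    - intros t Ht. replace (Cmul (CR t) C1) with (CR t) by ring. now apply HF.
    - intros t Ht. replace (Cmul C0 C1) with C0 by ring. rewrite Cmod_0. lra. }
  assert (E' : F C1 = F C0).
  { apply Csub_eq0, Cmod_eq0. pose proof (Cmod_ge0 (Csub (F C1) (F C0))). lra. }
  unfold F, u in E'.
  replace (Cmul C1 x) with x in E' by ring. replace (Cmul C1 y) with y in E' by ring.
  replace (Cmul C0 x) with C0 in E' by ring. replace (Cmul C0 y) with C0 in E' by ring.
  replace (Csub C1 (Cmul (Cmul K (Csub C1 C0)) (Cinv (Csub C1 C0)))) with (Csub C1 K) in E'.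
  2:{ replace (Csub C1 C0) with C1 by ring. field. exact C1_neq_C0. }
  rewrite Llog_0 in E'. unfold Cdiv.
  set (A := Llog (Csub C1 (Cmul (Cmul K (Csub C1 x)) (Cinv (Csub C1 y))))) in *.
  transitivity (Cadd (Csub (Cadd A (Llog y)) (Llog x)) (Llog x)); [ring|]. rewrite E'. ring.
Qed.

(** With v = kap w, hence chi v = w, [automorphism_vdot] writes 1 - <chi x, w> as K (1 - <x, v>) /
    (1 - <x, a>). On the segment t z the points chi (t z) stay in the ball, which supplies the
    hypothesis of [Llog_mobius] along the whole path. *)
Lemma Llog_automorphism (N : nat) (chi kap : vec -> vec) : inverse_pair N chi kap ->
  forall z w, in_ball N z -> in_ball N w ->
  Cadd (Llog (vdot N (chi z) w)) (Llog (vdot N z (kap vzero)))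
  = Cadd (Llog (vdot N z (kap w))) (Llog (vdot N (chi vzero) w)).
Proof.
  intros H z w Hz Hw. pose proof H as (_ & H2 & _ & H4 & H5).
  set (a := kap vzero). assert (Ha : in_ball N a) by apply H4, in_ball_zero.
  set (v := kap w). assert (Hv : in_ball N v) by now apply H4.
  assert (Ew : chi v = w) by now apply H5.
  set (K := Cdiv (CR (1 - vnorm2 N a)) (Csub C1 (vdot N a v))).
  pose proof (one_minus_vdot_neq0 N a v Ha Hv) as nav.
  assert (nK : K <> C0).
  { unfold K. apply Cmod_gt0_neq. rewrite Cmod_div by exact nav. apply Rdiv_lt_0_compat; [|now apply Cmod_pos].
    rewrite Cmod_CR. destruct Ha as [_ Ha]. rewrite Rabs_pos_eq; lra. }
  assert (HT : forall x, in_ball N x ->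
    vdot N (chi x) w = Csub C1 (Cdiv (Cmul K (Csub C1 (vdot N x v))) (Csub C1 (vdot N x a)))).
  { intros x Hx. pose proof (automorphism_vdot N chi kap H x v Hx Hv) as E. cbv zeta in E.
    fold a in E. rewrite Ew in E. pose proof (one_minus_vdot_neq0 N x a Hx Ha) as nxa.
    assert (E' : Csub C1 (vdot N (chi x) w) = Cdiv (Cmul (CR (1 - vnorm2 N a)) (Csub C1 (vdot N x v)))
      (Cmul (Csub C1 (vdot N x a)) (Csub C1 (vdot N a v)))).
    { rewrite <- E. field. split; assumption. }
    transitivity (Csub C1 (Csub C1 (vdot N (chi x) w))); [ring|]. rewrite E'. unfold K. field.
    split; assumption. }
  rewrite HT by exact Hz. rewrite (HT vzero (in_ball_zero N)), !vdot_zero_l.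
  replace (Cdiv (Cmul K (Csub C1 C0)) (Csub C1 C0)) with K.
  2:{ replace (Csub C1 C0) with C1 by ring. field. exact C1_neq_C0. }
  apply Llog_mobius; [now apply vdot_ball_lt1|now apply vdot_ball_lt1|exact nK|].
  intros t Ht. assert (Hin : in_ball N (vscal (CR t) z)).
  { apply in_ball_scal; [rewrite Cmod_CR, Rabs_pos_eq; lra|exact Hz]. }
  rewrite <- !vdot_scal_l, <- HT by exact Hin. apply vdot_ball_lt1; [now apply H2|exact Hw].
Qed.

(** * Homogeneous expansions *)

Lemma Csum_flat_map {A B : Type} (f : B -> C) (g : A -> list B) (l : list A) :
  Csum (map f (flat_map g l)) = Csum (map (fun j => Csum (map f (g j))) l).
Proof. induction l as [|j l IH]; simpl; [reflexivity|]. now rewrite map_app, Csum_app, IH. Qed.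

Lemma Csum_seq_shift (f : nat -> C) (n : nat) :
  Csum (map f (seq 0 (S n))) = Cadd (f O) (Csum (map (fun j => f (S j)) (seq 0 n))).
Proof. cbn [seq]. rewrite <- seq_shift, map_cons, map_map. reflexivity. Qed.

Lemma mi_spec (N : nat) : forall k a, In a (mi N k) <-> length a = N /\ list_sum a = k.
Proof.
  induction N as [|N IH]; intros k a.
  - simpl. destruct (Nat.eqb_spec k 0) as [->|n].
    + split; [intros [<-|[]]; auto|intros [Ha _]; left; now destruct a].
    + split; [intros []|]. intros [Ha Hs]. destruct a; [|discriminate]. simpl in Hs. lia.
  - cbn [mi]. rewrite in_flat_map. split.
    + intros [j [Hj Ha]]. apply in_seq in Hj. apply in_map_iff in Ha.
      destruct Ha as [b [<- Hb]]. apply IH in Hb. simpl. lia.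
    + intros [Hl Hs]. destruct a as [|j b]; [discriminate|]. simpl in Hl, Hs.
      exists j. split; [apply in_seq; lia|]. apply in_map. apply IH. lia.
Qed.

Lemma afact_pos (a : list nat) : (0 < afact a)%nat.
Proof. induction a as [|n a IH]; cbn; [lia|]. pose proof (lt_O_fact n). now apply Nat.mul_pos_pos. Qed.

Lemma INR_fact_pos (n : nat) : 0 < INR (fact n).
Proof. apply lt_0_INR, lt_O_fact. Qed.

Lemma INR_afact_pos (a : list nat) : 0 < INR (afact a).
Proof. apply lt_0_INR, afact_pos. Qed.

(** Divided powers: with them the binomial and multinomial theorems carry no coefficients. *)
Definition epow (k : nat) (x : C) : C := Cmul (CR (/ INR (fact k))) (Cpow x k).

Lemma epow_S (k : nat) (x : C) : Cmul x (epow k x) = Cmul (CR (INR (S k))) (epow (S k) x).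
Proof.
  unfold epow. rewrite fact_simpl, mult_INR. pose proof (INR_fact_pos k).
  assert (0 < INR (S k)) by (apply lt_0_INR; lia).
  replace (/ INR (fact k)) with (INR (S k) * / (INR (S k) * INR (fact k))) by (field; lra).
  rewrite (CR_mul (INR (S k)) (/ _)). simpl Cpow. ring.
Qed.

(** After multiplication by k + 1, the factor x + y raises the index of either factor by one, and
    the two shifted sums recombine through k + 1 = j + (k + 1 - j). *)
Lemma epow_add (k : nat) (x y : C) :
  epow k (Cadd x y) = Csum (map (fun j => Cmul (epow j x) (epow (k - j) y)) (seq 0 (S k))).
Proof.
  induction k as [|k IH].
  - simpl. unfold epow. simpl. rewrite Rinv_1. change (CR 1) with C1. ring.
  - assert (n : CR (INR (S k)) <> C0) by (apply CR_neq0, not_0_INR; lia).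
    assert (E : Cmul (CR (INR (S k))) (epow (S k) (Cadd x y)) = Cmul (CR (INR (S k)))
      (Csum (map (fun j => Cmul (epow j x) (epow (S k - j) y)) (seq 0 (S (S k)))))).
    { rewrite <- epow_S, IH.
      transitivity (Cadd (Csum (map (fun j => Cmul (CR (INR (S j))) (Cmul (epow (S j) x) (epow (k - j) y))) (seq 0 (S k))))
        (Csum (map (fun j => Cmul (CR (INR (S k - j))) (Cmul (epow j x) (epow (S k - j) y))) (seq 0 (S k))))).
      - rewrite <- Csum_mul_l, <- Csum_add. apply Csum_ext. intros j Hj. apply in_seq in Hj.
        replace (S k - j)%nat with (S (k - j)) by lia.
        transitivity (Cadd (Cmul (Cmul x (epow j x)) (epow (k - j) y)) (Cmul (epow j x) (Cmul y (epow (k - j) y)))); [ring|].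
        rewrite !epow_S. ring.
      - assert (E1 : Csum (map (fun j => Cmul (CR (INR (S j))) (Cmul (epow (S j) x) (epow (k - j) y))) (seq 0 (S k)))
          = Csum (map (fun j => Cmul (CR (INR j)) (Cmul (epow j x) (epow (S k - j) y))) (seq 0 (S (S k))))).
        { rewrite (Csum_seq_shift (fun j => Cmul (CR (INR j)) (Cmul (epow j x) (epow (S k - j) y)))).
          match goal with |- ?a = Cadd ?b ?c => change c with a; replace b with C0; [ring|] end.
          change (CR (INR 0)) with C0. ring. }
        assert (E2 : Csum (map (fun j => Cmul (CR (INR (S k - j))) (Cmul (epow j x) (epow (S k - j) y))) (seq 0 (S k)))
          = Csum (map (fun j => Cmul (CR (INR (S k - j))) (Cmul (epow j x) (epow (S k - j) y))) (seq 0 (S (S k))))).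
        { rewrite (Csum_seq_S _ (S k)), Nat.sub_diag. simpl (INR 0). change (CR 0) with C0. ring. }
        rewrite E1, E2, <- Csum_add, <- Csum_mul_l. apply Csum_ext. intros j Hj. apply in_seq in Hj.
        replace (INR (S k)) with (INR j + INR (S k - j)) by (rewrite <- plus_INR; f_equal; lia).
        rewrite CR_add. ring. }
    transitivity (Cmul (Cinv (CR (INR (S k)))) (Cmul (CR (INR (S k))) (epow (S k) (Cadd x y)))); [field; exact n|].
    rewrite E. field. exact n.
Qed.

Lemma Cpow_mul (x y : C) (n : nat) : Cpow (Cmul x y) n = Cmul (Cpow x n) (Cpow y n).
Proof. induction n; simpl; [ring|]. rewrite IHn. ring. Qed.

Lemma Cpow_add (x : C) (m n : nat) : Cpow x (m + n) = Cmul (Cpow x m) (Cpow x n).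
Proof. induction m; simpl; [ring|]. rewrite IHm. ring. Qed.

Lemma Cpow_CR (t : R) (n : nat) : Cpow (CR t) n = CR (t ^ n).
Proof. induction n as [|n IH]; simpl; [reflexivity|]. now rewrite IH, CR_mul. Qed.

Lemma monoAux_mul (z w : vec) : forall a i,
  Cmul (monoAux z i a) (Cconj (monoAux w i a)) = monoAux (fun j => Cmul (z j) (Cconj (w j))) i a.
Proof.
  induction a as [|n a IH]; intros i; simpl; [Csolve|].
  rewrite <- IH, Cconj_mul, Cconj_pow, Cpow_mul. ring.
Qed.

(** Splitting off the first exponent turns the sum over [mi] into the convolution of [epow_add]. *)
Lemma multinomial (x : vec) : forall N k i,
  Csum (map (fun a => Cmul (CR (/ INR (afact a))) (monoAux x i a)) (mi N k))
  = epow k (Csum (map x (seq i N))).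
Proof.
  induction N as [|N IH]; intros k i.
  - simpl. destruct k as [|k]; simpl; unfold epow; simpl.
    + rewrite Rinv_1. change (CR 1) with C1. ring.
    + ring.
  - cbn [mi]. rewrite Csum_flat_map.
    change (Csum (map x (seq i (S N)))) with (Cadd (x i) (Csum (map x (seq (S i) N)))).
    rewrite epow_add. apply Csum_ext. intros j Hj. rewrite map_map, <- IH, <- Csum_mul_l.
    apply Csum_ext. intros a _. cbn [monoAux afact map fold_right]. fold (afact a).
    unfold epow. rewrite mult_INR, Rinv_mult, CR_mul. ring.
Qed.

(* Coefficients of [z |-> - log (1 - <z, w>)]. *)
Definition kc (w : vec) (a : list nat) : C :=
  Cmul (CR (rinv (list_sum a) * (INR (fact (list_sum a)) / INR (afact a)))) (Cconj (mono w a)).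

Lemma homog_kc (N : nat) (w z : vec) (k : nat) : homog N (kc w) k z = lterm (vdot N z w) k.
Proof.
  unfold homog, lterm.
  transitivity (Cmul (CR (rinv k * INR (fact k)))
    (Csum (map (fun a => Cmul (CR (/ INR (afact a))) (monoAux (fun j => Cmul (z j) (Cconj (w j))) 0 a)) (mi N k)))).
  - rewrite <- Csum_mul_l. apply Csum_ext. intros a Ha. apply mi_spec in Ha. destruct Ha as [_ Ha].
    rewrite <- monoAux_mul. unfold kc, mono. rewrite Ha. unfold Rdiv. rewrite <- Rmult_assoc, CR_mul. ring.
  - rewrite multinomial. unfold epow, vdot. rewrite CR_mul.
    pose proof (INR_fact_pos k).
    assert (E : Cmul (CR (INR (fact k))) (CR (/ INR (fact k))) = C1)
      by (rewrite <- CR_mul, Rinv_r by lra; reflexivity).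
    set (X := Cpow _ k).
    transitivity (Cmul (Cmul (CR (INR (fact k))) (CR (/ INR (fact k)))) (Cmul (CR (rinv k)) X)); [ring|].
    rewrite E. ring.
Qed.

(** The degree 0 part is suppressed because its weight is 0: the seminorm cannot see constants. *)
Definition homog1 (N : nat) (c : list nat -> C) (w : vec) (k : nat) : C :=
  match k with O => C0 | S _ => homog N c k w end.

Lemma homog1_kc (N : nat) (w z : vec) (k : nat) : homog1 N (kc w) z k = lterm (vdot N z w) k.
Proof.
  destruct k; [|apply homog_kc]. unfold homog1, lterm; simpl. change (CR 0) with C0. ring.
Qed.

(** The reproducing property, one degree at a time: in positive degree the weight is the reciprocal
    of the numerical factor in [kc]. *)
Lemma Dterm_kc (N : nat) (c : list nat -> C) (w : vec) (k : nat) :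
  Dterm N c (kc w) k = homog1 N c w k.
Proof.
  unfold Dterm, homog1. destruct k as [|k].
  - apply Csum_zero. intros a _. unfold weight. simpl (INR 0). unfold Rdiv. rewrite !Rmult_0_l.
    change (CR 0) with C0. ring.
  - apply Csum_ext. intros a Ha. apply mi_spec in Ha. destruct Ha as [_ Ha].
    unfold kc. rewrite Ha, Cconj_mul, Cconj_CR, Cconj_conj. unfold rinv, weight.
    pose proof (INR_fact_pos (S k)). pose proof (INR_afact_pos a).
    assert (0 < INR (S k)) by (apply lt_0_INR; lia).
    set (A := INR (S k) * INR (afact a) / INR (fact (S k))).
    set (B := / INR (S k) * (INR (fact (S k)) / INR (afact a))).
    assert (E : Cmul (CR A) (CR B) = C1).
    { rewrite <- CR_mul. replace (A * B) with 1; [reflexivity|]. unfold A, B. field. repeat split; lra. }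
    transitivity (Cmul (Cmul (CR A) (CR B)) (Cmul (c a) (mono w a))); [ring|]. rewrite E. ring.
Qed.

Lemma weight_ge0 (k : nat) (a : list nat) : 0 <= weight k a.
Proof.
  unfold weight. apply Rdiv_le_0_compat; [|apply INR_fact_pos].
  apply Rmult_le_pos; [apply pos_INR|left; apply INR_afact_pos].
Qed.

Lemma weight_pos (k : nat) (a : list nat) : 0 < weight (S k) a.
Proof.
  unfold weight. apply Rdiv_lt_0_compat; [|apply INR_fact_pos].
  apply Rmult_lt_0_compat; [apply lt_0_INR; lia|apply INR_afact_pos].
Qed.

Lemma weight_0 (a : list nat) : weight 0 a = 0.
Proof. unfold weight. simpl. unfold Rdiv. now rewrite !Rmult_0_l. Qed.

Lemma monoAux_scal (l : C) (z : vec) : forall a i,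
  monoAux (vscal l z) i a = Cmul (Cpow l (list_sum a)) (monoAux z i a).
Proof.
  induction a as [|n a IH]; intros i; [simpl; ring|]. cbn [monoAux list_sum fold_right].
  fold (list_sum a). rewrite IH, Cpow_add. unfold vscal. rewrite Cpow_mul. ring.
Qed.

Lemma homog_scal (N : nat) (c : list nat -> C) (k : nat) (l : C) (z : vec) :
  homog N c k (vscal l z) = Cmul (Cpow l k) (homog N c k z).
Proof.
  unfold homog. rewrite <- Csum_mul_l. apply Csum_ext. intros a Ha. apply mi_spec in Ha.
  destruct Ha as [_ Ha]. unfold mono. rewrite monoAux_scal, Ha. ring.
Qed.

(** * Uniqueness of expansions *)

Lemma real_power_series_unique (b : nat -> R) :
  (forall t, Rabs t < 1 -> Un_cv (fun n => Rsum (map (fun k => b k * t ^ k) (seq 0 (S n)))) 0) ->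
  forall k, b k = 0.
Proof.
  intros H k.
  assert (Hs : forall t, Rabs t < 1 -> is_series (fun k => b k * t ^ k) 0).
  { intros t Ht. specialize (H t Ht). apply is_lim_seq_Reals in H.
    change (is_lim_seq (sum_n (fun k => b k * t ^ k)) 0).
    apply (is_lim_seq_ext (fun n => Rsum (map (fun k => b k * t ^ k) (seq 0 (S n))))); [|exact H].
    intros n. induction n as [|n IH].
    - rewrite sum_O. simpl. ring.
    - rewrite sum_Sn, Rsum_seq_S, IH. reflexivity. }
  assert (HP : forall t, Rabs t < 1 -> PSeries b t = 0).
  { intros t Ht. apply is_series_unique. apply Hs, Ht. }
  assert (HR : Rbar_lt 0 (CV_radius b)).
  { destruct (Rbar_le_lt_dec (CV_radius b) 0) as [h|h]; [|exact h]. exfalso.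
    assert (h2 : Rbar_lt (CV_radius b) (Rabs (1 / 2))).
    { eapply Rbar_le_lt_trans; [exact h|]. simpl. rewrite Rabs_pos_eq; lra. }
    apply (CV_disk_outside b (1 / 2) h2).
    apply (ex_series_lim_0 (fun n => b n * (1 / 2) ^ n)). exists 0. apply Hs. rewrite Rabs_pos_eq; lra. }
  replace 0 with ((fun _ : nat => 0) k) by reflexivity.
  apply (PSeries_ext_recip b (fun _ => 0)); [exact HR|rewrite CV_radius_const_0; exact I|].
  exists (mkposreal 1 Rlt_0_1). intros t Ht. rewrite PSeries_const_0. apply HP.
  change (Rabs (t - 0) < 1) in Ht. now rewrite Rminus_0_r in Ht.
Qed.

Lemma power_series_unique (b : nat -> C) (delta : R) : 0 < delta ->
  (forall t, Rabs t < delta -> Ccv (fun n => Csum (map (fun k => Cmul (b k) (CR (t ^ k))) (seq 0 (S n)))) C0) ->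
  forall k, b k = C0.
Proof.
  intros Hd H k.
  (* Treats real and imaginary parts together. The factor delta^k below rescales the interval of
     convergence to (-1, 1). *)
  assert (G : forall f : C -> R, (forall x r, f (Cmul x (CR r)) = f x * r) ->
    (forall x y, f (Cadd x y) = f x + f y) -> (forall x, Rabs (f x) <= Cmod x) -> f (b k) = 0).
  { intros f Hm Ha Hb.
    assert (P : f (b k) * delta ^ k = 0).
    { apply (real_power_series_unique (fun k => f (b k) * delta ^ k)). intros t Ht eps He.
      destruct (H (delta * t)) with (eps := eps) as [n0 Hn]; [|exact He|].
      - rewrite Rabs_mult, Rabs_pos_eq by lra. rewrite <- (Rmult_1_r delta) at 2.
        now apply Rmult_lt_compat_l.
      - exists n0. intros n h. specialize (Hn n h). unfold Rdist.
        eapply Rle_lt_trans; [|exact Hn]. eapply Rle_trans; [|apply Hb]. right. apply f_equal.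
        unfold Rminus. rewrite Ropp_0, Rplus_0_r.
        transitivity (f (Csum (map (fun k => Cmul (b k) (CR ((delta * t) ^ k))) (seq 0 (S n))))).
        2:{ f_equal. ring. }
        clear -Hm Ha. induction (seq 0 (S n)) as [|i l IH]; simpl.
        + replace C0 with (Cmul C0 (CR 0)) by Csolve. rewrite Hm. ring.
        + rewrite Ha, IH, Hm, Rpow_mult_distr. ring. }
    apply Rmult_integral in P. destruct P as [P|P]; [exact P|].
    exfalso. pose proof (pow_lt delta k Hd). lra. }
  apply C_ext.
  - apply (G re); [intros; simpl; ring|reflexivity|apply Rabs_re_le].
  - apply (G im); [intros; simpl; ring|reflexivity|apply Rabs_im_le].
Qed.

Lemma polynomial_unique (b : nat -> C) (n : nat) (delta : R) : 0 < delta ->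
  (forall t, Rabs t < delta -> Csum (map (fun k => Cmul (b k) (CR (t ^ k))) (seq 0 (S n))) = C0) ->
  forall k, (k <= n)%nat -> b k = C0.
Proof.
  intros Hd H k Hk.
  set (b' := fun k => if Nat.leb k n then b k else C0).
  assert (E : b' k = C0); [|now unfold b' in E; rewrite (proj2 (Nat.leb_le k n) Hk) in E].
  apply (power_series_unique b' delta Hd). intros t Ht eps He. exists n. intros m Hm.
  replace (Csum (map (fun k => Cmul (b' k) (CR (t ^ k))) (seq 0 (S m)))) with C0.
  - replace (Csub C0 C0) with C0 by ring. now rewrite Cmod_0.
  - rewrite <- (H t Ht). replace m with (n + (m - n))%nat by lia.
    induction (m - n)%nat as [|p IH].
    + rewrite Nat.add_0_r. apply Csum_ext. intros i Hi. apply in_seq in Hi. unfold b'.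
      rewrite (proj2 (Nat.leb_le i n)) by lia. reflexivity.
    + replace (n + S p)%nat with (S (n + p)) by lia. rewrite (Csum_seq_S _ (S (n + p))), <- IH.
      unfold b'. rewrite (proj2 (Nat.leb_gt (S (n + p)) n)) by lia. ring.
Qed.

Lemma monoAux_ext (z w : vec) : forall a i, (forall j, (i <= j)%nat -> z j = w j) -> monoAux z i a = monoAux w i a.
Proof.
  induction a as [|n a IH]; intros i H; simpl; [reflexivity|].
  rewrite H by lia. rewrite (IH (S i)); [reflexivity|]. intros j Hj. apply H. lia.
Qed.

(** Induction on the number of variables: for fixed later coordinates the sum is a polynomial in z i
    whose coefficients are sums of the same kind. The polydisc, unlike the ball, lets one coordinate
    vary independently of the others. *)
Lemma homogeneous_unique (delta : R) : 0 < delta -> forall N k i (c : list nat -> C),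
  (forall z, (forall j, Cmod (z j) < delta) -> Csum (map (fun a => Cmul (c a) (monoAux z i a)) (mi N k)) = C0) ->
  forall a, In a (mi N k) -> c a = C0.
Proof.
  intros Hd. induction N as [|N IH]; intros k i c H a Ha.
  - simpl in *. destruct (Nat.eqb_spec k 0); [|contradiction]. destruct Ha as [<-|[]].
    specialize (H vzero). simpl in H. transitivity (Cadd (Cmul (c []) C1) C0); [ring|].
    apply H. intros j. unfold vzero. now rewrite Cmod_0.
  - cbn [mi] in Ha. apply in_flat_map in Ha. destruct Ha as [j [Hj Ha]]. apply in_seq in Hj.
    apply in_map_iff in Ha. destruct Ha as [b [<- Hb]].
    apply (IH (k - j)%nat (S i) (fun b => c (j :: b))); [|exact Hb]. intros z Hz.
    set (q := fun j => Csum (map (fun b => Cmul (c (j :: b)) (monoAux z (S i) b)) (mi N (k - j)))).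
    change (q j = C0). apply (polynomial_unique q k delta Hd); [|lia].
    intros t Ht. set (zt := fun m => if Nat.eqb m i then CR t else z m).
    rewrite <- (H zt).
    + cbn [mi]. rewrite Csum_flat_map. apply Csum_ext. intros p _. unfold q.
      rewrite map_map. transitivity (Cmul (CR (t ^ p)) (Csum (map (fun b => Cmul (c (p :: b)) (monoAux z (S i) b)) (mi N (k - p))))); [ring|].
      rewrite <- Csum_mul_l. apply Csum_ext. intros b' _. cbn [monoAux].
      rewrite (monoAux_ext zt z b' (S i)).
      * unfold zt. rewrite Nat.eqb_refl.
        rewrite Cpow_CR. ring.
      * intros m Hm. unfold zt. destruct (Nat.eqb_spec m i); [lia|reflexivity].
    + intros m. unfold zt. destruct (Nat.eqb m i); [now rewrite Cmod_CR|apply Hz].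
Qed.

Lemma monoAux_firstn_ext (N : nat) (z w : vec) : forall a i, (length a + i <= N)%nat ->
  (forall j, (j < N)%nat -> z j = w j) -> monoAux z i a = monoAux w i a.
Proof.
  induction a as [|n a IH]; intros i Hl H; simpl in *; [reflexivity|].
  rewrite H by lia. rewrite (IH (S i)); [reflexivity|lia|exact H].
Qed.

(** Replacing z by t z gives a power series in t, so each homogeneous part vanishes separately;
    [homogeneous_unique] then separates the monomials. *)
Theorem expansion_zero (N : nat) (c : list nat -> C) :
  (forall z, in_ball N z -> Ccv (fun n => Csum (map (fun k => homog N c k z) (seq 0 (S n)))) C0) ->
  forall k a, In a (mi N k) -> c a = C0.
Proof.
  intros H k a Ha.
  assert (Hh : forall z, in_ball N z -> homog N c k z = C0).
  { intros z Hz. apply (power_series_unique (fun k => homog N c k z) 1 Rlt_0_1). intros t Ht.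
    assert (Hin : in_ball N (vscal (CR t) z)) by (apply in_ball_scal; [rewrite Cmod_CR; lra|exact Hz]).
    specialize (H _ Hin).
    replace (fun n => Csum (map (fun k0 => Cmul (homog N c k0 z) (CR (t ^ k0))) (seq 0 (S n)))) with
      (fun n => Csum (map (fun k0 => homog N c k0 (vscal (CR t) z)) (seq 0 (S n)))); [exact H|].
    apply functional_extensionality. intros n. apply Csum_ext. intros j _. rewrite homog_scal.
    rewrite Cpow_CR. ring. }
  (* The polydisc of this radius lies in the ball, since N coordinates of this size have moduli
     adding up to less than 1. *)
  assert (Hd : 0 < / (INR N + 1)) by (apply Rinv_0_lt_compat; pose proof (pos_INR N); lra).
  apply (homogeneous_unique (/ (INR N + 1)) Hd N k 0 c); [|exact Ha]. intros z Hz.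
  set (z' := fun j => if Nat.ltb j N then z j else C0).
  rewrite <- (Hh z').
  - unfold homog, mono. apply Csum_ext. intros b Hb. apply mi_spec in Hb. f_equal.
    apply (monoAux_firstn_ext N); [lia|]. intros j Hj. unfold z'.
    now rewrite (proj2 (Nat.ltb_lt j N) Hj).
  - apply vnorm_in_ball.
    + intros j Hj. unfold z'. now rewrite (proj2 (Nat.ltb_ge j N) Hj).
    + eapply Rle_lt_trans; [apply vnorm_le_sum|].
      apply Rle_lt_trans with (Rsum (map (fun _ => / (INR N + 1)) (seq 0 N))).
      * apply Rsum_le. intros j _. unfold z'. destruct (Nat.ltb j N); [left; apply Hz|].
        rewrite Cmod_0. lra.
      * rewrite Rsum_const, length_seq. pose proof (pos_INR N).
        apply Rmult_lt_reg_r with (INR N + 1); [lra|]. rewrite Rmult_assoc, Rinv_l by lra. lra.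
Qed.

(** * The Hilbert space of coefficients *)

Definition cfs := list nat -> C.
Definition cfadd (c d : cfs) : cfs := fun a => Cadd (c a) (d a).
Definition cfscal (u : C) (c : cfs) : cfs := fun a => Cmul u (c a).
Definition cfsub (c d : cfs) : cfs := fun a => Csub (c a) (d a).
Definition cfzero : cfs := fun _ => C0.

Lemma cfsub_add (c d : cfs) : cfsub c d = cfadd c (cfscal (CR (-1)) d).
Proof. apply functional_extensionality; intros a; unfold cfsub, cfadd, cfscal. Csolve. Qed.

Section Hilbert.
Variable N : nat.

(* Real part of the truncated inner product (without the constant term); the imaginary
   part is recovered by multiplying the second argument by [Ci]. *)
Definition bip (n : nat) (c d : cfs) : R :=
  Rsum (map (fun k => re (Dterm N c d k)) (seq 0 (S n))).

Lemma re_Dterm (c d : cfs) k : re (Dterm N c d k) =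
  Rsum (map (fun a => weight k a * (re (c a) * re (d a) + im (c a) * im (d a))) (mi N k)).
Proof.
  unfold Dterm. rewrite re_Csum, map_map. apply Rsum_ext. intros a _. simpl. ring.
Qed.

Lemma re_Dterm_self (c : cfs) k : re (Dterm N c c k) =
  Rsum (map (fun a => weight k a * Cmod2 (c a)) (mi N k)).
Proof. rewrite re_Dterm. reflexivity. Qed.

Lemma bip_sym n c d : bip n c d = bip n d c.
Proof.
  apply Rsum_ext. intros k _. rewrite !re_Dterm. apply Rsum_ext. intros a _. ring.
Qed.

Lemma bip_add_l n c d e : bip n (cfadd c d) e = bip n c e + bip n d e.
Proof.
  unfold bip. rewrite <- Rsum_plus. apply Rsum_ext. intros k _. rewrite !re_Dterm, <- Rsum_plus.
  apply Rsum_ext. intros a _. simpl. ring.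
Qed.

Lemma bip_scal_l n r c e : bip n (cfscal (CR r) c) e = r * bip n c e.
Proof.
  unfold bip. rewrite <- Rsum_scal. apply Rsum_ext. intros k _. rewrite !re_Dterm, <- Rsum_scal.
  apply Rsum_ext. intros a _. simpl. ring.
Qed.

Lemma bip_scal2 n u c : bip n (cfscal u c) (cfscal u c) = Cmod2 u * bip n c c.
Proof.
  unfold bip. rewrite <- Rsum_scal. apply Rsum_ext. intros k _. rewrite !re_Dterm_self, <- Rsum_scal.
  apply Rsum_ext. intros a _. unfold cfscal. rewrite Cmod2_mul. ring.
Qed.

Lemma re_Dterm_ge0 c k : 0 <= re (Dterm N c c k).
Proof.
  rewrite re_Dterm_self. apply Rsum_ge0. intros a _.
  apply Rmult_le_pos; [apply weight_ge0|apply Cmod2_ge0].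
Qed.

Lemma bip_S n c d : bip (S n) c d = bip n c d + re (Dterm N c d (S n)).
Proof. unfold bip. now rewrite Rsum_seq_S. Qed.

Lemma bip_incr n c : bip n c c <= bip (S n) c c.
Proof. rewrite bip_S. pose proof (re_Dterm_ge0 c (S n)). lra. Qed.

Lemma bip_ge0 n c : 0 <= bip n c c.
Proof. apply Rsum_ge0. intros k _. apply re_Dterm_ge0. Qed.

Definition fin (c : cfs) : Prop := exists M, forall n, bip n c c <= M.
Definition ip (c d : cfs) : R := real (Lim_seq (fun n => bip n c d)).

Lemma fin_add c d : fin c -> fin d -> fin (cfadd c d).
Proof.
  intros [M1 H1] [M2 H2]. exists (2 * M1 + 2 * M2). intros n.
  specialize (H1 n). specialize (H2 n).
  pose proof (bip_ge0 n (cfsub c d)) as P. rewrite cfsub_add in P.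
  rewrite bip_add_l, (bip_sym n c), (bip_sym n (cfscal _ _)), !bip_add_l, !bip_scal_l,
    (bip_sym n c (cfscal _ _)), (bip_sym n d (cfscal _ _)), !bip_scal_l in P.
  rewrite bip_add_l, (bip_sym n c), (bip_sym n d), !bip_add_l.
  rewrite (bip_sym n d c) in *. lra.
Qed.

Lemma fin_scal u c : fin c -> fin (cfscal u c).
Proof.
  intros [M H]. exists (Cmod2 u * M). intros n. rewrite bip_scal2.
  apply Rmult_le_compat_l; [apply Cmod2_ge0|apply H].
Qed.

Lemma bip_vanish n c d :
  (forall k a, In a (mi N k) -> weight k a * (re (c a) * re (d a) + im (c a) * im (d a)) = 0) ->
  bip n c d = 0.
Proof.
  intros H. unfold bip. transitivity (Rsum (map (fun _ : nat => 0) (seq 0 (S n)))).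
  - apply Rsum_ext. intros k _. rewrite re_Dterm.
    transitivity (Rsum (map (fun _ : list nat => 0) (mi N k))).
    + apply Rsum_ext. intros a Ha. now apply H.
    + rewrite Rsum_const. ring.
  - rewrite Rsum_const. ring.
Qed.

Lemma fin_zero : fin cfzero.
Proof. exists 0. intros n. right. apply bip_vanish. intros k a _. simpl. ring. Qed.

Lemma fin_sub c d : fin c -> fin d -> fin (cfsub c d).
Proof. intros Hc Hd. rewrite cfsub_add. apply fin_add; [exact Hc|now apply fin_scal]. Qed.

Lemma fin_lim c : fin c -> is_lim_seq (fun n => bip n c c) (ip c c).
Proof.
  intros [M H]. unfold ip. apply Lim_seq_correct'. apply ex_finite_lim_seq_incr with M.
  - intros n. apply bip_incr.
  - exact H.
Qed.

(** By polarisation the mixed products are combinations of squares, which converge monotonically. *)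
Lemma ip_lim c d : fin c -> fin d -> is_lim_seq (fun n => bip n c d) (ip c d).
Proof.
  intros Hc Hd. unfold ip. apply Lim_seq_correct'.
  exists ((ip (cfadd c d) (cfadd c d) - ip c c - ip d d) * / 2).
  apply (is_lim_seq_ext (fun n => (bip n (cfadd c d) (cfadd c d) - bip n c c - bip n d d) * / 2)).
  - intros n. rewrite bip_add_l, (bip_sym n c), (bip_sym n d), !bip_add_l, (bip_sym n d c). field.
  - apply is_lim_seq_mult'; [|apply is_lim_seq_const].
    apply is_lim_seq_minus'; [apply is_lim_seq_minus'|]; apply fin_lim; try assumption.
    now apply fin_add.
Qed.

Lemma ip_eq_lim c d l : is_lim_seq (fun n => bip n c d) (Finite l) -> ip c d = l.
Proof. intros H. unfold ip. now rewrite (is_lim_seq_unique _ _ H). Qed.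

Lemma ip_ext_bip c d c' d' : (forall n, bip n c d = bip n c' d') -> ip c d = ip c' d'.
Proof. intros H. unfold ip. f_equal. now apply Lim_seq_ext. Qed.

Lemma ip_sym c d : ip c d = ip d c.
Proof. apply ip_ext_bip. intros n. apply bip_sym. Qed.

Lemma ip_vanish c d :
  (forall k a, In a (mi N k) -> weight k a * (re (c a) * re (d a) + im (c a) * im (d a)) = 0) ->
  ip c d = 0.
Proof.
  intros H. apply ip_eq_lim. apply (is_lim_seq_ext (fun _ => 0)); [|apply is_lim_seq_const].
  intros n. symmetry. now apply bip_vanish.
Qed.

Lemma ip_add_l c d e : fin c -> fin d -> fin e -> ip (cfadd c d) e = ip c e + ip d e.
Proof.
  intros Hc Hd He. apply ip_eq_lim. apply (is_lim_seq_ext (fun n => bip n c e + bip n d e)).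
  - intros n. symmetry. apply bip_add_l.
  - apply is_lim_seq_plus'; now apply ip_lim.
Qed.

Lemma ip_scal_l r c e : fin c -> fin e -> ip (cfscal (CR r) c) e = r * ip c e.
Proof.
  intros Hc He. apply ip_eq_lim. apply (is_lim_seq_ext (fun n => r * bip n c e)).
  - intros n. symmetry. apply bip_scal_l.
  - apply is_lim_seq_mult'; [apply is_lim_seq_const|now apply ip_lim].
Qed.

Lemma ip_ge0 c : fin c -> 0 <= ip c c.
Proof.
  intros Hc. apply (is_lim_seq_le (fun _ => 0) (fun n => bip n c c) 0 (ip c c)).
  - intros n. apply bip_ge0.
  - apply is_lim_seq_const.
  - now apply fin_lim.
Qed.

Lemma bip_le_ip n c : fin c -> bip n c c <= ip c c.
Proof.
  intros Hc. apply (is_lim_seq_incr_compare (fun n => bip n c c)); [now apply fin_lim|].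
  intros m. apply bip_incr.
Qed.

Lemma ip_scal2 u c : fin c -> ip (cfscal u c) (cfscal u c) = Cmod2 u * ip c c.
Proof.
  intros Hc. apply ip_eq_lim. apply (is_lim_seq_ext (fun n => Cmod2 u * bip n c c)).
  - intros n. symmetry. apply bip_scal2.
  - apply is_lim_seq_mult'; [apply is_lim_seq_const|now apply fin_lim].
Qed.

Lemma ip_add_r c d e : fin c -> fin d -> fin e -> ip e (cfadd c d) = ip e c + ip e d.
Proof. intros. rewrite ip_sym, ip_add_l, (ip_sym c), (ip_sym d); auto. Qed.

Lemma ip_scal_r r c e : fin c -> fin e -> ip e (cfscal (CR r) c) = r * ip e c.
Proof. intros. rewrite ip_sym, ip_scal_l, (ip_sym c); auto. Qed.

Lemma ip_add2 r c d : fin c -> fin d ->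
  ip (cfadd c (cfscal (CR r) d)) (cfadd c (cfscal (CR r) d)) = ip c c + 2 * r * ip c d + r * r * ip d d.
Proof.
  intros Hc Hd. assert (Hrd : fin (cfscal (CR r) d)) by now apply fin_scal.
  assert (Hs : fin (cfadd c (cfscal (CR r) d))) by now apply fin_add.
  rewrite ip_add_l, !ip_add_r, !ip_scal_l, !ip_scal_r, (ip_sym d c) by assumption. ring.
Qed.

Lemma ip_sub2 c d : fin c -> fin d -> ip (cfsub c d) (cfsub c d) = ip c c - 2 * ip c d + ip d d.
Proof. intros Hc Hd. rewrite cfsub_add, ip_add2 by assumption. ring. Qed.

Lemma ip_sub_le c d e : fin c -> fin d -> fin e ->
  ip (cfsub c e) (cfsub c e) <= 2 * ip (cfsub c d) (cfsub c d) + 2 * ip (cfsub d e) (cfsub d e).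
Proof.
  intros Hc Hd He. assert (H1 : fin (cfsub c d)) by now apply fin_sub.
  assert (H2 : fin (cfsub d e)) by now apply fin_sub.
  replace (cfsub c e) with (cfadd (cfsub c d) (cfscal (CR 1) (cfsub d e))).
  - rewrite ip_add2 by assumption.
    pose proof (ip_ge0 _ (fin_sub _ _ H1 H2)) as P. rewrite ip_sub2 in P by assumption. lra.
  - apply functional_extensionality; intros a. unfold cfadd, cfsub, cfscal. Csolve.
Qed.

(** A discriminant bound that serves twice: for Cauchy-Schwarz, and for the near orthogonality of a
    minimising sequence. *)
Lemma quadratic_bound (b q e : R) : 0 <= q -> 0 <= e ->
  (forall t, - e <= 2 * t * b + t * t * q) -> b * b <= q * e.
Proof.
  intros Hq He H. destruct Hq as [Hq|Hq].
  - specialize (H (- b / q)).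
    replace (2 * (- b / q) * b + - b / q * (- b / q) * q) with (- (b * b) / q) in H by (field; lra).
    apply Rmult_le_compat_r with (r := q) in H; [|lra].
    replace (- (b * b) / q * q) with (- (b * b)) in H by (field; lra). lra.
  - subst q. destruct (Req_dec b 0) as [->|n]; [lra|exfalso].
    specialize (H (- (e + 1) / (2 * b))).
    replace (2 * (- (e + 1) / (2 * b)) * b) with (- (e + 1)) in H by (field; exact n). lra.
Qed.

Lemma ip_cauchy_schwarz c d : fin c -> fin d -> ip c d * ip c d <= ip c c * ip d d.
Proof.
  intros Hc Hd. rewrite (Rmult_comm (ip c c)). apply quadratic_bound; [now apply ip_ge0|now apply ip_ge0|].
  intros t. pose proof (ip_ge0 _ (fin_add c (cfscal (CR t) d) Hc (fin_scal _ _ Hd))) as P.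
  rewrite ip_add2 in P by assumption. lra.
Qed.

Lemma coef_le_bip c k a n : In a (mi N k) -> (k <= n)%nat -> weight k a * Cmod2 (c a) <= bip n c c.
Proof.
  intros Ha Hk. apply Rle_trans with (re (Dterm N c c k)).
  - rewrite re_Dterm_self. apply (Rsum_ge_term (fun a => weight k a * Cmod2 (c a))); [|exact Ha].
    intros b _. apply Rmult_le_pos; [apply weight_ge0|apply Cmod2_ge0].
  - apply (Rsum_ge_term (fun k => re (Dterm N c c k))); [intros; apply re_Dterm_ge0|apply in_seq; lia].
Qed.

Lemma C_complete (u : nat -> C) :
  (forall eps, 0 < eps -> exists J, forall i j, (J <= i)%nat -> (J <= j)%nat -> Cmod (Csub (u i) (u j)) < eps) ->
  exists l, Ccv u l.
Proof.
  intros H.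
  destruct (Rcomplete.R_complete (fun n => re (u n))) as [a Ha].
  { intros eps He. destruct (H eps He) as [J HJ]. exists J. intros i j Hi Hj. unfold Rdist.
    eapply Rle_lt_trans; [|apply (HJ i j Hi Hj)]. apply (Rabs_re_le (Csub (u i) (u j))). }
  destruct (Rcomplete.R_complete (fun n => im (u n))) as [b Hb].
  { intros eps He. destruct (H eps He) as [J HJ]. exists J. intros i j Hi Hj. unfold Rdist.
    eapply Rle_lt_trans; [|apply (HJ i j Hi Hj)]. apply (Rabs_im_le (Csub (u i) (u j))). }
  exists (mkC a b). intros eps He. destruct (Ha (eps / 2)) as [n1 H1]; [lra|].
  destruct (Hb (eps / 2)) as [n2 H2]; [lra|]. exists (Nat.max n1 n2). intros n Hn.
  specialize (H1 n ltac:(lia)). specialize (H2 n ltac:(lia)). unfold Rdist in *.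
  eapply Rle_lt_trans; [apply Cmod_le_abs|]. simpl. unfold Rminus in *. lra.
Qed.

Lemma Ccv_parts (u : nat -> C) l : Ccv u l ->
  is_lim_seq (fun n => re (u n)) (re l) /\ is_lim_seq (fun n => im (u n)) (im l).
Proof.
  intros H. split; apply is_lim_seq_Reals; intros eps He; destruct (H eps He) as [n0 Hn]; exists n0;
    intros n h; specialize (Hn n h); unfold Rdist; (eapply Rle_lt_trans; [|exact Hn]).
  - apply (Rabs_re_le (Csub (u n) l)).
  - apply (Rabs_im_le (Csub (u n) l)).
Qed.

Lemma parts_Ccv (u : nat -> C) l : is_lim_seq (fun n => re (u n)) (re l) ->
  is_lim_seq (fun n => im (u n)) (im l) -> Ccv u l.
Proof.
  intros Ha Hb. apply is_lim_seq_Reals in Ha. apply is_lim_seq_Reals in Hb.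
  intros eps He. destruct (Ha (eps / 2)) as [n1 H1]; [lra|].
  destruct (Hb (eps / 2)) as [n2 H2]; [lra|]. exists (Nat.max n1 n2). intros n Hn.
  specialize (H1 n ltac:(lia)). specialize (H2 n ltac:(lia)). unfold Rdist in *.
  eapply Rle_lt_trans; [apply Cmod_le_abs|]. simpl. unfold Rminus in *. lra.
Qed.

Lemma is_lim_seq_Rsum {T : Type} (f : nat -> T -> R) (g : T -> R) (l : list T) :
  (forall a, In a l -> is_lim_seq (fun n => f n a) (g a)) ->
  is_lim_seq (fun n => Rsum (map (f n) l)) (Rsum (map g l)).
Proof.
  induction l as [|a l IH]; intros H; simpl; [apply is_lim_seq_const|].
  apply is_lim_seq_plus'; [apply H; now left|apply IH; intros b Hb; apply H; now right].
Qed.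

(** In positive degree the weights are positive, so each coefficient is a Cauchy sequence. The
    truncated norms then pass to the coefficientwise limit, uniformly in the truncation. *)
Lemma fin_complete (u : nat -> cfs) : (forall j, fin (u j)) ->
  (forall eps, 0 < eps -> exists J, forall i j, (J <= i)%nat -> (J <= j)%nat ->
     ip (cfsub (u i) (u j)) (cfsub (u i) (u j)) <= eps) ->
  exists c, fin c /\ is_lim_seq (fun j => ip (cfsub (u j) c) (cfsub (u j) c)) 0.
Proof.
  intros Hu HC.
  assert (Hcv : forall k a, In a (mi N (S k)) -> exists l, Ccv (fun j => u j a) l).
  { intros k a Ha. apply C_complete. intros eps He. pose proof (weight_pos k a) as W.
    destruct (HC (weight (S k) a * (eps * eps / 2))) as [J HJ].
    { apply Rmult_lt_0_compat; [exact W|]. nra. }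
    exists J. intros i j Hi Hj. specialize (HJ i j Hi Hj).
    apply Cmod_lt_of_sqr; [lra|].
    pose proof (coef_le_bip (cfsub (u i) (u j)) (S k) a (S k) Ha (Nat.le_refl _)) as P1.
    pose proof (bip_le_ip (S k) _ (fin_sub _ _ (Hu i) (Hu j))) as P2.
    assert (P3 : Cmod2 (Csub (u i a) (u j a)) <= eps * eps / 2).
    { apply Rmult_le_reg_l with (weight (S k) a); [exact W|]. unfold cfsub in *. lra. }
    nra. }
  (* In degree 0 the sequence may diverge and [Clim] is an arbitrary value, invisible to [ip]. *)
  set (c := fun a => Clim (fun j => u j a)).
  assert (Hc : forall k a, In a (mi N (S k)) -> Ccv (fun j => u j a) (c a)).
  { intros k a Ha. destruct (Hcv k a Ha) as [l Hl]. unfold c. now rewrite (Clim_eq _ l). }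
  assert (Hb : forall n i, is_lim_seq (fun j => bip n (cfsub (u i) (u j)) (cfsub (u i) (u j)))
      (bip n (cfsub (u i) c) (cfsub (u i) c))).
  { intros n i. unfold bip. apply (is_lim_seq_Rsum (fun j k => re (Dterm N (cfsub (u i) (u j)) (cfsub (u i) (u j)) k))
      (fun k => re (Dterm N (cfsub (u i) c) (cfsub (u i) c) k))).
    intros k _. rewrite re_Dterm_self.
    apply (is_lim_seq_ext (fun j => Rsum (map (fun a => weight k a * Cmod2 (cfsub (u i) (u j) a)) (mi N k)))).
    { intros j. now rewrite re_Dterm_self. }
    apply (is_lim_seq_Rsum (fun j a => weight k a * Cmod2 (cfsub (u i) (u j) a))).
    intros a Ha. destruct k as [|k].
    - rewrite weight_0, Rmult_0_l. apply (is_lim_seq_ext (fun _ => 0)); [intros; ring|apply is_lim_seq_const].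
    - apply is_lim_seq_mult'; [apply is_lim_seq_const|].
      destruct (Ccv_parts _ _ (Hc k a Ha)) as [L1 L2]. unfold cfsub, Cmod2. simpl.
      assert (M1 : is_lim_seq (fun j => re (u i a) + - re (u j a)) (re (u i a) + - re (c a))).
      { apply is_lim_seq_plus'; [apply is_lim_seq_const|]. apply (is_lim_seq_opp _ (Finite (re (c a)))). exact L1. }
      assert (M2 : is_lim_seq (fun j => im (u i a) + - im (u j a)) (im (u i a) + - im (c a))).
      { apply is_lim_seq_plus'; [apply is_lim_seq_const|]. apply (is_lim_seq_opp _ (Finite (im (c a)))). exact L2. }
      apply is_lim_seq_plus'; apply is_lim_seq_mult'; assumption. }
  (* Fatou's argument: for fixed n let j tend to infinity; the bound obtained does not depend on
     n. *)
  assert (Hbd : forall eps, 0 < eps -> exists J, forall i, (J <= i)%nat -> forall n,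
     bip n (cfsub (u i) c) (cfsub (u i) c) <= eps).
  { intros eps He. destruct (HC eps He) as [J HJ]. exists J. intros i Hi n.
    apply (is_lim_seq_le_loc (fun j => bip n (cfsub (u i) (u j)) (cfsub (u i) (u j))) (fun _ => eps)
      (bip n (cfsub (u i) c) (cfsub (u i) c)) eps); [|apply Hb|apply is_lim_seq_const].
    exists J. intros j Hj. eapply Rle_trans; [|apply (HJ i j Hi Hj)].
    apply bip_le_ip. now apply fin_sub. }
  assert (Hfin : fin c).
  { destruct (Hbd 1 Rlt_0_1) as [J HJ]. specialize (HJ J (Nat.le_refl _)).
    replace c with (cfsub (u J) (cfsub (u J) c)).
    - apply fin_sub; [apply Hu|]. now exists 1.
    - apply functional_extensionality; intros a; unfold cfsub; ring. }
  exists c. split; [exact Hfin|]. apply is_lim_seq_Reals. intros eps He.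
  destruct (Hbd (eps / 2)) as [J HJ]; [lra|]. exists J. intros i Hi.
  pose proof (ip_ge0 _ (fin_sub _ _ (Hu i) Hfin)) as P0.
  assert (P1 : ip (cfsub (u i) c) (cfsub (u i) c) <= eps / 2).
  { apply (is_lim_seq_le (fun n => bip n (cfsub (u i) c) (cfsub (u i) c)) (fun _ => eps / 2)
      (ip (cfsub (u i) c) (cfsub (u i) c)) (eps / 2)); [intros n; now apply HJ| |apply is_lim_seq_const].
    apply fin_lim. now apply fin_sub. }
  unfold Rdist. rewrite Rminus_0_r, Rabs_pos_eq by exact P0. lra.
Qed.

Lemma ip_lim_l (u : nat -> cfs) c d : (forall j, fin (u j)) -> fin c -> fin d ->
  is_lim_seq (fun j => ip (cfsub (u j) c) (cfsub (u j) c)) 0 -> is_lim_seq (fun j => ip (u j) d) (ip c d).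
Proof.
  intros Hu Hc Hd H. apply is_lim_seq_Reals in H. apply is_lim_seq_Reals. intros eps He.
  pose proof (ip_ge0 d Hd) as D0.
  destruct (H (eps * eps / (ip d d + 1))) as [J HJ].
  { apply Rdiv_lt_0_compat; [nra|lra]. }
  exists J. intros j Hj. specialize (HJ j Hj). unfold Rdist in *.
  assert (Hf : fin (cfsub (u j) c)) by now apply fin_sub.
  pose proof (ip_ge0 _ Hf) as P0. rewrite Rminus_0_r, Rabs_pos_eq in HJ by exact P0.
  pose proof (ip_cauchy_schwarz (cfsub (u j) c) d Hf Hd) as CS.
  assert (E : ip (cfsub (u j) c) d = ip (u j) d - ip c d).
  { rewrite cfsub_add, ip_add_l, ip_scal_l; auto. ring. now apply fin_scal. }
  rewrite <- E. set (x := ip (cfsub (u j) c) d) in *. set (q := ip (cfsub (u j) c) (cfsub (u j) c)) in *.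
  assert (Hq : q * (ip d d + 1) < eps * eps).
  { apply Rmult_lt_compat_r with (r := ip d d + 1) in HJ; [|lra].
    replace (eps * eps / (ip d d + 1) * (ip d d + 1)) with (eps * eps) in HJ by (field; lra). exact HJ. }
  assert (x * x < eps * eps) by nra. apply Rabs_def1; nra.
Qed.

(** * Evaluation functionals *)

(* The value at [w], minus the value at 0, by the reproducing property of [kc w]. *)
Definition eval (c : cfs) (w : vec) : C := mkC (ip c (kc w)) (ip c (cfscal Ci (kc w))).
Definition hsum (c : cfs) (w : vec) (n : nat) : C := Csum (map (homog1 N c w) (seq 0 (S n))).

Lemma bip_kc c w n : bip n c (kc w) = re (hsum c w n).
Proof.
  unfold bip, hsum. rewrite re_Csum, map_map. apply Rsum_ext. intros k _. now rewrite Dterm_kc.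
Qed.

Lemma bip_Ci n c d : bip n c (cfscal Ci d) = Rsum (map (fun k => im (Dterm N c d k)) (seq 0 (S n))).
Proof.
  apply Rsum_ext. intros k _. unfold Dterm. rewrite re_Csum, im_Csum, !map_map.
  apply Rsum_ext. intros a _. unfold cfscal. simpl. ring.
Qed.

Lemma bip_Ci_kc c w n : bip n c (cfscal Ci (kc w)) = im (hsum c w n).
Proof.
  rewrite bip_Ci. unfold hsum. rewrite im_Csum, map_map. apply Rsum_ext. intros k _. now rewrite Dterm_kc.
Qed.

Lemma hsum_kc z w n : hsum (kc w) z n = Csum (map (lterm (vdot N z w)) (seq 0 (S n))).
Proof. apply Csum_ext. intros k _. apply homog1_kc. Qed.

(** The truncated square norms of [kc w] are the partial sums of the logarithmic series at |w|^2;
    they increase and converge. *)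
Lemma fin_kc w : in_ball N w -> fin (kc w).
Proof.
  intros Hw.
  pose proof (proj1 (Ccv_parts _ _ (Llog_series (vdot N w w) (vdot_ball_lt1 N w w Hw Hw)))) as L.
  exists (re (Llog (vdot N w w))). intros n. rewrite bip_kc, hsum_kc.
  apply (is_lim_seq_incr_compare (fun n => re (Csum (map (lterm (vdot N w w)) (seq 0 (S n)))))); [exact L|].
  intros m. rewrite <- !hsum_kc, <- !bip_kc. apply bip_incr.
Qed.

Lemma eval_series c w : fin c -> in_ball N w -> Ccv (hsum c w) (eval c w).
Proof.
  intros Hc Hw. apply parts_Ccv; simpl.
  - apply (is_lim_seq_ext (fun n => bip n c (kc w))); [intros; apply bip_kc|].
    apply ip_lim; [exact Hc|now apply fin_kc].
  - apply (is_lim_seq_ext (fun n => bip n c (cfscal Ci (kc w)))); [intros; apply bip_Ci_kc|].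
    apply ip_lim; [exact Hc|apply fin_scal; now apply fin_kc].
Qed.

Lemma eval_kc w z : in_ball N w -> in_ball N z -> eval (kc w) z = Llog (vdot N z w).
Proof.
  intros Hw Hz. apply (Ccv_unique (hsum (kc w) z)).
  - apply eval_series; [now apply fin_kc|exact Hz].
  - replace (hsum (kc w) z) with (fun n => Csum (map (lterm (vdot N z w)) (seq 0 (S n)))).
    + apply Llog_series. now apply vdot_ball_lt1.
    + apply functional_extensionality. intros n. symmetry. apply hsum_kc.
Qed.

Lemma eval_add c d z : fin c -> fin d -> in_ball N z -> eval (cfadd c d) z = Cadd (eval c z) (eval d z).
Proof.
  intros Hc Hd Hz. pose proof (fin_kc z Hz) as Hk.
  apply C_ext; simpl; apply ip_add_l; auto. now apply fin_scal.
Qed.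

Lemma homog1_scal u c w k : homog1 N (cfscal u c) w k = Cmul u (homog1 N c w k).
Proof.
  unfold homog1. destruct k; [ring|]. unfold homog. rewrite <- Csum_mul_l.
  apply Csum_ext. intros a _. unfold cfscal. ring.
Qed.

Lemma Ccv_mul_l u v l : Ccv v l -> Ccv (fun n => Cmul u (v n)) (Cmul u l).
Proof.
  intros H eps He. pose proof (Cmod_ge0 u) as U.
  destruct (H (eps / (Cmod u + 1))) as [n0 Hn]; [apply Rdiv_lt_0_compat; lra|].
  exists n0. intros n h. specialize (Hn n h).
  replace (Csub (Cmul u (v n)) (Cmul u l)) with (Cmul u (Csub (v n) l)) by ring.
  rewrite Cmod_mul. replace eps with ((Cmod u + 1) * (eps / (Cmod u + 1))) by (field; lra).
  pose proof (Cmod_ge0 (Csub (v n) l)). nra.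
Qed.

Lemma eval_scal u c z : fin c -> in_ball N z -> eval (cfscal u c) z = Cmul u (eval c z).
Proof.
  intros Hc Hz. apply (Ccv_unique (hsum (cfscal u c) z)).
  - apply eval_series; [now apply fin_scal|exact Hz].
  - replace (hsum (cfscal u c) z) with (fun n => Cmul u (hsum c z n)).
    + apply Ccv_mul_l. now apply eval_series.
    + apply functional_extensionality. intros n. unfold hsum. rewrite <- Csum_mul_l.
      apply Csum_ext. intros k _. symmetry. apply homog1_scal.
Qed.

Lemma eval_sub c d z : fin c -> fin d -> in_ball N z -> eval (cfsub c d) z = Csub (eval c z) (eval d z).
Proof.
  intros Hc Hd Hz. rewrite cfsub_add, eval_add, eval_scal; auto; [Csolve|now apply fin_scal].
Qed.

Lemma eval_zero z : eval cfzero z = C0.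
Proof.
  assert (H : forall d, ip cfzero d = 0).
  { intros d. apply ip_vanish. intros k a _. simpl. ring. }
  unfold eval. now rewrite !H.
Qed.

(** Cauchy-Schwarz for the real and the imaginary part separately, whence the factor 2. *)
Lemma eval_bound c w : fin c -> in_ball N w ->
  Cmod2 (eval c w) <= 2 * (ip c c * ip (kc w) (kc w)).
Proof.
  intros Hc Hw. pose proof (fin_kc w Hw) as Hk. unfold Cmod2, eval; simpl.
  pose proof (ip_cauchy_schwarz c (kc w) Hc Hk).
  pose proof (ip_cauchy_schwarz c (cfscal Ci (kc w)) Hc (fin_scal _ _ Hk)) as P.
  rewrite ip_scal2 in P by exact Hk. replace (Cmod2 Ci) with 1 in P by (unfold Cmod2; simpl; ring). lra.
Qed.

Lemma eval_ext_zero c : fin c -> (forall z, in_ball N z -> eval c z = C0) ->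
  (forall k a, In a (mi N (S k)) -> c a = C0) /\ ip c c = 0.
Proof.
  intros Hc H.
  assert (Hz : forall k a, In a (mi N (S k)) -> c a = C0).
  (* [eval] ignores the constant term, which has to be cleared before c becomes an expansion of
     0. *)
  { set (c' := fun a => if Nat.eqb (list_sum a) 0 then C0 else c a).
    intros k a Ha. assert (E : c' a = C0).
    { apply (expansion_zero N c') with (k := S k); [|exact Ha]. intros z Hz.
      rewrite <- (H z Hz). replace (fun n => Csum (map (fun k => homog N c' k z) (seq 0 (S n)))) with (hsum c z).
      - now apply eval_series.
      - apply functional_extensionality. intros n. apply Csum_ext. intros j _.
        unfold homog1. destruct j as [|j].
        + symmetry. apply Csum_zero. intros b Hb. apply mi_spec in Hb. destruct Hb as [_ Hb].
          unfold c'. rewrite Hb. simpl. ring.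
        + apply Csum_ext. intros b Hb. apply mi_spec in Hb. destruct Hb as [_ Hb].
          unfold c'. now rewrite Hb. }
    apply mi_spec in Ha. destruct Ha as [_ Ha]. unfold c' in E. now rewrite Ha in E. }
  split; [exact Hz|]. apply ip_vanish. intros [|k] a Ha; [rewrite weight_0; ring|].
  rewrite (Hz k a Ha). simpl. ring.
Qed.

(** * Combinations of kernels are dense *)

Definition comb (l : list (C * vec)) : cfs :=
  fold_right (fun p acc => cfadd (cfscal (fst p) (kc (snd p))) acc) cfzero l.
Definition ball_list (l : list (C * vec)) : Prop := List.Forall (fun p => in_ball N (snd p)) l.
Definition scale_list (u : C) (l : list (C * vec)) : list (C * vec) :=
  map (fun p => (Cmul u (fst p), snd p)) l.

Lemma fin_comb l : ball_list l -> fin (comb l).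
Proof.
  induction 1 as [|p l Hp Hl IH]; simpl; [apply fin_zero|].
  apply fin_add; [apply fin_scal; now apply fin_kc|exact IH].
Qed.

Lemma comb_app l m : comb (l ++ m) = cfadd (comb l) (comb m).
Proof.
  induction l as [|p l IH]; simpl; [|rewrite IH]; apply functional_extensionality; intros a;
    unfold cfadd, cfzero; simpl; ring.
Qed.

Lemma comb_scale u l : comb (scale_list u l) = cfscal u (comb l).
Proof.
  induction l as [|p l IH]; simpl; [|rewrite IH]; apply functional_extensionality; intros a;
    unfold cfadd, cfzero, cfscal; simpl; ring.
Qed.

Lemma ball_scale u l : ball_list l -> ball_list (scale_list u l).
Proof. intros H. unfold ball_list, scale_list. apply Forall_map. exact H. Qed.

Lemma comb_sub l m : comb (l ++ scale_list (CR (-1)) m) = cfsub (comb l) (comb m).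
Proof. now rewrite comb_app, comb_scale, cfsub_add. Qed.

Lemma is_lim_seq_inv_nat : is_lim_seq (fun n => / INR (S n)) 0.
Proof.
  apply is_lim_seq_Reals. intros eps He. destruct (archimed_cor1 eps He) as [n0 [H1 H2]].
  exists n0. intros n h. unfold Rdist. rewrite Rminus_0_r, Rabs_pos_eq.
  - eapply Rle_lt_trans; [|exact H1]. apply Rinv_le_contravar; [apply lt_0_INR; lia|apply le_INR; lia].
  - left. apply Rinv_0_lt_compat, lt_0_INR. lia.
Qed.

(* Projection theorem: a minimizing sequence is Cauchy, and the limit of the errors is
   orthogonal to all kernels, that is, it vanishes at every point. *)
Theorem kernels_dense c : fin c -> exists l : nat -> list (C * vec),
  (forall n, ball_list (l n)) /\
  is_lim_seq (fun n => ip (cfsub (comb (l n)) c) (cfsub (comb (l n)) c)) 0.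
Proof.
  intros Hc. set (Q := fun l => ip (cfsub (comb l) c) (cfsub (comb l) c)).
  assert (HQf : forall l, ball_list l -> fin (cfsub (comb l) c)).
  { intros l Hl. apply fin_sub; [now apply fin_comb|exact Hc]. }
  (* The infimum of Q, obtained as minus the supremum of - Q. *)
  destruct (completeness (fun y => exists l, ball_list l /\ y = - Q l)) as [s [Hs1 Hs2]].
  { exists 0. intros y [l [Hl ->]]. pose proof (ip_ge0 _ (HQf l Hl)). unfold Q. lra. }
  { exists (- Q []), []. split; [constructor|reflexivity]. }
  set (d := - s).
  assert (Hlow : forall l, ball_list l -> d <= Q l).
  { intros l Hl. assert (- Q l <= s) by (apply Hs1; eauto). unfold d; lra. }
  assert (Hex : forall n, exists l, ball_list l /\ Q l <= d + / INR (S n)).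
  { intros n. assert (Hp : 0 < / INR (S n)) by (apply Rinv_0_lt_compat, lt_0_INR; lia).
    destruct (excluded_middle_informative (exists l, ball_list l /\ Q l <= d + / INR (S n))) as [h|h]; [exact h|].
    exfalso. assert (s <= s - / INR (S n)); [|lra]. apply Hs2. intros y [l [Hl ->]].
    apply Rnot_lt_le. intros hh. apply h. exists l. split; [exact Hl|]. unfold d. lra. }
  set (l := fun n => proj1_sig (constructive_indefinite_description _ (Hex n))).
  assert (Hl : forall n, ball_list (l n) /\ Q (l n) <= d + / INR (S n)).
  { intros n. unfold l. now destruct (constructive_indefinite_description _ (Hex n)). }
  exists l. split; [apply Hl|].
  set (e := fun n => cfsub (comb (l n)) c). assert (He : forall n, fin (e n)) by (intros n; apply HQf, Hl).
  assert (Hinv : forall n, 0 < / INR (S n)) by (intros n; apply Rinv_0_lt_compat, lt_0_INR; lia).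
  (* Parallelogram law: the midpoint of two combinations is again a combination, so its square error
     is at least d, and |e i - e j|^2 <= 2 |e i|^2 + 2 |e j|^2 - 4 d. *)
  assert (Hcau : forall i j, ip (cfsub (e i) (e j)) (cfsub (e i) (e j)) <= 2 * / INR (S i) + 2 * / INR (S j)).
  { intros i j.
    assert (Hm : d <= Q (scale_list (CR (/ 2)) (l i ++ l j))).
    { apply Hlow, ball_scale. apply Forall_app. split; apply Hl. }
    unfold Q in Hm.
    replace (cfsub (comb (scale_list (CR (/ 2)) (l i ++ l j))) c) with
      (cfscal (CR (/ 2)) (cfadd (e i) (cfscal (CR 1) (e j)))) in Hm.
    2:{ rewrite comb_scale, comb_app. apply functional_extensionality; intros a.
        unfold cfscal, cfsub, e, cfadd, cfsub. apply C_ext; simpl; field. }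
    assert (F1 : fin (cfscal (CR 1) (e j))) by (apply fin_scal; exact (He j)).
    assert (F2 : fin (cfadd (e i) (cfscal (CR 1) (e j)))) by exact (fin_add _ _ (He i) F1).
    rewrite (ip_scal2 _ _ F2), (ip_add2 _ _ _ (He i) (He j)) in Hm.
    rewrite (ip_sub2 _ _ (He i) (He j)).
    replace (Cmod2 (CR (/ 2))) with (/ 4) in Hm by (unfold Cmod2; simpl; field).
    destruct (Hl i) as [_ Hi]. destruct (Hl j) as [_ Hj]. unfold Q in Hi, Hj. fold (e i) in Hi. fold (e j) in Hj. lra. }
  destruct (fin_complete e He) as [x [Hx Hlim]].
  { intros eps Heps. destruct (archimed_cor1 (eps / 4)) as [n0 [H1 H2]]; [lra|].
    exists n0. intros i j Hi Hj. eapply Rle_trans; [apply Hcau|].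
    assert (forall m, (n0 <= m)%nat -> / INR (S m) <= / INR n0).
    { intros m hm. apply Rinv_le_contravar; [apply lt_0_INR; lia|apply le_INR; lia]. }
    pose proof (H i Hi). pose proof (H j Hj). lra. }
  assert (Horth : forall u w, in_ball N w -> ip x (cfscal u (kc w)) = 0).
  { intros u w Hw. set (g := cfscal u (kc w)). assert (Hg : fin g) by (apply fin_scal; now apply fin_kc).
    pose proof (ip_lim_l e x g He Hx Hg Hlim) as L.
    (* Adding t g to e n cannot push the square error below d, while |e n|^2 <= d + 1 / (n + 1);
       this is a quadratic in t bounded below. *)
    assert (B : forall n, ip (e n) g * ip (e n) g <= ip g g * / INR (S n)).
    { intros n. apply quadratic_bound; [now apply ip_ge0|left; apply Hinv|]. intros t.
      assert (Hm : d <= Q ((Cmul (CR t) u, w) :: l n)).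
      { apply Hlow. constructor; [exact Hw|apply Hl]. }
      unfold Q in Hm. replace (cfsub (comb ((Cmul (CR t) u, w) :: l n)) c) with (cfadd (e n) (cfscal (CR t) g)) in Hm.
      2:{ simpl. apply functional_extensionality; intros a. unfold e, g, cfscal, cfsub, cfadd. ring. }
      rewrite (ip_add2 _ _ _ (He n) Hg) in Hm. destruct (Hl n) as [_ Hn]. unfold Q in Hn. fold (e n) in Hn. lra. }
    assert (L2 : is_lim_seq (fun n => ip (e n) g * ip (e n) g) (ip x g * ip x g)) by now apply is_lim_seq_mult'.
    assert (L3 : is_lim_seq (fun n => ip g g * / INR (S n)) (ip g g * 0)).
    { apply is_lim_seq_mult'; [apply is_lim_seq_const|apply is_lim_seq_inv_nat]. }
    pose proof (is_lim_seq_le _ _ _ _ B L2 L3) as P. simpl in P. nra. }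
  assert (Hx0 : ip x x = 0).
  { apply eval_ext_zero; [exact Hx|]. intros z Hz. unfold eval.
    rewrite (Horth Ci z Hz). replace (kc z) with (cfscal C1 (kc z)).
    - now rewrite (Horth C1 z Hz).
    - apply functional_extensionality; intros a; unfold cfscal; ring. }
  apply (is_lim_seq_le_le (fun _ => 0) _ (fun n => 2 * ip (cfsub (e n) x) (cfsub (e n) x))).
  - intros n. split; [apply ip_ge0, He|]. fold (e n).
    pose proof (ip_sub_le (e n) x cfzero (He n) Hx fin_zero) as P.
    assert (Ez : forall y, cfsub y cfzero = y).
    { intros y. apply functional_extensionality; intros a; unfold cfsub, cfzero; ring. }
    rewrite !Ez, Hx0 in P. lra.
  - apply is_lim_seq_const.
  - replace (Finite 0) with (Finite (2 * 0)) by (f_equal; ring).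
    apply is_lim_seq_mult'; [apply is_lim_seq_const|exact Hlim].
Qed.
End Hilbert.

(** * Composition with automorphisms *)

Section Composition.
Variable N : nat.
Notation ip := (ip N). Notation fin := (fin N). Notation eval := (eval N).

Lemma ip_scal_kc c u w : fin c -> in_ball N w -> ip c (cfscal u (kc w)) = re (Cmul (Cconj u) (eval c w)).
Proof.
  intros Hc Hw. pose proof (fin_kc N w Hw) as Hk.
  replace (cfscal u (kc w)) with (cfadd (cfscal (CR (re u)) (kc w)) (cfscal (CR (im u)) (cfscal Ci (kc w)))).
  - rewrite ip_add_r, !ip_scal_r; auto using fin_scal. simpl. ring.
  - apply functional_extensionality; intros a; unfold cfadd, cfscal. Csolve.
Qed.

Lemma ip_comb_cons c p m : fin c -> in_ball N (snd p) -> ball_list N m ->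
  ip c (comb (p :: m)) = re (Cmul (Cconj (fst p)) (eval c (snd p))) + ip c (comb m).
Proof.
  intros Hc Hp Hm. cbn [comb fold_right]. fold (comb m).
  rewrite ip_add_r, ip_scal_kc; auto using fin_scal, fin_kc, fin_comb.
Qed.

Lemma eval_comb_cons p l z : in_ball N (snd p) -> ball_list N l -> in_ball N z ->
  eval (comb (p :: l)) z = Cadd (Cmul (fst p) (Llog (vdot N z (snd p)))) (eval (comb l) z).
Proof.
  intros Hp Hl Hz. cbn [comb fold_right]. fold (comb l).
  rewrite eval_add, eval_scal, eval_kc; auto using fin_scal, fin_kc, fin_comb.
Qed.

Lemma hsum_vzero c n : hsum N c vzero n = C0.
Proof.
  apply Csum_zero. intros [|k] _; [reflexivity|]. simpl.
  replace vzero with (vscal C0 vzero).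
  - rewrite homog_scal. simpl. ring.
  - apply functional_extensionality; intros i; unfold vscal, vzero; ring.
Qed.

Lemma Ccv_const (l : C) : Ccv (fun _ => l) l.
Proof. intros eps He. exists O. intros n _. replace (Csub l l) with C0 by ring. now rewrite Cmod_0. Qed.

Lemma eval_vzero c : fin c -> eval c vzero = C0.
Proof.
  intros Hc. apply (Ccv_unique (hsum N c vzero)); [apply eval_series; [exact Hc|apply in_ball_zero]|].
  replace (hsum N c vzero) with (fun _ : nat => C0); [apply Ccv_const|].
  apply functional_extensionality; intros n. symmetry. apply hsum_vzero.
Qed.

(** Equal values make the seminorm of c - d vanish, and Cauchy-Schwarz then removes its product with
    e. *)
Lemma ip_ext c d e : fin c -> fin d -> fin e -> (forall z, in_ball N z -> eval c z = eval d z) -> ip c e = ip d e.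
Proof.
  intros Hc Hd He H. assert (Hs : fin (cfsub c d)) by now apply fin_sub.
  assert (E : ip (cfsub c d) (cfsub c d) = 0).
  { apply eval_ext_zero; [exact Hs|]. intros z Hz. rewrite eval_sub, H by assumption. ring. }
  pose proof (ip_cauchy_schwarz N _ e Hs He) as P. rewrite E in P.
  rewrite cfsub_add, ip_add_l, ip_scal_l in P; auto using fin_scal. nra.
Qed.

Lemma norm_lim (u : nat -> cfs) c : (forall j, fin (u j)) -> fin c ->
  is_lim_seq (fun j => ip (cfsub (u j) c) (cfsub (u j) c)) 0 -> is_lim_seq (fun j => ip (u j) (u j)) (ip c c).
Proof.
  intros Hu Hc H.
  apply (is_lim_seq_ext (fun j => ip (cfsub (u j) c) (cfsub (u j) c) + 2 * ip (u j) c - ip c c)).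
  { intros j. rewrite ip_sub2 by auto. ring. }
  replace (ip c c) with (0 + 2 * ip c c - ip c c) at 1 by ring.
  apply is_lim_seq_minus'; [|apply is_lim_seq_const].
  apply is_lim_seq_plus'; [exact H|]. apply is_lim_seq_mult'; [apply is_lim_seq_const|].
  now apply ip_lim_l.
Qed.

Lemma eval_lim (u : nat -> cfs) c z : (forall j, fin (u j)) -> fin c -> in_ball N z ->
  is_lim_seq (fun j => ip (cfsub (u j) c) (cfsub (u j) c)) 0 -> Ccv (fun j => eval (u j) z) (eval c z).
Proof.
  intros Hu Hc Hz H. apply parts_Ccv; simpl; apply ip_lim_l; auto using fin_kc, fin_scal.
Qed.

Variables chi kap : vec -> vec.
Hypothesis Hpair : inverse_pair N chi kap.

Definition push (l : list (C * vec)) : list (C * vec) :=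
  flat_map (fun p => [(fst p, kap (snd p)); (Copp (fst p), kap vzero)]) l.

Lemma ball_kap z : in_ball N z -> in_ball N (kap z).
Proof. apply Hpair. Qed.

Lemma ball_chi z : in_ball N z -> in_ball N (chi z).
Proof. apply Hpair. Qed.

Lemma ball_push l : ball_list N l -> ball_list N (push l).
Proof.
  induction 1 as [|p l Hp Hl IH]; [constructor|]. simpl.
  constructor; [now apply ball_kap|]. constructor; [apply ball_kap, in_ball_zero|exact IH].
Qed.

(* The transported kernels: k_w o chi = k_(kap w) - k_(kap 0) up to a constant. *)
Lemma eval_push l z : ball_list N l -> in_ball N z ->
  eval (comb (push l)) z = Csub (eval (comb l) (chi z)) (eval (comb l) (chi vzero)).
Proof.
  intros Hl Hz. pose proof (in_ball_zero N) as H0.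
  induction Hl as [|p l Hp Hl IH].
  - simpl. rewrite !eval_zero. ring.
  - change (push (p :: l)) with ((fst p, kap (snd p)) :: (Copp (fst p), kap vzero) :: push l).
    assert (Hl' := ball_push l Hl).
    assert (Hk := ball_kap _ H0).
    rewrite eval_comb_cons; [|now apply ball_kap|constructor; assumption|exact Hz].
    rewrite eval_comb_cons; [|exact Hk|exact Hl'|exact Hz].
    rewrite !(eval_comb_cons p l) by auto using ball_chi.
    rewrite IH. cbn [fst snd].
    pose proof (Llog_automorphism N chi kap Hpair z (snd p) Hz Hp) as E.
    assert (E' : Llog (vdot N z (kap (snd p))) = Csub (Cadd (Llog (vdot N (chi z) (snd p))) (Llog (vdot N z (kap vzero))))
       (Llog (vdot N (chi vzero) (snd p)))) by (rewrite E; ring).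
    rewrite E'. ring.
Qed.

(** Pairing with a kernel is evaluation. At kap w the transported l has the value of l at chi (kap
    w) = w minus its value at chi 0; subtracting the same at kap 0 cancels the constant and leaves
    the value of l at w, since l vanishes at 0. *)
Lemma ip_push l m : ball_list N l -> ball_list N m -> ip (comb (push l)) (comb (push m)) = ip (comb l) (comb m).
Proof.
  intros Hl Hm. pose proof (in_ball_zero N) as H0. assert (Hk := ball_kap _ H0).
  pose proof (fin_comb N _ Hl) as Fl. pose proof (fin_comb N _ (ball_push l Hl)) as Fpl.
  assert (Echi : forall w, in_ball N w -> chi (kap w) = w) by (intros w Hw; now apply Hpair).
  induction Hm as [|p m Hp Hm IH].
  - simpl. rewrite !ip_vanish; [reflexivity| |]; intros k a _; simpl; ring.
  - change (push (p :: m)) with ((fst p, kap (snd p)) :: (Copp (fst p), kap vzero) :: push m).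
    assert (Hm' := ball_push m Hm).
    rewrite ip_comb_cons; [|exact Fpl|now apply ball_kap|constructor; assumption].
    rewrite ip_comb_cons; [|exact Fpl|exact Hk|exact Hm'].
    rewrite (ip_comb_cons (comb l) p m) by assumption. rewrite IH. cbn [fst snd].
    rewrite !eval_push, !Echi by auto using ball_kap.
    rewrite (eval_vzero (comb l)) by exact Fl. simpl. ring.
Qed.

Lemma comb_push_sub l m :
  comb (push (l ++ scale_list (CR (-1)) m)) = cfsub (comb (push l)) (comb (push m)).
Proof.
  rewrite <- comb_sub. unfold push. rewrite flat_map_app. rewrite !comb_app. f_equal.
  induction m as [|p m IH]; [reflexivity|]. simpl. rewrite IH.
  replace (Copp (Cmul (CR (-1)) (fst p))) with (Cmul (CR (-1)) (Copp (fst p))) by ring. reflexivity.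
Qed.

(** If c represents f modulo constants, then c' represents f o chi modulo constants; both sides are
    normalised to vanish at 0. *)
Definition pullback (c c' : cfs) : Prop :=
  fin c' /\ forall z, in_ball N z -> eval c' z = Csub (eval c (chi z)) (eval c (chi vzero)).

(** The source of the expansion of f o chi. Transported approximations of c form a Cauchy sequence
    because [push] preserves the inner product, and point values pass to the limit because
    evaluations are bounded. *)
Lemma pullback_exists c : fin c -> exists c', pullback c c' /\ ip c' c' = ip c c.
Proof.
  intros Hc. destruct (kernels_dense N c Hc) as [l [Hl Hlim]].
  set (u := fun n => comb (push (l n))).
  assert (Hu : forall n, fin (u n)) by (intros n; apply fin_comb, ball_push, Hl).
  assert (Hcl : forall n, fin (comb (l n))) by (intros n; apply fin_comb, Hl).
  destruct (fin_complete N u Hu) as [c' [Hc' Hlim']].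
  { intros eps He. apply is_lim_seq_Reals in Hlim.
    destruct (Hlim (eps / 4)) as [J HJ]; [lra|]. exists J. intros i j Hi Hj.
    unfold u. rewrite <- comb_push_sub, ip_push, comb_sub by
      (apply List.Forall_app; split; [apply Hl|apply ball_scale, Hl]).
    pose proof (ip_sub_le N (comb (l i)) c (comb (l j)) (Hcl i) Hc (Hcl j)) as P.
    assert (E : ip (cfsub c (comb (l j))) (cfsub c (comb (l j))) = ip (cfsub (comb (l j)) c) (cfsub (comb (l j)) c)).
    { rewrite !ip_sub2 by auto. rewrite (ip_sym N c (comb (l j))). ring. }
    rewrite E in P.
    assert (Q : forall k, (J <= k)%nat -> ip (cfsub (comb (l k)) c) (cfsub (comb (l k)) c) <= eps / 4).
    { intros k Hk. specialize (HJ k Hk). unfold Rdist in HJ. rewrite Rminus_0_r in HJ.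
      apply Rabs_def2 in HJ. lra. }
    pose proof (Q i Hi). pose proof (Q j Hj). lra. }
  exists c'. split; [split; [exact Hc'|]|].
  - intros z Hz. apply (Ccv_unique (fun n => eval (u n) z)); [now apply eval_lim|].
    pose proof (eval_lim _ c (chi z) Hcl Hc (ball_chi z Hz) Hlim) as L1.
    pose proof (eval_lim _ c (chi vzero) Hcl Hc (ball_chi _ (in_ball_zero N)) Hlim) as L2.
    intros eps He. destruct (L1 (eps / 2)) as [n1 H1]; [lra|]. destruct (L2 (eps / 2)) as [n2 H2]; [lra|].
    exists (Nat.max n1 n2). intros n Hn. specialize (H1 n ltac:(lia)). specialize (H2 n ltac:(lia)).
    unfold u. rewrite eval_push by (apply Hl || exact Hz).
    set (A := eval (comb (l n)) (chi z)) in *. set (B := eval (comb (l n)) (chi vzero)) in *.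
    replace (Csub (Csub A B) (Csub (eval c (chi z)) (eval c (chi vzero)))) with
      (Csub (Csub A (eval c (chi z))) (Csub B (eval c (chi vzero)))) by ring.
    eapply Rle_lt_trans; [apply Cmod_sub_le|]. lra.
  - pose proof (norm_lim u c' Hu Hc' Hlim') as L1.
    pose proof (norm_lim _ c Hcl Hc Hlim) as L2.
    apply (is_lim_seq_ext _ (fun n => ip (comb (l n)) (comb (l n)))) in L1.
    + apply is_lim_seq_unique in L1. apply is_lim_seq_unique in L2. rewrite L1 in L2. now injection L2.
    + intros n. apply ip_push; apply Hl.
Qed.

(** Any pullback has the values of the one constructed in [pullback_exists], hence the same
    seminorm. *)
Lemma pullback_norm c c' : fin c -> pullback c c' -> ip c' c' = ip c c.
Proof.
  intros Hc [Hc' H]. destruct (pullback_exists c Hc) as [d [[Hd Hdz] E]]. rewrite <- E.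
  assert (Ez : forall z, in_ball N z -> eval c' z = eval d z).
  { intros z Hz. now rewrite H, Hdz. }
  rewrite (ip_ext c' d c' Hc' Hd Hc' Ez), (ip_sym N d). now apply ip_ext.
Qed.

Lemma pullback_add c d c' d' : fin c -> fin d -> pullback c c' -> pullback d d' ->
  pullback (cfadd c d) (cfadd c' d').
Proof.
  intros Hc Hd [Hc' H1] [Hd' H2]. split; [now apply fin_add|]. intros z Hz.
  rewrite !eval_add, H1, H2 by auto using ball_chi, in_ball_zero. ring.
Qed.

Lemma pullback_scal u c c' : fin c -> pullback c c' -> pullback (cfscal u c) (cfscal u c').
Proof.
  intros Hc [Hc' H1]. split; [now apply fin_scal|]. intros z Hz.
  rewrite !eval_scal, H1 by auto using ball_chi, in_ball_zero. ring.
Qed.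

Lemma pullback_ip c d c' d' : fin c -> fin d -> pullback c c' -> pullback d d' -> ip c' d' = ip c d.
Proof.
  intros Hc Hd H1 H2.
  pose proof (pullback_norm _ _ (fin_add N c d Hc Hd) (pullback_add _ _ _ _ Hc Hd H1 H2)) as E.
  pose proof (pullback_norm _ _ Hc H1) as E1. pose proof (pullback_norm _ _ Hd H2) as E2.
  destruct H1 as [Hc' _]. destruct H2 as [Hd' _].
  assert (X : forall x y, fin x -> fin y -> ip (cfadd x y) (cfadd x y) = ip x x + 2 * ip x y + ip y y).
  { intros x y Hx Hy. rewrite ip_add_l, !ip_add_r, (ip_sym N y x); auto using fin_add. ring. }
  rewrite !X in E by assumption. lra.
Qed.
End Composition.

(** * Functions of the Dirichlet space *)

Section Functions.
Variable N : nat.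
Notation ip := (ip N). Notation fin := (fin N). Notation eval := (eval N).

(* [c (zero_mi N)] is irrelevant here: its weight is 0. *)
Definition rep (f : vec -> C) (c : cfs) : Prop :=
  fin c /\ forall z, in_ball N z -> f z = Cadd (f vzero) (eval c z).

Lemma mi_0 : mi N 0 = [zero_mi N].
Proof.
  unfold zero_mi. induction N as [|n IH]; [reflexivity|]. cbn [mi seq flat_map].
  simpl. now rewrite IH.
Qed.

Lemma mono_zero_mi z : mono z (zero_mi N) = C1.
Proof.
  assert (H : forall n i, monoAux z i (repeat 0%nat n) = C1).
  { induction n as [|n IH]; intros i; [reflexivity|]. simpl. rewrite IH. ring. }
  apply H.
Qed.

Lemma homog_0 c z : homog N c 0 z = c (zero_mi N).
Proof. unfold homog. rewrite mi_0. simpl. rewrite mono_zero_mi. ring. Qed.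

Lemma partial_sum_hsum c z n :
  Csum (map (fun k => homog N c k z) (seq 0 (S n))) = Cadd (c (zero_mi N)) (hsum N c z n).
Proof.
  unfold hsum. rewrite !(Csum_seq_shift _ n), homog_0. unfold homog1. ring.
Qed.

Lemma Ccv_add_l u v l : Ccv v l -> Ccv (fun n => Cadd u (v n)) (Cadd u l).
Proof.
  intros H eps He. destruct (H eps He) as [n0 Hn]. exists n0. intros n h.
  replace (Csub (Cadd u (v n)) (Cadd u l)) with (Csub (v n) l) by ring. auto.
Qed.

Lemma fin_expansion f c : fin c ->
  (expansion N f c <-> forall z, in_ball N z -> f z = Cadd (c (zero_mi N)) (eval c z)).
Proof.
  intros Hc.
  assert (L : forall z, in_ball N z -> Ccv (fun n => Csum (map (fun k => homog N c k z) (seq 0 (S n))))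
     (Cadd (c (zero_mi N)) (eval c z))).
  { intros z Hz. replace (fun n => Csum (map (fun k => homog N c k z) (seq 0 (S n)))) with
      (fun n => Cadd (c (zero_mi N)) (hsum N c z n)).
    - apply Ccv_add_l. now apply eval_series.
    - apply functional_extensionality; intros n. now rewrite partial_sum_hsum. }
  split; intros H z Hz.
  - exact (Ccv_unique _ _ _ (H z Hz) (L z Hz)).
  - rewrite (H z Hz). now apply L.
Qed.

Lemma rep_of_expansion f c : fin c -> expansion N f c -> rep f c /\ f vzero = c (zero_mi N).
Proof.
  intros Hc He. pose proof (proj1 (fin_expansion f c Hc) He) as H.
  assert (H0 : f vzero = c (zero_mi N)).
  { rewrite (H _ (in_ball_zero N)), eval_vzero by exact Hc. ring. }
  split; [|exact H0]. split; [exact Hc|]. intros z Hz. rewrite H0. now apply H.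
Qed.

Definition set0 (x : C) (c : cfs) : cfs := fun a => if Nat.eqb (list_sum a) 0 then x else c a.

Lemma list_sum_zero_mi : list_sum (zero_mi N) = 0%nat.
Proof. unfold zero_mi. induction N; simpl; auto. Qed.

Lemma Dterm_set0 x y c d k : Dterm N (set0 x c) (set0 y d) k = Dterm N c d k.
Proof.
  destruct k as [|k].
  - unfold Dterm. rewrite !Csum_zero; [reflexivity| |]; intros a _; rewrite weight_0; change (CR 0) with C0; ring.
  - apply Csum_ext. intros a Ha. apply mi_spec in Ha. unfold set0. now rewrite (proj2 Ha).
Qed.

Lemma set0_rep f c : rep f c -> fin (set0 (f vzero) c) /\ expansion N f (set0 (f vzero) c).
Proof.
  intros [[M HM] H]. 
  assert (E : forall n d, bip N n (set0 (f vzero) c) d = bip N n c d).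
  { intros n d. apply Rsum_ext. intros k _.
    rewrite <- (Dterm_set0 C0 C0 (set0 (f vzero) c) d), <- (Dterm_set0 C0 C0 c d). do 2 f_equal.
    apply functional_extensionality; intros a. unfold set0. now destruct (Nat.eqb (list_sum a) 0). }
  assert (Hf : fin (set0 (f vzero) c)).
  { exists M. intros n. rewrite E, bip_sym, E. apply HM. }
  split; [exact Hf|]. apply fin_expansion; [exact Hf|]. intros z Hz. rewrite (H z Hz).
  unfold set0 at 1. rewrite list_sum_zero_mi. simpl. f_equal.
  unfold eval. f_equal; apply ip_ext_bip; intros n; now rewrite E.
Qed.

Lemma inD_rep f : inD N f <-> holo N f /\ exists c, rep f c.
Proof.
  assert (Eq : forall c n, Rsum (map (fun k => Rsum (map (fun a => weight k a * Cmod2 (c a)) (mi N k))) (seq 0 (S n)))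
    = bip N n c c).
  { intros c n. apply Rsum_ext. intros k _. now rewrite re_Dterm_self. }
  split; intros [Hh H]; split; try exact Hh.
  - destruct H as [c [He [r Hr]]]. exists c. apply rep_of_expansion; [|exact He].
    exists r. intros n. apply is_lim_seq_Reals in Hr. rewrite <- Eq.
    apply (is_lim_seq_incr_compare _ _ Hr). intros m. rewrite !Eq. apply bip_incr.
  - destruct H as [c Hc]. destruct (set0_rep f c Hc) as [Hf He].
    exists (set0 (f vzero) c). split; [exact He|]. exists (ip (set0 (f vzero) c) (set0 (f vzero) c)).
    apply is_lim_seq_Reals. apply (is_lim_seq_ext (fun n => bip N n (set0 (f vzero) c) (set0 (f vzero) c))).
    + intros n. now rewrite Eq.
    + now apply fin_lim.
Qed.

(** [coef] is picked by [epsilon]. Uniqueness of expansions pins it down on the multi-indices of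
    length N, which are the ones entering [Dinner]. *)
Lemma coef_rep f c : rep f c ->
  forall k a, In a (mi N k) -> coef N f a = set0 (f vzero) c a.
Proof.
  intros Hc k a Ha. destruct (set0_rep f c Hc) as [_ He].
  assert (Hco : expansion N f (coef N f)).
  { unfold coef. apply epsilon_spec. now exists (set0 (f vzero) c). }
  apply Csub_eq0. apply (expansion_zero N (cfsub (coef N f) (set0 (f vzero) c))) with (k := k); [|exact Ha].
  intros z Hz. specialize (He z Hz). specialize (Hco z Hz). intros eps Heps.
  destruct (He (eps / 2)) as [n1 H1]; [lra|]. destruct (Hco (eps / 2)) as [n2 H2]; [lra|].
  exists (Nat.max n1 n2). intros n Hn. specialize (H1 n ltac:(lia)). specialize (H2 n ltac:(lia)).
  replace (Csum (map (fun k0 => homog N (cfsub (coef N f) (set0 (f vzero) c)) k0 z) (seq 0 (S n)))) with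
    (Csub (Csum (map (fun k0 => homog N (coef N f) k0 z) (seq 0 (S n))))
          (Csum (map (fun k0 => homog N (set0 (f vzero) c) k0 z) (seq 0 (S n))))).
  - set (A := Csum (map (fun k0 => homog N (coef N f) k0 z) (seq 0 (S n)))) in *.
    set (B := Csum (map (fun k0 => homog N (set0 (f vzero) c) k0 z) (seq 0 (S n)))) in *.
    replace (Csub (Csub A B) C0) with (Csub (Csub A (f z)) (Csub B (f z))) by ring.
    eapply Rle_lt_trans; [apply Cmod_sub_le|]. lra.
  - rewrite <- Csum_sub. apply Csum_ext. intros j _. unfold homog. rewrite <- Csum_sub.
    apply Csum_ext. intros b _. unfold cfsub. ring.
Qed.

Definition sip (c d : cfs) : C := mkC (ip c d) (ip c (cfscal Ci d)).

Lemma Dinner_rep f g c d : rep f c -> rep g d ->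
  Dinner N f g = Cadd (Cmul (f vzero) (Cconj (g vzero))) (sip c d).
Proof.
  intros Hf Hg. pose proof (coef_rep f c Hf) as Cf. pose proof (coef_rep g d Hg) as Cg.
  unfold Dinner. f_equal.
  - assert (Hz : In (zero_mi N) (mi N 0)) by (rewrite mi_0; now left).
    rewrite (Cf 0%nat _ Hz), (Cg 0%nat _ Hz). unfold set0. now rewrite list_sum_zero_mi.
  - destruct Hf as [Fc _]. destruct Hg as [Fd _]. apply Clim_eq.
    replace (fun n => Csum (map (fun k => Dterm N (coef N f) (coef N g) k) (seq 0 (S n)))) with
      (fun n => mkC (bip N n c d) (bip N n c (cfscal Ci d))).
    + apply parts_Ccv; simpl; apply ip_lim; auto. now apply fin_scal.
    + apply functional_extensionality; intros n.
      replace (Csum (map (fun k => Dterm N (coef N f) (coef N g) k) (seq 0 (S n)))) with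
        (Csum (map (fun k => Dterm N c d k) (seq 0 (S n)))).
      * rewrite bip_Ci. apply C_ext; cbn [re im]; [rewrite re_Csum|rewrite im_Csum]; now rewrite map_map.
      * apply Csum_ext. intros k _. rewrite <- (Dterm_set0 (f vzero) (g vzero)).
        apply Csum_ext. intros a Ha. now rewrite (Cf k a Ha), (Cg k a Ha).
Qed.

Lemma Dnorm_rep f c : rep f c -> Dnorm N f = sqrt (Cmod2 (f vzero) + ip c c).
Proof.
  intros Hf. unfold Dnorm. rewrite (Dinner_rep f f c c Hf Hf). f_equal. simpl. unfold Cmod2. ring.
Qed.

Lemma Dnorm_sqr f c : rep f c -> Dnorm N f * Dnorm N f = Cmod2 (f vzero) + ip c c.
Proof.
  intros Hf. rewrite (Dnorm_rep f c Hf). apply sqrt_sqrt.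
  pose proof (Cmod2_ge0 (f vzero)). pose proof (ip_ge0 N c (proj1 Hf)). lra.
Qed.

Lemma rep_comp chi kap f c : inverse_pair N chi kap -> rep f c ->
  exists c', rep (Ccomp f chi) c' /\ pullback N chi c c'.
Proof.
  intros Hp [Fc Hc]. destruct (pullback_exists N chi kap Hp c Fc) as [c' [[F' H'] _]].
  exists c'. split; [|split; assumption]. split; [exact F'|]. intros z Hz. unfold Ccomp.
  assert (B : forall w, in_ball N w -> in_ball N (chi w)) by apply Hp.
  rewrite (Hc (chi z)), (Hc (chi vzero)), (H' z Hz) by auto using in_ball_zero. ring.
Qed.

Lemma rep_ext f g c : (forall z, in_ball N z -> f z = g z) -> rep f c -> rep g c.
Proof.
  intros E [Fc H]. split; [exact Fc|]. intros z Hz. rewrite <- !E by auto using in_ball_zero. now apply H.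
Qed.

Lemma rep_add f g c d : rep f c -> rep g d -> rep (fun z => Cadd (f z) (g z)) (cfadd c d).
Proof.
  intros [Fc Hc] [Fd Hd]. split; [now apply fin_add|]. intros z Hz.
  rewrite (Hc z Hz), (Hd z Hz), eval_add by assumption. ring.
Qed.

Lemma rep_scal u f c : rep f c -> rep (fun z => Cmul u (f z)) (cfscal u c).
Proof.
  intros [Fc Hc]. split; [now apply fin_scal|]. intros z Hz.
  rewrite (Hc z Hz), eval_scal by assumption. ring.
Qed.

Lemma rep_const u : rep (fun _ => u) cfzero.
Proof. split; [apply fin_zero|]. intros z Hz. rewrite eval_zero. ring. Qed.

Lemma rep_sub f g c d : rep f c -> rep g d -> rep (fsub f g) (cfsub c d).
Proof.
  intros Hf Hg. rewrite cfsub_add. apply (rep_ext (fun z => Cadd (f z) (Cmul (CR (-1)) (g z)))).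
  - intros z _. unfold fsub. Csolve.
  - apply rep_add; [exact Hf|now apply rep_scal].
Qed.

Definition kfunc (w : vec) (z : vec) : C := Llog (vdot N z w).

Lemma kfunc_vzero w : kfunc w vzero = C0.
Proof. unfold kfunc. rewrite vdot_zero_l. apply Llog_0. Qed.

Lemma rep_kfunc w : in_ball N w -> rep (kfunc w) (kc w).
Proof.
  intros Hw. split; [now apply fin_kc|]. intros z Hz. rewrite kfunc_vzero, eval_kc by assumption.
  unfold kfunc. ring.
Qed.

Lemma holo_kfunc w : in_ball N w -> holo N (kfunc w).
Proof.
  intros Hw. apply (holo_comp_cderiv N (fun z => vdot N z w) Llog); [apply holo_vdot|].
  intros z Hz. eexists. apply Llog_cderiv. now apply vdot_ball_lt1.
Qed.

Lemma inD_comp chi kap f : inverse_pair N chi kap -> inD N f -> inD N (Ccomp f chi).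
Proof.
  intros Hp Hf. apply inD_rep in Hf. destruct Hf as [Hh [c Hc]].
  pose proof Hp as (P1 & P2 & _). apply inD_rep. split; [now apply holo_comp|].
  destruct (rep_comp chi kap f c Hp Hc) as [c' [Hc' _]]. now exists c'.
Qed.

Lemma inD_add f g : inD N f -> inD N g -> inD N (fun z => Cadd (f z) (g z)).
Proof.
  intros Hf Hg. apply inD_rep in Hf. apply inD_rep in Hg. destruct Hf as [Hh [c Hc]].
  destruct Hg as [Kh [d Hd]]. apply inD_rep. split; [now apply holo_add|].
  eexists. now apply rep_add; eassumption.
Qed.

Lemma inD_scal u f : inD N f -> inD N (fun z => Cmul u (f z)).
Proof.
  intros Hf. apply inD_rep in Hf. destruct Hf as [Hh [c Hc]].
  apply inD_rep. split; [apply holo_mul; [apply holo_const|exact Hh]|]. eexists. apply rep_scal; eassumption.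
Qed.

Lemma inD_const u : inD N (fun _ => u).
Proof. apply inD_rep. split; [apply holo_const|]. eexists. apply rep_const. Qed.

Lemma inD_sub f g : inD N f -> inD N g -> inD N (fsub f g).
Proof.
  intros Hf Hg. apply inD_rep in Hf. apply inD_rep in Hg. destruct Hf as [Hh [c Hc]].
  destruct Hg as [Kh [d Hd]]. apply inD_rep. split; [now apply holo_sub|].
  eexists. now apply rep_sub; eassumption.
Qed.

Lemma inD_kfunc w : in_ball N w -> inD N (kfunc w).
Proof. intros Hw. apply inD_rep. split; [now apply holo_kfunc|]. eexists. now apply rep_kfunc. Qed.

Lemma sip_pullback chi kap c d c' d' : inverse_pair N chi kap -> fin c -> fin d ->
  pullback N chi c c' -> pullback N chi d d' -> sip c' d' = sip c d.
Proof.
  intros Hp Hc Hd H1 H2. unfold sip. f_equal.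
  - eapply pullback_ip; eassumption.
  - eapply pullback_ip; try eassumption; [now apply fin_scal|]. eapply pullback_scal; eassumption.
Qed.
End Functions.

(** * The adjoint and the commutator *)

Section DirichletNorm.
Variable N : nat.

Lemma sip_add_r c d e : fin N c -> fin N d -> fin N e -> sip N e (cfadd c d) = Cadd (sip N e c) (sip N e d).
Proof.
  intros Hc Hd He. unfold sip.
  replace (cfscal Ci (cfadd c d)) with (cfadd (cfscal Ci c) (cfscal Ci d)).
  - rewrite !ip_add_r by auto using fin_scal. reflexivity.
  - apply functional_extensionality; intros a; unfold cfscal, cfadd; ring.
Qed.

Lemma sip_scal_kc u c w : fin N c -> in_ball N w -> sip N c (cfscal u (kc w)) = Cmul (Cconj u) (eval N c w).
Proof.
  intros Hc Hw. unfold sip.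
  replace (cfscal Ci (cfscal u (kc w))) with (cfscal (Cmul Ci u) (kc w)).
  - rewrite !ip_scal_kc by assumption. apply C_ext; simpl; ring.
  - apply functional_extensionality; intros a; unfold cfscal; ring.
Qed.

Lemma sip_kc_l c w : fin N c -> in_ball N w -> sip N (kc w) c = Cconj (eval N c w).
Proof.
  intros Hc Hw. unfold sip. rewrite (ip_sym N (kc w) (cfscal Ci c)), (ip_sym N (kc w) c).
  change (ip N (cfscal Ci c) (kc w)) with (re (eval N (cfscal Ci c) w)).
  rewrite eval_scal by assumption. apply C_ext; simpl; ring.
Qed.

Lemma sip_zero_l c : sip N cfzero c = C0.
Proof.
  unfold sip. rewrite !ip_vanish; [reflexivity| |]; intros k a _; simpl; ring.
Qed.

Lemma Dnorm_ge0 f : 0 <= Dnorm N f.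
Proof. apply sqrt_pos. Qed.

Lemma Dnorm_ext f g : inD N f -> (forall z, in_ball N z -> f z = g z) -> Dnorm N f = Dnorm N g.
Proof.
  intros Hf E. apply inD_rep in Hf. destruct Hf as [_ [c Hc]].
  rewrite (Dnorm_rep N f c Hc), (Dnorm_rep N g c (rep_ext N f g c E Hc)).
  now rewrite E by apply in_ball_zero.
Qed.

Lemma Dnorm_scal u f : inD N f -> Dnorm N (fun z => Cmul u (f z)) = Cmod u * Dnorm N f.
Proof.
  intros Hf. apply inD_rep in Hf. destruct Hf as [_ [c Hc]].
  rewrite (Dnorm_rep N f c Hc), (Dnorm_rep N _ _ (rep_scal N u f c Hc)).
  rewrite ip_scal2, Cmod2_mul by apply Hc. unfold Cmod.
  rewrite <- sqrt_mult_alt by apply Cmod2_ge0. f_equal. ring.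
Qed.

(** A crude triangle inequality from |f + g|^2 <= 2 |f|^2 + 2 |g|^2, enough for passing to
    limits. *)
Lemma Dnorm_add_le f g : inD N f -> inD N g ->
  Dnorm N (fun z => Cadd (f z) (g z)) <= 2 * (Dnorm N f + Dnorm N g).
Proof.
  intros Hf Hg. apply inD_rep in Hf. destruct Hf as [_ [c Hc]].
  apply inD_rep in Hg. destruct Hg as [_ [d Hd]].
  pose proof (Dnorm_ge0 f). pose proof (Dnorm_ge0 g).
  pose proof (Dnorm_sqr N f c Hc) as E1. pose proof (Dnorm_sqr N g d Hd) as E2.
  pose proof (Dnorm_sqr N _ _ (rep_add N f g c d Hc Hd)) as E3. cbv beta in E3.
  pose proof (ip_ge0 N _ (fin_sub N c d (proj1 Hc) (proj1 Hd))) as P.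
  rewrite ip_sub2 in P by (apply Hc || apply Hd).
  replace (cfadd c d) with (cfadd c (cfscal (CR 1) d)) in E3
    by (apply functional_extensionality; intros a; unfold cfadd, cfscal; Csolve).
  rewrite ip_add2 in E3 by (apply Hc || apply Hd).
  pose proof (Cmod2_ge0 (Csub (f vzero) (g vzero))) as Q. unfold Cmod2 in *. simpl in *.
  pose proof (Dnorm_ge0 (fun z => Cadd (f z) (g z))). nra.
Qed.

Lemma value_bound h z : inD N h -> in_ball N z ->
  Cmod2 (Csub (h z) (h vzero)) <= 2 * (Dnorm N h * Dnorm N h * ip N (kc z) (kc z)).
Proof.
  intros Hh Hz. apply inD_rep in Hh. destruct Hh as [_ [c Hc]].
  rewrite (Dnorm_sqr N h c Hc), (proj2 Hc z Hz).
  replace (Csub (Cadd (h vzero) (eval N c z)) (h vzero)) with (eval N c z) by ring.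
  eapply Rle_trans; [apply eval_bound; [apply Hc|exact Hz]|].
  pose proof (Cmod2_ge0 (h vzero)). pose proof (ip_ge0 N _ (fin_kc N z Hz)).
  apply Rmult_le_compat_l; [lra|]. apply Rmult_le_compat_r; lra.
Qed.

Lemma value_bounded z : in_ball N z -> exists K, 0 <= K /\ forall h, inD N h -> Cmod (h z) <= K * Dnorm N h.
Proof.
  intros Hz. set (P := ip N (kc z) (kc z)). assert (HP : 0 <= P) by apply ip_ge0, fin_kc, Hz.
  (* One unit for the value at 0; the rest bounds h z - h 0 because 2 P <= (1 + 2 P)^2, which avoids
     a square root. *)
  exists (1 + (1 + 2 * P)). split; [lra|]. intros h Hh. pose proof (Dnorm_ge0 h) as D0.
  assert (H0 : Cmod (h vzero) <= Dnorm N h).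
  { pose proof Hh as Hh'. apply inD_rep in Hh'. destruct Hh' as [_ [c Hc]].
    apply Cmod_le_of_sqr; [exact D0|]. rewrite (Dnorm_sqr N h c Hc).
    pose proof (ip_ge0 N c (proj1 Hc)). lra. }
  assert (H1 : Cmod (Csub (h z) (h vzero)) <= (1 + 2 * P) * Dnorm N h).
  { apply Cmod_le_of_sqr; [nra|]. eapply Rle_trans; [now apply value_bound|]. fold P.
    replace ((1 + 2 * P) * Dnorm N h * ((1 + 2 * P) * Dnorm N h)) with
      (Dnorm N h * Dnorm N h * ((1 + 2 * P) * (1 + 2 * P))) by ring.
    replace (2 * (Dnorm N h * Dnorm N h * P)) with (Dnorm N h * Dnorm N h * (2 * P)) by ring.
    apply Rmult_le_compat_l; nra. }
  replace (h z) with (Cadd (Csub (h z) (h vzero)) (h vzero)) by ring.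
  eapply Rle_trans; [apply Cmod_triangle|]. lra.
Qed.

Lemma ip_kc_self w : in_ball N w -> ip N (kc w) (kc w) = - ln (1 - vnorm2 N w).
Proof.
  intros Hw. change (ip N (kc w) (kc w)) with (re (eval N (kc w) w)).
  rewrite eval_kc, vdot_self by assumption. rewrite re_Llog.
  - replace (Csub C1 (CR (vnorm2 N w))) with (CR (1 - vnorm2 N w)) by Csolve.
    rewrite Cmod_CR, Rabs_pos_eq; [reflexivity|]. destruct Hw; lra.
  - rewrite <- vdot_self. now apply vdot_ball_lt1.
Qed.

Lemma Llog_bound x r : Cmod x <= r -> r < 1 -> Cmod (Llog x) <= 2 / (1 - r).
Proof.
  intros Hx Hr. pose proof (Cmod_ge0 x) as x0.
  pose proof (segment_bound Llog x (fun z => Cinv (Csub C1 z)) (/ (1 - r))) as P.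
  rewrite Llog_0 in P. replace (Csub (Llog x) C0) with (Llog x) in P by ring. apply P.
  - intros t Ht. apply Llog_cderiv. rewrite Cmod_mul, Cmod_CR, Rabs_pos_eq by lra. nra.
  - intros t Ht. assert (Hz : Cmod (Cmul (CR t) x) <= r).
    { rewrite Cmod_mul, Cmod_CR, Rabs_pos_eq by lra. nra. }
    set (z := Cmul (CR t) x) in *.
    rewrite Cmod_mul, Cmod_inv by (apply one_minus_neq0; lra).
    pose proof (Cmod_sub_ge C1 z) as Q. rewrite Cmod_1 in Q.
    rewrite <- (Rmult_1_r (/ (1 - r))). apply Rmult_le_compat; [|exact x0| |lra].
    + left. apply Rinv_0_lt_compat. lra.
    + apply Rinv_le_contravar; lra.
Qed.

(** Uniform in w: for a fixed evaluation point, while w approaches the sphere. *)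
Lemma kfunc_bound w z : in_ball N w -> in_ball N z -> Cmod (kfunc N w z) <= 2 / (1 - vnorm N z).
Proof.
  intros Hw Hz. apply Llog_bound; [|now apply in_ball_vnorm].
  eapply Rle_trans; [apply cauchy_schwarz|]. apply in_ball_vnorm in Hw.
  pose proof (vnorm_ge0 N z). nra.
Qed.

(** Uniform in z: for a fixed kernel, while the evaluation point approaches the sphere. *)
Lemma kfunc_bound_r w z : in_ball N w -> in_ball N z -> Cmod (kfunc N w z) <= 2 / (1 - vnorm N w).
Proof.
  intros Hw Hz. apply Llog_bound; [|now apply in_ball_vnorm].
  eapply Rle_trans; [apply cauchy_schwarz|]. apply in_ball_vnorm in Hz.
  pose proof (vnorm_ge0 N w). nra.
Qed.

(** The case w = z of [automorphism_vdot], with |1 - <z, a>|^2 <= 4. After taking logarithms,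
    |k_(eta z)|^2 exceeds |k_z|^2 by at most a constant. *)
Lemma automorphism_one_minus_norm eta theta z : inverse_pair N eta theta -> in_ball N z ->
  (1 - vnorm2 N (theta vzero)) / 4 * (1 - vnorm2 N z) <= 1 - vnorm2 N (eta z).
Proof.
  intros Hp Hz. pose proof Hp as (_ & H2 & _ & H4 & _).
  set (a := theta vzero). assert (Ha : in_ball N a) by apply H4, in_ball_zero.
  pose proof (automorphism_vdot N eta theta Hp z z Hz Hz) as E. cbv zeta in E. fold a in E.
  rewrite !vdot_self, <- (vdot_conj N z a) in E.
  replace (Csub C1 (Cconj (vdot N z a))) with (Cconj (Csub C1 (vdot N z a))) in E by Csolve.
  rewrite Cmul_conj in E. apply (f_equal re) in E. simpl in E.
  assert (B : Cmod2 (Csub C1 (vdot N z a)) <= 4).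
  { rewrite <- Cmod_sqr. pose proof (Cmod_sub_le C1 (vdot N z a)) as P. rewrite Cmod_1 in P.
    pose proof (vdot_ball_lt1 N z a Hz Ha). pose proof (Cmod_ge0 (Csub C1 (vdot N z a))). nra. }
  destruct (H2 z Hz) as [_ Hez]. nra.
Qed.
End DirichletNorm.

(** * The explicit adjoint of a composition operator *)

Section Adjoint.
Variable N : nat.
Variables psi chi : vec -> vec.
Hypothesis Hpsi : inverse_pair N psi chi.

(** For the full inner product the kernel at b = psi 0 is 1 + k_b, so the first summand accounts for
    the product f(psi 0) conj g(0) of constant terms. The second is g o chi normalised at 0, the
    adjoint for the seminorm, on which C_psi is unitary. *)
Definition adjoint_comp (g : vec -> C) (z : vec) : C :=
  Cadd (Cmul (g vzero) (Cadd C1 (kfunc N (psi vzero) z))) (Csub (g (chi z)) (g (chi vzero))).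

Lemma ball_psi0 : in_ball N (psi vzero).
Proof. apply Hpsi, in_ball_zero. Qed.

Lemma inD_adjoint_comp g : inD N g -> inD N (adjoint_comp g).
Proof.
  intros Hg. unfold adjoint_comp.
  apply (inD_add N (fun z => Cmul (g vzero) (Cadd C1 (kfunc N (psi vzero) z))) (fun z => Csub (g (chi z)) (g (chi vzero)))).
  - apply inD_scal. apply (inD_add N (fun _ => C1)); [apply inD_const|apply inD_kfunc, ball_psi0].
  - exact (inD_sub N (Ccomp g chi) (fun _ => g (chi vzero))
      (inD_comp N chi psi g (inverse_pair_sym N _ _ Hpsi) Hg) (inD_const N _)).
Qed.

Lemma adjoint_comp_spec : is_adjoint_comp N psi adjoint_comp.
Proof.
  intros g Hg. split; [now apply inD_adjoint_comp|]. intros f Hf.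
  apply inD_rep in Hf. destruct Hf as [_ [c Hc]]. apply inD_rep in Hg. destruct Hg as [_ [d Hd]].
  destruct (rep_comp N psi chi f c Hpsi Hc) as [c1 [Hc1 Pc]].
  destruct (rep_comp N chi psi g d (inverse_pair_sym N _ _ Hpsi) Hd) as [d1 [Hd1 Pd]].
  pose proof (proj1 Hc) as Fc. pose proof (proj1 Hd) as Fd. pose proof (proj1 Hd1) as Fd1.
  pose proof (fin_kc N _ ball_psi0) as Fk.
  assert (HA : rep N (adjoint_comp g) (cfadd (cfscal (g vzero) (kc (psi vzero))) d1)).
  { split; [apply fin_add; [now apply fin_scal|exact Fd1]|]. intros z Hz.
    rewrite eval_add, eval_scal, eval_kc by auto using fin_scal, ball_psi0.
    unfold adjoint_comp. rewrite kfunc_vzero. pose proof (proj2 Hd1 z Hz) as E. unfold Ccomp in E.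
    rewrite E. unfold kfunc. ring. }
  rewrite (Dinner_rep N _ _ _ _ Hc1 Hd), (Dinner_rep N _ _ _ _ Hc HA).
  assert (E0 : adjoint_comp g vzero = g vzero) by (unfold adjoint_comp; rewrite kfunc_vzero; ring).
  rewrite E0, sip_add_r, sip_scal_kc by auto using fin_scal, ball_psi0.
  (* As d1 is the pullback of d under chi, d is the pullback of d1 under psi; so pairing c1 with d
     amounts to pairing c with d1. *)
  assert (P : pullback N psi d1 d).
  { split; [exact Fd|]. intros z Hz.
    assert (Hpz : in_ball N (psi z)) by now apply Hpsi.
    rewrite !(proj2 Pd) by auto using ball_psi0.
    assert (I : forall x, in_ball N x -> chi (psi x) = x) by (intros x Hx; now apply Hpsi).
    rewrite !I by auto using in_ball_zero. rewrite (eval_vzero N d Fd). ring. }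
  rewrite (sip_pullback N psi chi c d1 c1 d Hpsi Fc Fd1 Pc P).
  unfold Ccomp. rewrite (proj2 Hc (psi vzero) ball_psi0). ring.
Qed.

(* The adjoint is determined on the ball by pairing with the constants and the kernels. *)
Lemma adjoint_comp_unique A : is_adjoint_comp N psi A -> forall g, inD N g ->
  forall z, in_ball N z -> A g z = adjoint_comp g z.
Proof.
  intros HA g Hg. destruct (HA g Hg) as [D1 I1]. destruct (adjoint_comp_spec g Hg) as [D2 I2].
  apply inD_rep in D1. destruct D1 as [_ [c Hc]]. apply inD_rep in D2. destruct D2 as [_ [d Hd]].
  assert (H0 : A g vzero = adjoint_comp g vzero).
  { pose proof (I1 _ (inD_const N C1)) as E1. rewrite (I2 _ (inD_const N C1)) in E1.
    rewrite (Dinner_rep N _ _ _ _ (rep_const N C1) Hc), (Dinner_rep N _ _ _ _ (rep_const N C1) Hd) in E1.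
    rewrite !sip_zero_l in E1.
    apply (f_equal Cconj) in E1. rewrite !Cconj_add, !Cconj_mul, !Cconj_conj in E1.
    transitivity (Cadd (Cmul (Cconj C1) (A g vzero)) (Cconj C0)); [Csolve|]. rewrite <- E1. Csolve. }
  intros z Hz. pose proof (I1 _ (inD_kfunc N z Hz)) as E1. rewrite (I2 _ (inD_kfunc N z Hz)) in E1.
  rewrite (Dinner_rep N _ _ _ _ (rep_kfunc N z Hz) Hc), (Dinner_rep N _ _ _ _ (rep_kfunc N z Hz) Hd) in E1.
  rewrite !sip_kc_l, H0 in E1 by (apply Hc || apply Hd || exact Hz).
  rewrite (proj2 Hc z Hz), (proj2 Hd z Hz), H0. f_equal.
  rewrite <- (Cconj_conj (eval N c z)), <- (Cconj_conj (eval N d z)). f_equal.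
  set (x := Cmul _ _) in E1. transitivity (Csub (Cadd x (Cconj (eval N c z))) x); [ring|].
  rewrite <- E1. ring.
Qed.
End Adjoint.

Lemma Un_cv_0_of_bound (x : nat -> R) : (forall n, 0 <= x n) ->
  (forall eps, 0 < eps -> exists n0, forall n, (n0 <= n)%nat -> x n <= eps) -> Un_cv x 0.
Proof.
  intros H0 H eps He. destruct (H (eps / 2)) as [n0 Hn]; [lra|]. exists n0. intros n h.
  unfold Rdist. rewrite Rminus_0_r, Rabs_pos_eq by apply H0. specialize (Hn n h). lra.
Qed.

Lemma Ccv_add u v l m : Ccv u l -> Ccv v m -> Ccv (fun n => Cadd (u n) (v n)) (Cadd l m).
Proof.
  intros Hu Hv eps He. destruct (Hu (eps / 2)) as [n1 H1]; [lra|]. destruct (Hv (eps / 2)) as [n2 H2]; [lra|].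
  exists (Nat.max n1 n2). intros n Hn. specialize (H1 n ltac:(lia)). specialize (H2 n ltac:(lia)).
  replace (Csub (Cadd (u n) (v n)) (Cadd l m)) with (Cadd (Csub (u n) l) (Csub (v n) m)) by ring.
  eapply Rle_lt_trans; [apply Cmod_triangle|]. lra.
Qed.

(** * Compactness of the commutator *)

Section Commutator.
Variable N : nat.
Variables phi kap psi chi : vec -> vec.
Hypothesis Hphi : inverse_pair N phi kap.
Hypothesis Hpsi : inverse_pair N psi chi.
Variable A : (vec -> C) -> (vec -> C).
Hypothesis HA : is_adjoint_comp N psi A.

Let T := fun f => fsub (A (Ccomp f phi)) (Ccomp (A f) phi).
Let k1 := fun z => Cadd C1 (kfunc N (psi vzero) z).

Lemma commutator_eq f z : inD N f -> in_ball N z ->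
  T f z = Csub (Cadd (Cmul (f (phi vzero)) (k1 z)) (Csub (f (phi (chi z))) (f (phi (chi vzero)))))
               (Cadd (Cmul (f vzero) (k1 (phi z))) (Csub (f (chi (phi z))) (f (chi vzero)))).
Proof.
  intros Hf Hz. unfold T, fsub, Ccomp at 2.
  assert (Hpz : in_ball N (phi z)) by now apply Hphi.
  rewrite (adjoint_comp_unique N psi chi Hpsi A HA f Hf _ Hpz).
  rewrite (adjoint_comp_unique N psi chi Hpsi A HA _ (inD_comp N phi kap f Hphi Hf) _ Hz).
  reflexivity.
Qed.

Lemma inD_commutator f : inD N f -> inD N (T f).
Proof.
  intros Hf. apply inD_sub.
  - apply HA. now apply (inD_comp N phi kap).
  - apply (inD_comp N phi kap); [exact Hphi|]. now apply HA.
Qed.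

(** When the maps commute, the terms f(phi(chi z)) and f(chi(phi z)) cancel, and T f is a
    combination of [k1], [k1] o phi and 1. The three coefficients are bounded along the sequence, so
    Bolzano-Weierstrass suffices. *)
Lemma commutator_compact : (forall z, in_ball N z -> phi (psi z) = psi (phi z)) -> compact_op N T.
Proof.
  intros Hcomm u Hu [M HM].
  (* Commuting with psi amounts to commuting with its inverse. *)
  assert (Hc : forall z, in_ball N z -> phi (chi z) = chi (phi z)).
  { intros z Hz. assert (Hcz : in_ball N (chi z)) by now apply Hpsi.
    assert (Hpcz : in_ball N (phi (chi z))) by now apply Hphi.
    rewrite <- (proj1 (proj2 (proj2 (proj2 (proj2 Hpsi))) _ Hpcz)), <- Hcomm by exact Hcz.
    now rewrite (proj2 (proj2 (proj2 (proj2 (proj2 Hpsi))) _ Hz)). }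
  assert (B0 := in_ball_zero N).
  assert (Bp0 : in_ball N (phi vzero)) by now apply Hphi.
  assert (Bc0 : in_ball N (chi vzero)) by now apply Hpsi.
  assert (Bpc0 : in_ball N (phi (chi vzero))) by now apply Hphi.
  assert (Hk1 : inD N k1).
  { apply (inD_add N (fun _ => C1)); [apply inD_const|]. apply inD_kfunc. now apply Hpsi. }
  assert (Hk2 : inD N (Ccomp k1 phi)) by now apply (inD_comp N phi kap).
  set (p1 := fun n => u n (phi vzero)). set (p2 := fun n => Copp (u n vzero)).
  set (p3 := fun n => Csub (u n (chi vzero)) (u n (phi (chi vzero)))).
  set (lin := fun q1 q2 q3 z => Cadd (Cmul q1 (k1 z)) (Cadd (Cmul q2 (Ccomp k1 phi z)) q3)).
  assert (HT : forall n z, in_ball N z -> T (u n) z = lin (p1 n) (p2 n) (p3 n) z).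
  { intros n z Hz. rewrite commutator_eq, Hc by auto. unfold lin, p1, p2, p3, Ccomp. ring. }
  assert (Hlin : forall q1 q2 q3, inD N (lin q1 q2 q3)).
  { intros q1 q2 q3. apply (inD_add N (fun z => Cmul q1 (k1 z)) (fun z => Cadd (Cmul q2 (Ccomp k1 phi z)) q3)).
    - now apply inD_scal.
    - apply (inD_add N (fun z => Cmul q2 (Ccomp k1 phi z)) (fun _ => q3)); [now apply inD_scal|apply inD_const]. }
  set (D := Dnorm N k1 + Dnorm N (Ccomp k1 phi) + Dnorm N (fun _ => C1) + 1).
  assert (HD : 0 < D /\ Dnorm N k1 <= D /\ Dnorm N (Ccomp k1 phi) <= D /\ Dnorm N (fun _ => C1) <= D).
  { unfold D. pose proof (Dnorm_ge0 N k1). pose proof (Dnorm_ge0 N (Ccomp k1 phi)).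
    pose proof (Dnorm_ge0 N (fun _ => C1)). lra. }
  assert (Hnorm : forall q1 q2 q3, Dnorm N (lin q1 q2 q3) <= 4 * D * (Cmod q1 + Cmod q2 + Cmod q3)).
  { intros q1 q2 q3.
    pose proof (Dnorm_add_le N (fun z => Cmul q1 (k1 z)) (fun z => Cadd (Cmul q2 (Ccomp k1 phi z)) q3)
      (inD_scal N q1 _ Hk1) (inD_add N (fun z => Cmul q2 (Ccomp k1 phi z)) (fun _ => q3) (inD_scal N q2 _ Hk2) (inD_const N q3))) as P1.
    pose proof (Dnorm_add_le N (fun z => Cmul q2 (Ccomp k1 phi z)) (fun _ => q3)
      (inD_scal N q2 _ Hk2) (inD_const N q3)) as P2.
    pose proof (Dnorm_scal N q3 (fun _ => C1) (inD_const N C1)) as P3.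
    cbv beta in P3. replace (fun _ : vec => Cmul q3 C1) with (fun _ : vec => q3) in P3
      by (apply functional_extensionality; intros ?; ring).
    rewrite P3, (Dnorm_scal N q2 _ Hk2) in P2. rewrite (Dnorm_scal N q1 _ Hk1) in P1.
    fold (lin q1 q2 q3) in P1.
    pose proof (Cmod_ge0 q1). pose proof (Cmod_ge0 q2). pose proof (Cmod_ge0 q3).
    destruct HD as (D0 & D1 & D2 & D3).
    assert (X1 := Rmult_le_compat_l (Cmod q1) _ _ ltac:(lra) D1).
    assert (X2 := Rmult_le_compat_l (Cmod q2) _ _ ltac:(lra) D2).
    assert (X3 := Rmult_le_compat_l (Cmod q3) _ _ ltac:(lra) D3).
    assert (0 <= D * Cmod q1) by (apply Rmult_le_pos; lra). lra. }
  assert (Hbd : forall z, in_ball N z -> exists K, forall n, Cmod (u n z) <= K).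
  { intros z Hz. destruct (value_bounded N z Hz) as [K [HK HKb]]. exists (K * M). intros n.
    eapply Rle_trans; [now apply HKb|]. now apply Rmult_le_compat_l. }
  destruct (Hbd _ Bp0) as [K1 HK1]. destruct (Hbd _ B0) as [K2 HK2].
  destruct (Hbd _ Bc0) as [K3 HK3]. destruct (Hbd _ Bpc0) as [K4 HK4].
  destruct (bounded_subsequence_C p1 K1 HK1) as [s1 [l1 [Hs1 L1]]].
  destruct (bounded_subsequence_C (fun n => p2 (s1 n)) K2) as [s2 [l2 [Hs2 L2]]].
  { intros n. unfold p2. rewrite Cmod_opp. apply HK2. }
  destruct (bounded_subsequence_C (fun n => p3 (s1 (s2 n))) (K3 + K4)) as [s3 [l3 [Hs3 L3]]].
  { intros n. unfold p3. eapply Rle_trans; [apply Cmod_sub_le|]. now apply Rplus_le_compat. }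
  set (s := fun k => s1 (s2 (s3 k))).
  assert (Hs : strictly_inc s).
  { apply (strictly_inc_comp s1 (fun k => s2 (s3 k))); [exact Hs1|]. now apply strictly_inc_comp. }
  exists s. split; [exact Hs|]. exists (lin l1 l2 l3). split; [apply Hlin|].
  assert (M1 : Ccv (fun k => p1 (s k)) l1).
  { apply (Ccv_subseq (fun n => p1 (s1 n)) l1 (fun k => s2 (s3 k))); [now apply strictly_inc_comp|exact L1]. }
  assert (M2 : Ccv (fun k => p2 (s k)) l2).
  { apply (Ccv_subseq (fun n => p2 (s1 (s2 n))) l2 s3); assumption. }
  apply Un_cv_0_of_bound; [intros; apply Dnorm_ge0|]. intros eps He.
  assert (He' : 0 < eps / (12 * D)) by (apply Rdiv_lt_0_compat; lra).
  destruct (M1 _ He') as [n1 N1]. destruct (M2 _ He') as [n2 N2]. destruct (L3 _ He') as [n3 N3].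
  exists (Nat.max n1 (Nat.max n2 n3)). intros n Hn.
  specialize (N1 n ltac:(lia)). specialize (N2 n ltac:(lia)). specialize (N3 n ltac:(lia)).
  fold (s n) in N3.
  rewrite <- (Dnorm_ext N (lin (Csub (p1 (s n)) l1) (Csub (p2 (s n)) l2) (Csub (p3 (s n)) l3))).
  - eapply Rle_trans; [apply Hnorm|].
    replace eps with (4 * D * (eps / (12 * D) + eps / (12 * D) + eps / (12 * D))) by (field; lra).
    apply Rmult_le_compat_l; lra.
  - apply Hlin.
  - intros z Hz. unfold fsub.
    change (Csub (A (Ccomp (u (s n)) phi) z) (Ccomp (A (u (s n))) phi z)) with (T (u (s n)) z).
    rewrite HT by exact Hz. unfold lin. ring.
Qed.

(* Near the boundary: otherwise test the commutator on normalized kernels k_w / |k_w|,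
   which tend weakly to 0, and evaluate at [psi (kap w)], where the two composition terms
   give |k_w|^2 and a bounded quantity. *)
Lemma compact_boundary : compact_op N T -> forall delta, 0 < delta ->
  exists r, r < 1 /\ forall w, in_ball N w -> r < vnorm N w ->
    vnorm2 N (vadd (chi (phi (psi (kap w)))) (vscal (Copp C1) w)) <= delta.
Proof.
  intros HT delta Hdelta.
  set (gam := fun w => chi (phi (psi (kap w)))).
  destruct (excluded_middle_informative (exists r, r < 1 /\ forall w, in_ball N w -> r < vnorm N w ->
    vnorm2 N (vadd (gam w) (vscal (Copp C1) w)) <= delta)) as [h|h]; [exact h|exfalso].
  (* For this rate 1 - |w|^2 < 2 exp(- (n + 1)) < exp(- n), so the square norm of the n-th kernel is
     at least n. *)
  assert (Hex : forall n : nat, exists w, in_ball N w /\ 1 - exp (- INR (S n)) < vnorm N w /\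
    delta < vnorm2 N (vadd (gam w) (vscal (Copp C1) w))).
  { intros n. apply NNPP. intros hn. apply h. exists (1 - exp (- INR (S n))).
    pose proof (exp_pos (- INR (S n))). split; [lra|]. intros w Hw Hr.
    apply Rnot_lt_le. intros hl. apply hn. eauto. }
  set (w := fun n => proj1_sig (constructive_indefinite_description _ (Hex n))).
  assert (Hw : forall n, in_ball N (w n) /\ 1 - exp (- INR (S n)) < vnorm N (w n) /\
    delta < vnorm2 N (vadd (gam (w n)) (vscal (Copp C1) (w n)))).
  { intros n. unfold w. now destruct (constructive_indefinite_description _ (Hex n)). }
  pose proof (fun n => proj1 (Hw n)) as Bw.
  set (S := fun n => ip N (kc (w n)) (kc (w n))).
  assert (HS : forall n, INR n <= S n /\ 0 < S n).
  { intros n. unfold S. rewrite ip_kc_self by apply Bw.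
    destruct (Hw n) as [Hb [Hr _]]. apply in_ball_vnorm in Hb. rewrite <- vnorm_sqr.
    set (v := vnorm N (w n)) in *. pose proof (exp_pos (- INR (Datatypes.S n))) as Hp.
    assert (Hv : 0 < v).
    { pose proof (lt_0_INR (Datatypes.S n) ltac:(lia)).
      pose proof (exp_increasing (- INR (Datatypes.S n)) 0 ltac:(lra)) as E. rewrite exp_0 in E. lra. }
    assert (Hlow : 0 < 1 - v * v) by nra.
    assert (H2 : 1 - v * v < 2 * exp (- INR (Datatypes.S n))) by nra.
    assert (He : 2 * exp (- INR (Datatypes.S n)) < exp (- INR n)).
    { rewrite S_INR. replace (- (INR n + 1)) with (- INR n + - (1)) by ring. rewrite exp_plus.
      assert (E2 : 2 < exp 1) by (pose proof (exp_ineq1 1 ltac:(lra)); lra).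
      rewrite (exp_Ropp 1). pose proof (exp_pos (- INR n)) as Q. set (q := exp (- INR n)) in *.
      assert (0 < exp 1) by apply exp_pos.
      apply Rmult_lt_reg_r with (exp 1); [lra|].
      replace (2 * (q * / exp 1) * exp 1) with (2 * q) by (field; lra). nra. }
    assert (Hl : ln (1 - v * v) < - INR n).
    { rewrite <- (ln_exp (- INR n)). apply ln_increasing; lra. }
    pose proof (pos_INR n). lra. }
  set (s := fun n => sqrt (S n)).
  assert (Hs : forall n, 0 < s n /\ s n * s n = S n).
  { intros n. destruct (HS n) as [_ Hp]. unfold s. split; [now apply sqrt_lt_R0|apply sqrt_sqrt; lra]. }
  set (u := fun n z => Cmul (CR (/ s n)) (kfunc N (w n) z)).
  assert (Hu : forall n, inD N (u n)) by (intros n; apply inD_scal, inD_kfunc, Bw).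
  assert (Hu1 : forall n, Dnorm N (u n) = 1).
  { intros n. unfold u. destruct (Hs n) as [Hp Hsq].
    rewrite Dnorm_scal, (Dnorm_rep N _ _ (rep_kfunc N (w n) (Bw n))) by apply inD_kfunc, Bw.
    rewrite kfunc_vzero, Cmod_CR, Rabs_pos_eq by (left; now apply Rinv_0_lt_compat).
    replace (Cmod2 C0 + ip N (kc (w n)) (kc (w n))) with (S n) by (unfold Cmod2, S; simpl; ring).
    fold (s n). field. lra. }
  assert (Hu0 : forall n, u n vzero = C0) by (intros n; unfold u; rewrite kfunc_vzero; ring).
  destruct (HT u Hu) as [t [Ht [g [Hg Hlim]]]].
  { exists 1. intros n. rewrite Hu1. lra. }
  assert (B0 := in_ball_zero N).
  assert (Bphi : forall z, in_ball N z -> in_ball N (phi z)) by apply Hphi.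
  assert (Bkap : forall z, in_ball N z -> in_ball N (kap z)) by apply Hphi.
  assert (Bpsi : forall z, in_ball N z -> in_ball N (psi z)) by apply Hpsi.
  assert (Bchi : forall z, in_ball N z -> in_ball N (chi z)) by apply Hpsi.
  assert (Htn : forall n, (n <= t n)%nat) by exact (strictly_inc_ge t Ht).
  (* At a fixed z the kernels are bounded uniformly in w, while the normalising factor tends to
     0. *)
  assert (Hupt : forall z, in_ball N z -> Ccv (fun k => u (t k) z) C0).
  { intros z Hz eps He. pose proof (in_ball_vnorm N z Hz) as Hz1. set (K := 2 / (1 - vnorm N z)).
    assert (HK : 0 < K) by (apply Rdiv_lt_0_compat; lra).
    destruct (archimed_cor1 (eps * eps / (K * K))) as [n0 [H1 H2]].
    { apply Rdiv_lt_0_compat; nra. }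
    exists n0. intros n Hn. replace (Csub (u (t n) z) C0) with (u (t n) z) by ring.
    pose proof (kfunc_bound N (w (t n)) z (Bw _) Hz) as P. fold K in P.
    destruct (Hs (t n)) as [Hp Hsq]. destruct (HS (t n)) as [Hq _].
    unfold u. rewrite Cmod_mul, Cmod_CR, Rabs_pos_eq by (left; now apply Rinv_0_lt_compat).
    assert (Hn0 : 0 < INR n0) by now apply lt_0_INR.
    assert (Hnt : INR n0 <= S (t n)).
    { eapply Rle_trans; [|exact Hq]. apply le_INR. specialize (Htn n). lia. }
    assert (HKs : K < eps * s (t n)).
    { assert (K * K < (eps * s (t n)) * (eps * s (t n))).
      { replace (eps * s (t n) * (eps * s (t n))) with (eps * eps * S (t n)) by (rewrite <- Hsq; ring).
        apply Rlt_le_trans with (eps * eps * INR n0); [|apply Rmult_le_compat_l; nra].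
        apply Rmult_lt_compat_r with (r := INR n0 * (K * K)) in H1; [|apply Rmult_lt_0_compat; nra].
        replace (/ INR n0 * (INR n0 * (K * K))) with (K * K) in H1 by (field; lra).
        replace (eps * eps / (K * K) * (INR n0 * (K * K))) with (eps * eps * INR n0) in H1 by (field; lra).
        exact H1. }
      assert (0 < eps * s (t n)) by nra. nra. }
    apply Rmult_lt_reg_l with (s (t n)); [exact Hp|].
    rewrite <- Rmult_assoc, Rinv_r, Rmult_1_l by lra. lra. }
  (* Norm convergence implies pointwise convergence, and T u at z is a fixed linear combination of
     values of u, which tend to 0. So the norm limit of the images can only be 0. *)
  assert (Hg0 : forall z, in_ball N z -> g z = C0).
  { intros z Hz. apply (Ccv_unique (fun k => T (u (t k)) z)).
    - destruct (value_bounded N z Hz) as [K [HK HKb]]. intros eps He.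
      destruct (Hlim (eps / (K + 1))) as [n0 Hn]; [apply Rdiv_lt_0_compat; lra|].
      exists n0. intros n hn. specialize (Hn n hn). unfold Rdist in Hn.
      rewrite Rminus_0_r, Rabs_pos_eq in Hn by apply Dnorm_ge0.
      eapply Rle_lt_trans; [apply (HKb (fsub (T (u (t n))) g)); apply inD_sub; [now apply inD_commutator|exact Hg]|].
      replace eps with ((K + 1) * (eps / (K + 1))) by (field; lra).
      pose proof (Dnorm_ge0 N (fsub (T (u (t n))) g)). fold T in Hn. nra.
    - assert (L : forall c p, in_ball N p -> Ccv (fun k => Cmul c (u (t k) p)) C0).
      { intros c p Hp. replace C0 with (Cmul c C0) by ring. apply Ccv_mul_l. now apply Hupt. }
      pose proof (Ccv_add _ _ _ _ (L (k1 z) _ (Bphi _ B0))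
        (Ccv_add _ _ _ _ (L C1 _ (Bphi _ (Bchi _ Hz)))
        (Ccv_add _ _ _ _ (L (Copp C1) _ (Bphi _ (Bchi _ B0)))
        (Ccv_add _ _ _ _ (L (Copp (k1 (phi z))) _ B0)
        (Ccv_add _ _ _ _ (L (Copp C1) _ (Bchi _ (Bphi _ Hz))) (L C1 _ (Bchi _ B0))))))) as LL.
      match type of LL with Ccv ?F ?L => replace (fun k => T (u (t k)) z) with F;
        [replace C0 with L by ring; exact LL|] end.
      apply functional_extensionality; intros k. rewrite commutator_eq by auto. ring. }
  set (a := phi (chi vzero)).
  assert (Ba : in_ball N a) by (apply Bphi, Bchi, B0).
  set (c0 := (1 - vnorm2 N a) / 4).
  assert (Hc0 : 0 < c0 <= 1 / 4).
  { unfold c0. destruct Ba as [_ Ba]. pose proof (vnorm2_ge0 N a). lra. }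
  assert (Bb : in_ball N (psi vzero)) by auto.
  set (bd := fun z => 2 / (1 - vnorm N z)).
  assert (Hbd : forall z, in_ball N z -> 0 < bd z).
  { intros z Hz. apply in_ball_vnorm in Hz. apply Rdiv_lt_0_compat; lra. }
  (* C2 bounds everything except |k_x|^2: the product k_x(phi 0) k_(psi 0)(x'), the values of k_x at
     a and at chi (phi 0), and re k_x(gam x), which the gap delta controls. *)
  set (C2 := bd (phi vzero) * bd (psi vzero) + bd a + bd (chi (phi vzero)) + Rabs (ln (delta / 2))).
  pose proof (Hbd _ (Bphi _ B0)) as q1. pose proof (Hbd _ Bb) as q2. pose proof (Hbd _ Ba) as q3.
  pose proof (Hbd _ (Bchi _ (Bphi _ B0))) as q4. pose proof (Rabs_pos (ln (delta / 2))) as q5.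
  assert (HC2 : 0 < C2).
  { unfold C2. pose proof (Rmult_lt_0_compat _ _ q1 q2). lra. }
  (* With S m > 2 C2 + |ln c0| one gets S - C2 >= S / 2 and |k_x'|^2 <= 2 S. Then (S / 2)^2 <= 4
     |hh|^2 S^2, so |hh|^2 >= 1/16, whereas |hh| < 1/8. *)
  destruct (Hlim (1 / 8)) as [n1 Hn1]; [lra|].
  destruct (INR_unbounded (2 * C2 + Rabs (ln c0))) as [n2 Hn2].
  set (n := Nat.max n1 n2). specialize (Hn1 n ltac:(lia)).
  unfold Rdist in Hn1. rewrite Rminus_0_r, Rabs_pos_eq in Hn1 by apply Dnorm_ge0.
  change (Dnorm N (fsub (T (u (t n))) g) < 1 / 8) in Hn1.
  set (m := t n) in *. set (hh := fsub (T (u m)) g) in *.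
  assert (Hhh : inD N hh) by (apply inD_sub; [apply inD_commutator, Hu|exact Hg]).
  assert (HSm : 2 * C2 + Rabs (ln c0) < S m).
  { eapply Rlt_le_trans; [exact Hn2|]. eapply Rle_trans; [|apply HS]. apply le_INR.
    pose proof (Htn n). unfold m. lia. }
  destruct (Hs m) as [Hsm Hsq]. pose proof (Bw m) as Bm. destruct (Hw m) as [_ [_ Hgam]].
  (* Chosen so that phi (chi x') = x, the point where k_x takes the value |k_x|^2. *)
  set (x := w m) in *. set (x' := psi (kap x)).
  assert (Bx' : in_ball N x') by (apply Bpsi, Bkap, Bm).
  assert (Bgx : in_ball N (gam x)) by (apply Bchi, Bphi, Bx').
  assert (Ex : phi (chi x') = x).
  { unfold x'. destruct Hphi as (_ & _ & _ & _ & I1). destruct Hpsi as (_ & _ & _ & _ & I2).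
    rewrite (proj1 (I2 _ (Bkap _ Bm))). now apply I1. }
  pose proof (value_bound N hh x' Hhh Bx') as V.
  assert (HP : ip N (kc x') (kc x') <= S m + Rabs (ln c0)).
  { unfold S. fold x. rewrite !ip_kc_self by assumption.
    pose proof (automorphism_one_minus_norm N (fun z => psi (kap z)) (fun z => phi (chi z)) x
      (inverse_pair_comp N psi chi kap phi Hpsi (inverse_pair_sym N _ _ Hphi)) Bm) as Q.
    cbv beta in Q. fold a x' in Q. fold c0 in Q.
    destruct Bm as [_ Bm]. assert (0 < 1 - vnorm2 N x) by lra.
    assert (Hln : ln (c0 * (1 - vnorm2 N x)) <= ln (1 - vnorm2 N x')).
    { apply Rcomplements.ln_le; [apply Rmult_lt_0_compat; lra|exact Q]. }
    rewrite ln_mult in Hln by lra. pose proof (Rle_abs (- ln c0)) as R. rewrite Rabs_Ropp in R. lra. }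
  assert (Ediff : Cmul (CR (s m)) (Csub (hh x') (hh vzero)) =
    Cadd (Cadd (Cmul (kfunc N x (phi vzero)) (kfunc N (psi vzero) x')) (kfunc N x x))
         (Cadd (Cadd (Copp (kfunc N x a)) (Copp (kfunc N x (gam x)))) (kfunc N x (chi (phi vzero))))).
  { unfold hh, fsub at 1 2. rewrite !Hg0, !commutator_eq by auto. rewrite Ex, Hu0.
    fold a. unfold k1. rewrite kfunc_vzero. change (chi (phi x')) with (gam x).
    unfold u. fold x.
    assert (E1 : Cmul (CR (s m)) (CR (/ s m)) = C1).
    { rewrite <- CR_mul, Rinv_r by lra. reflexivity. }
    set (X := CR (s m)) in *. set (Y := CR (/ s m)) in *.
    match goal with |- ?L = ?R => transitivity (Cmul (Cmul X Y) R); [ring|rewrite E1; ring] end. }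
  assert (Hre : S m - C2 <= s m * Cmod (Csub (hh x') (hh vzero))).
  { rewrite <- (Rabs_pos_eq (s m)), <- Cmod_CR, <- Cmod_mul, Ediff by lra.
    eapply Rle_trans; [|apply re_le_Cmod]. cbn [re Cadd Copp].
    assert (E1 : re (kfunc N x x) = S m).
    { unfold kfunc, S. fold x. change (ip N (kc x) (kc x)) with (re (eval N (kc x) x)).
      now rewrite eval_kc. }
    rewrite E1.
    pose proof (Rabs_re_le (Cmul (kfunc N x (phi vzero)) (kfunc N (psi vzero) x'))) as R1.
    rewrite Cmod_mul in R1.
    pose proof (kfunc_bound N x (phi vzero) Bm (Bphi _ B0)) as R2.
    pose proof (kfunc_bound_r N (psi vzero) x' Bb Bx') as R3.
    pose proof (Rmult_le_compat _ _ _ _ (Cmod_ge0 _) (Cmod_ge0 _) R2 R3) as R4.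
    pose proof (Rle_trans _ _ _ (Rabs_re_le _) (kfunc_bound N x a Bm Ba)) as R5.
    pose proof (Rle_trans _ _ _ (Rabs_re_le _) (kfunc_bound N x _ Bm (Bchi _ (Bphi _ B0)))) as R6.
    (* Both points lie in the ball, so delta < |gam x - x|^2 < 2 re (1 - <gam x, x>). *)
    assert (R7 : re (kfunc N x (gam x)) <= Rabs (ln (delta / 2))).
    { unfold kfunc. rewrite re_Llog by now apply vdot_ball_lt1.
      pose proof (Rle_abs (- ln (delta / 2))) as Q. rewrite Rabs_Ropp in Q.
      assert (ln (delta / 2) <= ln (Cmod (Csub C1 (vdot N (gam x) x)))); [|lra].
      apply Rcomplements.ln_le; [lra|].
      rewrite vnorm2_add, vnorm2_scal, vdot_scal_r in Hgam.
      pose proof (re_le_Cmod (Csub C1 (vdot N (gam x) x))) as Z. unfold Cmod2 in Hgam. simpl in Hgam, Z.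
      destruct Bgx as [_ Bgx]. destruct Bm as [_ Bm]. lra. }
    apply Rabs_le_between in R5. apply Rabs_le_between in R6.
    pose proof (Rle_trans _ _ _ R1 R4) as R8. apply Rabs_le_between in R8.
    unfold C2, bd. cbn [re Cmul] in R8 |- *. lra. }
  set (d := Cmod (Csub (hh x') (hh vzero))) in *.
  assert (Hd2 : d * d = Cmod2 (Csub (hh x') (hh vzero))) by apply Cmod_sqr.
  set (Dn := Dnorm N hh) in *. pose proof (Dnorm_ge0 N hh) as Dn0. fold Dn in Dn0.
  assert (V1 : d * d <= 2 * (Dn * Dn * (2 * S m))).
  { rewrite Hd2. eapply Rle_trans; [exact V|].
    apply Rmult_le_compat_l; [lra|]. apply Rmult_le_compat_l; [nra|]. lra. }
  pose proof (Rabs_pos (ln c0)) as q6.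
  assert (V2 : (S m / 2) * (S m / 2) <= (s m * d) * (s m * d)) by nra.
  assert (V3 : (s m * d) * (s m * d) = S m * (d * d)) by (rewrite <- Hsq; ring).
  assert (V4 : S m * (d * d) <= S m * (2 * (Dn * Dn * (2 * S m)))) by (apply Rmult_le_compat_l; lra).
  assert (V5 : Dn * Dn < 1 / 64) by nra.
  assert (V6 : 0 < S m * S m) by nra.
  assert (V7 : Dn * Dn * (S m * S m) <= 1 / 64 * (S m * S m)) by (apply Rmult_le_compat_r; lra).
  nra.
Qed.

(** By [compact_boundary] the difference gam z - z tends to 0 at the sphere, uniformly; the maximum
    principle with bound 0, on every slice and in every coordinate, gives gam = id. *)
Lemma compact_commute : (1 <= N)%nat -> compact_op N T ->
  forall z, in_ball N z -> phi (psi z) = psi (phi z).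
Proof.
  intros HN HT.
  pose proof (compact_boundary HT) as Hb.
  pose proof (inverse_pair_comp N _ _ _ _ (inverse_pair_comp N _ _ _ _ (inverse_pair_sym N _ _ Hpsi) Hphi)
    (inverse_pair_comp N _ _ _ _ Hpsi (inverse_pair_sym N _ _ Hphi))) as Hgam.
  cbv beta in Hgam. destruct Hgam as (G1 & G2 & _).
  set (gam := fun z => chi (phi (psi (kap z)))) in *.
  assert (Hslice : forall zeta i l, (i < N)%nat -> supp_in N zeta -> vnorm N zeta = 1 -> Cmod l < 1 ->
    gam (vscal l zeta) i = vscal l zeta i).
  { intros zeta i l Hi Hs Hn Hl. apply Csub_eq0, Cmod_eq0, Rle_antisym; [|apply Cmod_ge0].
    set (F := fsub (fun z => gam z i) (fun z => z i)).
    assert (HF : cdiff_disc (fun l => F (vscal l zeta))).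
    { apply (cdiff_slice N); [|exact Hs|exact Hn]. apply holo_sub; [now apply G1|now apply holo_coord]. }
    change (Cmod (F (vscal l zeta)) <= 0).
    apply (max_principle (fun l => F (vscal l zeta)) 0); [lra| | | |exact Hl].
    - intros y Hy. destruct (HF y Hy) as [d Hd]. exact (cderiv_ccont _ _ _ Hd).
    - intros y Hy. now apply HF.
    - intros eta He. destruct (Hb (eta * eta)) as [r [Hr Hbr]]; [nra|].
      exists r. split; [exact Hr|]. intros y [Hy1 Hy2].
      assert (By : in_ball N (vscal y zeta)) by now apply in_ball_unit_scal.
      specialize (Hbr _ By). rewrite vnorm_scal, Hn, Rmult_1_r in Hbr. specialize (Hbr Hy1).
      rewrite Rplus_0_l. unfold F, fsub.
      replace (Csub (gam (vscal y zeta) i) (vscal y zeta i)) with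
        (vadd (gam (vscal y zeta)) (vscal (Copp C1) (vscal y zeta)) i) by (unfold vadd, vscal at 2; ring).
      eapply Rle_trans; [apply (coord_le_vnorm N); exact Hi|].
      pose proof (vnorm_sqr N (vadd (gam (vscal y zeta)) (vscal (Copp C1) (vscal y zeta)))) as E.
      pose proof (vnorm_ge0 N (vadd (gam (vscal y zeta)) (vscal (Copp C1) (vscal y zeta)))).
      unfold gam in *. nra. }
  assert (Hid : forall z, in_ball N z -> gam z = z).
  { intros z Hz. apply (vec_ext N); [now apply G2|apply Hz|]. intros i Hi.
    destruct (excluded_middle_informative (z = vzero)) as [->|n].
    (* The origin determines no direction; any unit vector will do, and 1 <= N provides one. *)
    - set (e := fun j => if Nat.eqb j 0 then C1 else C0).
      replace vzero with (vscal C0 e) by (apply functional_extensionality; intros j; unfold vscal, vzero; ring).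
      apply Hslice; [exact Hi| | |rewrite Cmod_0; lra].
      + intros j Hj. unfold e. destruct (Nat.eqb_spec j 0); [lia|reflexivity].
      + unfold vnorm, vnorm2. destruct N as [|n]; [lia|]. cbn [seq map Rsum fold_right].
        fold (Rsum (map (fun i0 => Cmod2 (e i0)) (seq 1 n))).
        assert (E : Rsum (map (fun i0 => Cmod2 (e i0)) (seq 1 n)) = 0).
        { transitivity (Rsum (map (fun _ : nat => 0) (seq 1 n))); [|rewrite Rsum_const; ring].
          apply Rsum_ext. intros j Hj. apply in_seq in Hj. unfold e.
          destruct (Nat.eqb_spec j 0); [lia|]. unfold Cmod2; simpl; ring. }
        rewrite E. unfold e, Cmod2; simpl. replace (1 * 1 + 0 * 0 + 0) with 1 by ring. apply sqrt_1.
    - destruct (unit_direction N z Hz n) as [zeta [Hs [Hn [Ez Hp]]]]. rewrite Ez.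
      apply Hslice; try assumption. rewrite Cmod_CR, Rabs_pos_eq by lra. now apply in_ball_vnorm. }
  intros z Hz.
  pose proof Hphi as (_ & P2 & _ & P4 & I1). pose proof Hpsi as (_ & Q2 & _ & Q4 & I2).
  (* At phi z the identity gam = id reads chi (phi (psi z)) = phi z; psi is then applied to both
     sides. *)
  pose proof (Hid (phi z) (P2 z Hz)) as E. unfold gam in E. rewrite (proj1 (I1 z Hz)) in E.
  rewrite <- (proj2 (I2 _ (P2 _ (Q2 _ Hz)))). now rewrite E.
Qed.
End Commutator.

Theorem theorem4p3 (N : nat) (HN : (1 <= N)%nat) (phi psi : vec -> vec)
  (Hphi : automorphism N phi) (Hpsi : automorphism N psi) :
  (exists A, is_adjoint_comp N psi A) /\
  forall A, is_adjoint_comp N psi A ->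
    (compact_op N (fun f => fsub (A (Ccomp f phi)) (Ccomp (A f) phi))
     <-> (forall z, in_ball N z -> phi (psi z) = psi (phi z))).
Proof.
  destruct (automorphism_inverse N phi Hphi) as [kap Hk].
  destruct (automorphism_inverse N psi Hpsi) as [chi Hc].
  split.
  - exists (adjoint_comp N psi chi). now apply adjoint_comp_spec.
  - intros A HA. split.
    + now apply (compact_commute N phi kap psi chi).
    + now apply (commutator_compact N phi kap psi chi).
Qed.
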